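(* Let $f(x,y,z)=z^2+y^3+x^5$ and let $X=V(f)\subset\mathbb{C}^3$ (the $E_8$-singularity). Let $G(X)$ be the Gröbner fan of $X$, let $\mathcal{M}$ be the set of its maximal dimensional Gröbner cones, and let $$\mathcal{V}=\bigcup_{C\in\mathcal{M}}\big(p_C\cap\mathbb{Z}^3\big)\setminus\{0\},$$ where $p_C$ is the profile of $C$. Then there is a regular refinement $\Sigma$ of $G(X)$ whose rays are exactly the rays generated by the elements of $\mathcal{V}$, such that: (i) the associated toric morphism $\pi_\Sigma:X_\Sigma\to\mathbb{C}^3$ is an embedded toric resolution of $X$; moreover, for each $C\in\mathcal{M}$, every element of $(p_C\cap\mathbb{Z}^3)\setminus\{0\}$ is irreducible in $C$; (ii) the elements of $\mathcal{V}$ on the skeleton of $G(X)$ give the minimal resolution graph of the singularity. That is, let $\mathcal{S}$ be the set of vectors of $\mathcal{V}$ with all coordinates strictly positive which lie on the skeleton of $G(X)$. Then the exceptional curves of $\widetilde{X}\to X$ are exactly the irreducible components of the sets $\widetilde{X}\cap D_u$ for $u\in\mathcal{S}$ (each of these sets being nonempty), and the resolution graph of $\widetilde X\to X$ is the graph of the minimal resolution of $X$.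
   Context: For $v\in(\mathbb{R}_{\ge0})^3$ and $f=\sum_\alpha c_\alpha x^{\alpha_1}y^{\alpha_2}z^{\alpha_3}$, let $o_v(f)=\min\{v\cdot\alpha : c_\alpha\ne0\}$ and let $In_v(f)$ be the sum of the terms $c_\alpha x^{\alpha_1}y^{\alpha_2}z^{\alpha_3}$ with $c_\alpha\neq 0$ and $v\cdot\alpha=o_v(f)$. The closure of $\{w\in(\mathbb{R}_{\ge0})^3: In_w(f)=In_v(f)\}$ is a polyhedral cone, called a Gröbner cone. The Gröbner fan $G(X)$ is the fan with support $(\mathbb{R}_{\ge0})^3$ formed by these cones (together with their faces). In the present case the maximal dimensional Gröbner cones are $\langle(1,0,0),(0,0,1),(6,10,15)\rangle$ (initial form $y^3$), $\langle(0,1,0),(0,0,1),(6,10,15)\rangle$ (initial form $x^5$) and $\langle(1,0,0),(0,1,0),(6,10,15)\rangle$ (initial form $z^2$), where $\langle\cdot\rangle$ denotes the cone of nonnegative real combinations. The skeleton of $G(X)$ is the union of its cones of dimension at most $2$. Profile: for a strongly convex rational cone $C=\langle v_1,\dots,v_r\rangle$ with primitive extremal generators $v_1,\dots,v_r$, the profile $p_C$ is the bounded region of $C$ given by the convex hull of $0,v_1,\dots,v_r$. (In the cases considered here, $v_1,\dots,v_r$ all lie on a single hyperplane.) A nonzero vector of $C\cap\mathbb{Z}^3$ is irreducible in $C$ if it is not the sum of two nonzero vectors of $C\cap\mathbb{Z}^3$. A cone is regular if its primitive generators are part of a $\mathbb{Z}$-basis of $\mathbb{Z}^3$; a fan is regular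 if all its cones are. A regular refinement of $G(X)$ is a regular fan $\Sigma$ with support $(\mathbb{R}_{\ge0})^3$ such that each cone of $G(X)$ is a union of cones of $\Sigma$. The toric morphism $\pi_\Sigma:X_\Sigma\to\mathbb{C}^3$ is an embedded toric resolution of $X$ if it is proper and birational, $X_\Sigma$ is smooth, and the irreducible components of the total transform $\pi_\Sigma^{-1}(X)$ are smooth and meet transversally. $\widetilde{X}\subset X_\Sigma$ denotes the strict transform of $X$, and $D_u\subset X_\Sigma$ is the torus-invariant prime divisor of the ray generated by $u$. The exceptional curves of $\widetilde X\to X$ are the irreducible curves in $\widetilde X$ contracted to a point. The resolution graph has one vertex for each exceptional curve, weighted by its self-intersection in $\widetilde X$, and edges given by intersections. *)

(* Defs.v *)
From HB Require Import structures.
From mathcomp Require Import all_boot all_order all_algebra.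
From mathcomp.real_closed Require Import complex.
From mathcomp Require Import boolp classical_sets functions cardinality reals.
From mathcomp Require Import topology.
From mathcomp Require Import mpoly.

Set Implicit Arguments.
Unset Strict Implicit.
Unset Printing Implicit Defensive.

Import Order.TTheory GRing.Theory Num.Theory numFieldTopology.Exports.
Local Open Scope ring_scope.
Local Open Scope classical_set_scope.
Local Open Scope complex_scope.
Local Open Scope card_scope.

(* Complex algebraic varieties are modelled as "spaces with functions": a set
   of closed points, its Zariski open sets, and for each open set U the
   complex-valued functions regular on U.  Functions are total, only their
   values on U matter.  The axioms are collected in [variety] below. *)
Record space (R : realType) := Space {
  pt :> Type;
  zopen : set (set pt);
  regular : set pt -> set (pt -> R[i])
}.

Section Spaces.
Variable R : realType.
Local Notation C := R[i].
Implicit Types X Y : space R.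

Definition zclosed X (A : set X) : Prop := zopen (~` A).

Definition zclosure X (A : set X) : set X :=
  [set x | forall U : set X, zopen U -> U x -> U `&` A !=set0].

Definition zdense X (A : set X) : Prop :=
  forall U : set X, zopen U -> U !=set0 -> U `&` A !=set0.

Definition irreducible X (A : set X) : Prop :=
  A !=set0 /\ forall F G : set X, zclosed F -> zclosed G ->
    A `<=` F `|` G -> A `<=` F \/ A `<=` G.

Definition component X (Z A : set X) : Prop :=
  [/\ A `<=` Z, irreducible A &
      forall B : set X, B `<=` Z -> irreducible B -> A `<=` B -> B = A].

Definition around X (p : X) (P : X -> Prop) : Prop :=
  exists U : set X, [/\ zopen U, U p & forall y, U y -> P y].

(* [g] represents an element of the local ring of X at p *)
Definition germ X (p : X) (g : X -> C) : Prop :=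
  exists U : set X, [/\ zopen U, U p & regular U g].

Definition sub_space X (A : set X) : space R :=
  @Space R {x : X | A x}
    [set U | exists2 V : set X, zopen V & U = [set x | V (sval x)]]
    (fun U => [set g | forall x, U x -> exists V : set X, exists h : X -> C,
       [/\ zopen V, V (sval x), regular V h &
           forall y, U y -> V (sval y) -> g y = h (sval y)]]).

Definition trace X (Z A : set X) : set (sub_space Z) :=
  [set x | A (sval x)].

Definition regular_map X Y (phi : X -> Y) : Prop :=
  forall V : set Y, zopen V ->
    zopen (phi @^-1` V) /\
    forall g : Y -> C, regular V g -> regular (phi @^-1` V) (g \o phi).

Definition isomorphism X Y (phi : X -> Y) : Prop :=
  regular_map phi /\
  exists psi : Y -> X, [/\ regular_map psi, cancel phi psi & cancel psi phi].

Definition isomorphic X Y : Prop := exists phi : X -> Y, isomorphism phi.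

Definition eval n (p : {mpoly C[n]}) (x : 'rV[C]_n) : C :=
  p.@[fun i => x 0 i].

Definition zero_locus n (S : set {mpoly C[n]}) : set 'rV[C]_n :=
  [set x | forall p, S p -> eval p x = 0].

Definition affine_space n : space R :=
  @Space R 'rV[C]_n
    [set U | exists S : set {mpoly C[n]}, ~` U = zero_locus S]
    (fun U => [set g | forall x, U x -> exists p q : {mpoly C[n]},
       eval q x != 0 /\
       forall y, U y -> eval q y != 0 -> g y = eval p y / eval q y]).

Definition P1_coord (x : option C) (i : 'I_2) : C :=
  if x is Some a then (if i == 0 then a else 1) else (if i == 0 then 1 else 0).

Definition projective_line : space R :=
  @Space R (option C)
    [set U | exists2 S : set {mpoly C[2]},
       (forall p, S p -> exists d, p \is d.-homog) &
       ~` U = [set x | forall p, S p -> p.@[P1_coord x] = 0]]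
    (fun U => [set g | forall x, U x ->
       exists d, exists p q : {mpoly C[2]},
       [/\ p \is d.-homog, q \is d.-homog, q.@[P1_coord x] != 0 &
           forall y, U y -> q.@[P1_coord y] != 0 ->
             g y = p.@[P1_coord y] / q.@[P1_coord y]]]).

Definition affine_variety X : Prop :=
  exists n, exists Z : set (affine_space n),
    zclosed Z /\ isomorphic X (sub_space Z).

Definition zseparated X : Prop :=
  forall (Z : space R) (f g : Z -> X),
    affine_variety Z -> regular_map f -> regular_map g ->
    zclosed [set z | f z = g z].

Definition variety X : Prop :=
  [/\ [/\ zopen [set: X],
          (forall U V : set X, zopen U -> zopen V -> zopen (U `&` V)) &
          (forall F : set (set X), F `<=` @zopen R X ->
             zopen (\bigcup_(U in F) U))],
      (forall (U : set X) (g : X -> C), zopen U ->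
         (regular U g <-> forall x, U x -> exists V : set X, exists h : X -> C,
            [/\ zopen V, V x, regular V h &
                forall y, U y -> V y -> g y = h y])),
      (exists k, exists U : 'I_k -> set X,
         (forall i, zopen (U i) /\ affine_variety (sub_space (U i))) /\
         \bigcup_i U i = setT) &
      zseparated X].

(* Smooth of dimension d at p: locally isomorphic to the zero set, in an open
   subset of affine (d+r)-space, of r polynomials with independent
   differentials. *)
Definition smooth_at d X (p : X) : Prop :=
  exists (U : set X) (r : nat) (g : 'I_r -> {mpoly C[d + r]})
         (W : set (affine_space (d + r)))
         (phi : sub_space U ->
                @sub_space (affine_space (d + r))
                  (W `&` [set x | forall i, eval (g i) x = 0]))
         (Up : U p),
    [/\ zopen U, zopen W, isomorphism phi &
        \rank (\matrix_(i < r, j < d + r)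
                 eval (mderiv j (g i)) (sval (phi (exist _ p Up)))) = r].

Definition smooth d X : Prop := forall p : X, smooth_at d p.

(* Mumford's basis of the classical (analytic) topology.  In R[i], [0 < eps]
   says that eps is a positive real number, and the norm is the modulus. *)
Definition classical_open X (A : set X) : Prop :=
  forall x, A x -> exists (V : set X) (k : nat) (g : 'I_k -> X -> C) (eps : C),
    [/\ zopen V, V x, (forall i, regular V (g i)), 0 < eps &
        forall y, V y -> (forall i, `|g i y - g i x| < eps) -> A y].

Definition classical_compact X (K : set X) : Prop :=
  forall (I : Type) (U : I -> set X), (forall i, classical_open (U i)) ->
    K `<=` \bigcup_i U i ->
    exists k, exists s : 'I_k -> I, K `<=` \bigcup_j U (s j).

Definition proper_map X Y (phi : X -> Y) : Prop :=
  regular_map phi /\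
  forall K : set Y, classical_compact K -> classical_compact (phi @^-1` K).

Definition birational X Y (phi : X -> Y) : Prop :=
  exists (U : set X) (V : set Y) (psi : sub_space U -> sub_space V),
    [/\ zopen U /\ zdense U, zopen V /\ zdense V, isomorphism psi &
        forall x, sval (psi x) = phi (sval x)].

(* the ideal of Z in the local ring at p is generated by g *)
Definition local_equation X (Z : set X) (p : X) (g : X -> C) : Prop :=
  [/\ germ p g, around p (fun y => Z y -> g y = 0) &
      forall h, germ p h -> around p (fun y => Z y -> h y = 0) ->
        exists2 a, germ p a & around p (fun y => h y = a y * g y)].

Definition max_ideal_sqr X (p : X) (h : X -> C) : Prop :=
  exists (k : nat) (a b : 'I_k -> X -> C),
    [/\ (forall j, germ p (a j) /\ a j p = 0),
        (forall j, germ p (b j) /\ b j p = 0) &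
        around p (fun y => h y = \sum_j a j y * b j y)].

(* the local equations are linearly independent in the cotangent space *)
Definition transversal_at X (p : X) k (Z : 'I_k -> set X) : Prop :=
  exists2 g : 'I_k -> X -> C,
    (forall i, local_equation (Z i) p (g i)) &
    forall c : 'I_k -> C,
      max_ideal_sqr p (fun y => \sum_i c i * g i y) -> forall i, c i = 0.

Definition components_meet_transversally X (T : set X) : Prop :=
  forall (p : X) k (Z : 'I_k -> set X), injective Z ->
    (forall i, component T (Z i) /\ Z i p) -> transversal_at p Z.

(* the quotient of the local ring at p by (a) has complex dimension n *)
Definition colength X (p : X) (a : X -> C) (n : nat) : Prop :=
  exists b : 'I_n -> X -> C,
    [/\ (forall i, germ p (b i)),
        (forall h, germ p h -> exists (c : 'I_n -> C) (q : X -> C),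
           germ p q /\
           around p (fun y => h y = \sum_i c i * b i y + a y * q y)) &
        (forall (c : 'I_n -> C) (q : X -> C), germ p q ->
           around p (fun y => \sum_i c i * b i y = a y * q y) ->
           forall i, c i = 0)].

(* an irreducible closed subset of Krull dimension 1 *)
Definition curve X (E : set X) : Prop :=
  [/\ zclosed E, irreducible E, (forall p, E <> [set p]) &
      forall F : set X, zclosed F -> irreducible F -> F `<=` E -> F <> E ->
        exists p, F = [set p]].

(* Let h be a rational function, regular on U, that is a local equation of
   the curve E at the points of U `&` E.  Then 1/h is a rational section of
   the line bundle O(E) that is a generator at the generic point of E;
   [section_order E U h p n] says that its restriction to E has order n at p:
   if e is a local equation of E at p and h = e a / b, this order is that of
   (b / a) restricted to E. *)
Definition section_order X (E U : set X) (h : X -> C) (p : sub_space E)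
    (n : int) : Prop :=
  exists (e a b : X -> C) (k l : nat),
    [/\ local_equation E (sval p) e,
        germ (sval p) a /\ germ (sval p) b,
        around (sval p) (fun y => U y -> h y * b y = e y * a y),
        @colength (sub_space E) p (a \o sval) k /\
        @colength (sub_space E) p (b \o sval) l &
        n = l%:Z - k%:Z].

(* E.E = n, where E.E is the degree of the restriction to E of O(E); for a
   complete curve E it does not depend on the rational section. *)
Definition self_intersection X (E : set X) (n : int) : Prop :=
  exists (U : set X) (h : X -> C) (ord : sub_space E -> int)
         (k : nat) (q : 'I_k -> sub_space E),
    [/\ [/\ zopen U, regular U h & U `&` E !=set0],
        (forall p, U p -> E p -> local_equation E p h),
        (forall p, section_order U h p (ord p)),
        injective q /\ (forall p, ord p <> 0 -> exists i, p = q i) &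
        n = \sum_i ord (q i)].

Definition resolution Y X (rho : Y -> X) : Prop :=
  [/\ variety Y, irreducible [set: Y], smooth 2 Y, proper_map rho &
      birational rho].

Definition exceptional_curve Y X (rho : Y -> X) (E : set Y) : Prop :=
  curve E /\ exists x, forall y, E y -> rho y = x.

(* No exceptional curve is a (-1)-curve.  As E.E is well defined, the
   existential over n says that E.E differs from -1. *)
Definition minimal_resolution Y X (rho : Y -> X) : Prop :=
  resolution rho /\
  forall E : set Y, exceptional_curve rho E ->
    isomorphic (sub_space E) projective_line ->
    exists2 n, self_intersection E n & n <> -1.

(* [edges v w] is the number of edges joining v and w *)
Record weighted_graph := WeightedGraph {
  vertex : finType;
  weight : vertex -> int;
  edges : vertex -> vertex -> nat
}.

Definition resolution_graph Y X (rho : Y -> X) (G : weighted_graph) : Prop :=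
  exists E : vertex G -> set Y,
    [/\ injective E,
        (forall D, exceptional_curve rho D <-> exists v, D = E v),
        (forall v, self_intersection (E v) (weight v)),
        (forall v w, v <> w -> E v `&` E w #= `I_(edges v w)) &
        (forall v : vertex G, edges v v = 0%N)].

Definition minimal_resolution_graph X (G : weighted_graph) : Prop :=
  exists (Y : space R) (rho : Y -> X),
    minimal_resolution rho /\ resolution_graph rho G.

End Spaces.

Section Cones.
Variable R : realType.
Local Notation V := 'rV[R]_3.
Local Notation N := 'rV[int]_3.

Definition lat (u : N) : V := map_mx intr u.

Definition dot (a b : V) : R := \sum_i a 0 i * b 0 i.

Definition orthant : set V := [set v | forall i, 0 <= v 0 i].

Definition cone_hull (A : set V) : set V :=
  [set w | exists (k : nat) (l : 'I_k -> R) (a : 'I_k -> V),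
     (forall i, 0 <= l i /\ A (a i)) /\ w = \sum_i l i *: a i].

Definition convex_hull (A : set V) : set V :=
  [set w | exists (k : nat) (l : 'I_k -> R) (a : 'I_k -> V),
     [/\ forall i, 0 <= l i /\ A (a i), \sum_i l i = 1 &
         w = \sum_i l i *: a i]].

Definition ray (u : N) : set V := cone_hull [set lat u].

Definition rational_cone (C : set V) : Prop :=
  exists2 A : set N, finite_set A & C = cone_hull (lat @` A).

Definition strongly_convex (C : set V) : Prop :=
  forall w, C w -> C (- w) -> w = 0.

Definition face (F C : set V) : Prop :=
  exists2 m : V, (forall w, C w -> 0 <= dot m w) &
    F = C `&` [set w | dot m w = 0].

(* the linear span of C has dimension d *)
Definition cone_dim (C : set V) (d : nat) : Prop :=
  exists A : 'M[R]_(d, 3),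
    [/\ row_free A, (forall i, C (row i A)) & forall w, C w -> (w <= A)%MS].

Definition primitive (u : N) : Prop :=
  u <> 0 /\ forall (k : nat) (w : N), u = w *+ k -> k = 1%N.

Definition prim_gens (C : set V) : set N :=
  [set u | primitive u /\ face (ray u) C].

Definition regular_cone (C : set V) : Prop :=
  exists2 B : 'M[int]_3, B \in unitmx &
    exists J : {set 'I_3}, prim_gens C = [set row j B | j in [set` J]].

Definition fan (S : set (set V)) : Prop :=
  [/\ finite_set S,
      (forall C, S C -> rational_cone C /\ strongly_convex C),
      (forall C F, S C -> face F C -> S F) &
      (forall C D, S C -> S D -> face (C `&` D) C /\ face (C `&` D) D)].

Definition regular_fan (S : set (set V)) : Prop :=
  fan S /\ forall C, S C -> regular_cone C.

Definition fan_support (S : set (set V)) : set V := \bigcup_(C in S) C.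

Definition rays (S : set (set V)) : set (set V) :=
  [set C | S C /\ cone_dim C 1].

Definition refines (S T : set (set V)) : Prop :=
  forall C, T C ->
    exists2 S' : set (set V), S' `<=` S & C = \bigcup_(D in S') D.

Definition skeleton (S : set (set V)) : set V :=
  \bigcup_(C in [set C | S C /\ exists2 d, (d <= 2)%N & cone_dim C d]) C.

Definition profile (C : set V) : set V :=
  convex_hull (0 |` lat @` prim_gens C).

Definition profile_points (C : set V) : set N :=
  [set u | profile C (lat u) /\ u <> 0].

Definition irreducible_in (C : set V) (u : N) : Prop :=
  [/\ u <> 0, C (lat u) &
      ~ exists a b : N,
          [/\ a <> 0, b <> 0, C (lat a), C (lat b) & u = a + b]].

Implicit Type f : {mpoly R[i][3]}.

Definition exp_weight (v : V) (a : 'X_{1..3}) : R :=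
  \sum_i v 0 i * (a i)%:R.

(* the condition on a says that its weight is the minimum o_v(f) *)
Definition initial_form (v : V) f : {mpoly R[i][3]} :=
  \sum_(a <- msupp f |
        all (fun b => exp_weight v a <= exp_weight v b) (msupp f))
    f@_a *: 'X_[a].

Definition groebner_cones f : set (set V) :=
  [set closure [set w | orthant w /\ initial_form w f = initial_form v f]
  | v in orthant].

Definition groebner_fan f : set (set V) :=
  [set F | exists2 C, groebner_cones f C & face F C].

Definition max_groebner_cones f : set (set V) :=
  [set C | groebner_cones f C /\ cone_dim C 3].

Definition groebner_points f : set N :=
  \bigcup_(C in max_groebner_cones f) profile_points C.

Definition interior_skeleton_points f : set N :=
  [set u | [/\ groebner_points f u, (forall i, 0 < u 0 i) &
               skeleton (groebner_fan f) (lat u)]].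

End Cones.

Section Toric.
Variable R : realType.
Local Notation C := R[i].
Local Notation V := 'rV[R]_3.
Local Notation N := 'rV[int]_3.

Definition dual_lattice (s : set V) : set N :=
  [set m | forall w, s w -> 0 <= dot (lat R m) w].

Definition perp (s : set V) : set N :=
  [set m | forall w, s w -> dot (lat R m) w = 0].

(* A point of the toric variety lies in the orbit of a unique cone tau of the
   fan, where it is a group morphism from the characters orthogonal to tau to
   the nonzero complex numbers.  Extended by 0 outside perp tau, it gives the
   value [chr m] at the point of every character m that is regular there. *)
Record toric_point (S : set (set V)) := ToricPoint {
  orb : set V;
  chr : N -> C;
  orb_fan : S orb;
  chr0 : chr 0 = 1;
  chrD : forall m m', perp orb m -> perp orb m' ->
    chr (m + m') = chr m * chr m';
  chr_out : forall m, ~ perp orb m -> chr m = 0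
}.

Section Variety.
Variable S : set (set V).

Definition toric_chart (s : set V) : set (toric_point S) :=
  [set x | face (orb x) s].

(* the functions on [toric_chart s] given by the semigroup algebra of the
   dual cone of s *)
Definition chart_functions (s : set V) : set (toric_point S -> C) :=
  [set P | exists (k : nat) (c : 'I_k -> C) (m : 'I_k -> N),
     (forall i, dual_lattice s (m i)) /\
     forall x, P x = \sum_i c i * chr x (m i)].

Definition toric_variety : space R :=
  @Space R (toric_point S)
    [set U | forall s x, S s -> toric_chart s x -> U x ->
       exists Q, [/\ chart_functions s Q, Q x != 0 &
         forall y, toric_chart s y -> Q y != 0 -> U y]]
    (fun U => [set g | forall x, U x -> exists s P Q,
       [/\ S s, toric_chart s x, chart_functions s P /\ chart_functions s Q,
           Q x != 0 &
           forall y, U y -> toric_chart s y -> Q y != 0 -> g y = P y / Q y]]).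

Definition torus : set toric_variety := [set x | orb x = [set 0]].

(* the morphism to affine 3-space induced by the identity of the lattice, for
   a fan with support in the orthant *)
Definition toric_morphism (x : toric_variety) : affine_space R 3 :=
  \row_i chr x (delta_mx 0 i).

Definition toric_divisor (u : N) : set toric_variety :=
  zclosure [set x : toric_variety | orb x = ray u].

Definition total_transform (X : set (affine_space R 3)) : set toric_variety :=
  toric_morphism @^-1` X.

Definition strict_transform (X : set (affine_space R 3)) : set toric_variety :=
  zclosure (total_transform X `&` torus).

Definition embedded_resolution (X : set (affine_space R 3)) : Prop :=
  [/\ proper_map toric_morphism, birational toric_morphism,
      smooth 3 toric_variety,
      (forall Z, component (total_transform X) Z -> smooth 2 (sub_space Z)) &
      components_meet_transversally (total_transform X)].

End Variety.

End Toric.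

Arguments orthant : clear implicits.
Arguments ray : clear implicits.
Arguments toric_morphism {R} S x.
Arguments toric_divisor {R} S u.
Arguments strict_transform {R} S X.
Arguments embedded_resolution {R} S X.

Definition E8_poly (R : realType) : {mpoly R[i][3]} :=
  'X_2 ^+ 2 + 'X_1 ^+ 3 + 'X_0 ^+ 5.

Definition E8 (R : realType) : set (affine_space R 3) :=
  zero_locus [set E8_poly R].
Arguments E8 : clear implicits.

(* Main.v *)
Require Import Defs.
From HB Require Import structures.
From mathcomp Require Import all_boot all_order all_algebra.
From mathcomp.real_closed Require Import complex.
From mathcomp Require Import boolp classical_sets functions cardinality reals.
From mathcomp Require Import topology mpoly ring lra zify.
From mathcomp Require normed_module matrix_normedtype.
Require Import Defs.

(** The initial form of z^2 + y^3 + x^5 has at least two terms exactly on three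
  plane cones, spanned by the apex (6,10,15) and one of the coordinate axes;
  they are the walls between the three chambers of the Groebner fan.  The
  profile of a chamber is a simplex of level 1 for an integral functional that
  is at least 1 on the nonzero lattice points of the chamber, so its nonzero
  lattice points are the points of level 1, which are irreducible
  ([profile_irreducible]).  They are the vertices of a triangulation into 31
  unimodular triangles that refines the chambers; the cones over its faces
  form the fan [e8fan].  The triangulation is induced by a strictly convex
  function.  The difference of two of its linear pieces separates the
  corresponding cones, which gives the axioms of a fan and the separatedness
  of the toric variety; a vector lies in the cone whose linear piece is
  largest on it, which gives the support; and the same maximality argument,
  made with the moduli of characters, bounds the coordinates of the points
  over a bounded set, which gives the properness of the toric morphism
  ([e8fan_cover], [toric_bounded]).

  In the chart of a cone the equation of the surface is the monomial of minimal
  weight times a function [Feq], which is the equation of the strict transform.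
  A point can only be a zero of that function if two monomials tie on its
  cone, that is, in the chart of one of the ten edges into which the three
  walls are divided.  There the function is 1 + A + s^p t^(p-1) with an
  invertible coordinate A, so that it can replace A as a coordinate
  ([edge_chart]): the strict transform and the divisors of the two ends become
  three coordinate planes.  Smoothness of the components and transversality
  follow ([E8_embedded]), and the strict transform is covered by the ten open
  subsets 1 + s^p t^(p-1) <> 0 of the plane ([strict_chart]).

  A divisor of the fan lies over the origin if the coordinates of its ray are
  positive.  On the strict transform this leaves the eight points inside the
  walls, which give eight irreducible curves; off the origin the toric
  morphism is injective on the strict transform, so these are the exceptional
  curves ([exceptional_curveP]).  A character m with m(u) = 1 has a simple zero
  along the curve of u, and at the crossing with the divisor of a neighbour u'
  it has order m(u') along that divisor.  Hence the self-intersection is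
  minus the sum of the m(u') over the neighbours, and this is -2 because the
  neighbours of u on the walls add up to 2u ([self_intersection_exc]).  Two
  curves meet in one point if an edge joins their rays and are disjoint
  otherwise ([exc_curve_meet]); the eight points form chains of 4, 2 and 1
  points, each joined to the apex.  As no curve has self-intersection -1 the
  resolution is minimal. *)

Set Implicit Arguments.
Unset Strict Implicit.
Unset Printing Implicit Defensive.

Import Order.TTheory GRing.Theory Num.Theory numFieldTopology.Exports.
Local Open Scope ring_scope.
Local Open Scope classical_set_scope.
Local Open Scope complex_scope.
Local Open Scope card_scope.

Local Notation N := 'rV[int]_3.

(** * Simplicial lattice cones *)

Definition pr (m u : N) : int := \sum_i m 0 i * u 0 i.

Lemma pr0 u : pr 0 u = 0.
Proof. by rewrite /pr big1 // => i _; rewrite mxE mul0r. Qed.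

Lemma prD m m' u : pr (m + m') u = pr m u + pr m' u.
Proof. by rewrite /pr -big_split; apply: eq_bigr => i _; rewrite mxE mulrDl. Qed.

Lemma prN m u : pr (- m) u = - pr m u.
Proof. by rewrite /pr -sumrN; apply: eq_bigr => i _; rewrite mxE mulNr. Qed.

Lemma prB m m' u : pr (m - m') u = pr m u - pr m' u.
Proof. by rewrite prD prN. Qed.

Lemma prMn m u n : pr (m *+ n) u = pr m u *+ n.
Proof. by elim: n => [|n IH]; rewrite ?mulr0n ?pr0 // !mulrS prD IH. Qed.

Lemma prZ c m u : pr (c *: m) u = c * pr m u.
Proof. by rewrite /pr mulr_sumr; apply: eq_bigr => i _; rewrite mxE mulrA. Qed.

Lemma pr_sum (I : Type) (r : seq I) (P : pred I) (F : I -> N) u :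
  pr (\sum_(i <- r | P i) F i) u = \sum_(i <- r | P i) pr (F i) u.
Proof. by apply: (big_morph (pr^~ u)) => [x y|]; rewrite ?prD ?pr0. Qed.

Lemma prC m u : pr m u = pr u m.
Proof. by apply: eq_bigr => i _; rewrite mulrC. Qed.

Lemma pr_delta i u : pr (delta_mx 0 i) u = u 0 i.
Proof.
rewrite /pr (bigD1 i) //= mxE !eqxx mul1r big1 ?addr0 // => j /negPf ji.
by rewrite mxE ji mul0r.
Qed.

(** Conditions that are checked by evaluation speak of triples of integers; this
  turns a triple into a lattice vector. *)
Definition vz (t : int * int * int) : N :=
  \row_(i < 3) nth 0 [:: t.1.1; t.1.2; t.2] i.

Lemma pr_vz s t :
  pr (vz s) (vz t) = s.1.1 * t.1.1 + s.1.2 * t.1.2 + s.2 * t.2.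
Proof. by rewrite /pr !big_ord_recl big_ord0 !mxE /= addr0 addrA. Qed.

Lemma vzP (u : N) : u = vz (u 0 0, u 0 1, u 0 2%:R).
Proof.
by apply/rowP => i; rewrite mxE; case: i => [[|[|[|//]]] h] /=; congr (u 0 _);
  apply: val_inj.
Qed.

Section Cones.
Variable R : realType.
Local Notation V := 'rV[R]_3.
Implicit Types (B D : 'I_3 -> N) (a : pred 'I_3) (w m : V) (u : N).

Lemma dot_lat (m u : N) : dot (lat R m) (lat R u) = (pr m u)%:~R.
Proof.
rewrite /dot /pr (big_morph intr (rmorphD intr) (rmorph0 intr)).
by apply: eq_bigr => i _; rewrite !mxE intrM.
Qed.

Lemma dotDr m w w' : dot m (w + w') = dot m w + dot m w'.
Proof. by rewrite /dot -big_split; apply: eq_bigr => i _; rewrite mxE mulrDr. Qed.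

Lemma dotC m w : dot m w = dot w m.
Proof. by apply: eq_bigr => i _; rewrite mulrC. Qed.

Lemma dotDl m w w' : dot (w + w') m = dot w m + dot w' m.
Proof. by rewrite !(dotC _ m) dotDr. Qed.

Lemma dotZr c m w : dot m (c *: w) = c * dot m w.
Proof. by rewrite /dot mulr_sumr; apply: eq_bigr => i _; rewrite mxE mulrCA. Qed.

Lemma dot0r m : dot m 0 = 0.
Proof. by rewrite /dot big1 // => i _; rewrite mxE mulr0. Qed.

Lemma dot0l m : dot 0 m = 0.
Proof. by rewrite dotC dot0r. Qed.

Lemma dotNr m w : dot m (- w) = - dot m w.
Proof. by rewrite -scaleN1r dotZr mulN1r. Qed.

Lemma dot_sumr (I : Type) (r : seq I) (P : pred I) (F : I -> V) m :
  dot m (\sum_(i <- r | P i) F i) = \sum_(i <- r | P i) dot m (F i).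
Proof. by apply: (big_morph (dot m)) => [x y|]; rewrite ?dotDr ?dot0r. Qed.

Lemma latD u u' : lat R (u + u') = lat R u + lat R u'.
Proof. by apply/rowP => i; rewrite !mxE intrD. Qed.

Lemma latN u : lat R (- u) = - lat R u.
Proof. by apply/rowP => i; rewrite !mxE mulrNz. Qed.

Lemma lat0 : lat R 0 = 0.
Proof. by apply/rowP => i; rewrite !mxE. Qed.

Lemma lat_inj : injective (lat R).
Proof. by move=> u u' /rowP h; apply/rowP => i; have := h i; rewrite !mxE => /intr_inj. Qed.

Lemma lat_MZ (c : int) u : lat R (c *: u) = c%:~R *: lat R u.
Proof. by apply/rowP => i; rewrite !mxE intrM. Qed.

(** Cones are handled through an ordered triple of generators and a selection
  of some of them: the faces of a simplicial cone are then the cones over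
  smaller selections. *)
Definition cof B a : set V :=
  [set w | exists c : 'I_3 -> R, (forall k, 0 <= c k /\ (~~ a k -> c k = 0)) /\
     w = \sum_k c k *: lat R (B k)].

(** The functionals [D i] are, up to the common factor [d], the basis dual to
  the generators; the multiple allows for generators that do not span the
  lattice. *)
Definition dualb B D (d : int) : Prop :=
  0 < d /\ forall i j, pr (D i) (B j) = d *+ (i == j).

Lemma dot_comb (c : 'I_3 -> R) B m :
  dot m (\sum_k c k *: lat R (B k)) = \sum_k c k * dot m (lat R (B k)).
Proof. by rewrite dot_sumr; apply: eq_bigr => k _; rewrite dotZr. Qed.

Lemma comb_coef B D d (c : 'I_3 -> R) k : dualb B D d ->
  dot (lat R (D k)) (\sum_i c i *: lat R (B i)) = c k * d%:~R.
Proof.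
move=> [_ hD]; rewrite dot_comb (bigD1 k) //= big1 ?addr0 ?dot_lat ?hD ?eqxx //.
by move=> i /negPf ik; rewrite dot_lat hD eq_sym ik mulr0n mulr0.
Qed.

Lemma comb_inj B D d (c c' : 'I_3 -> R) : dualb B D d ->
  \sum_i c i *: lat R (B i) = \sum_i c' i *: lat R (B i) -> c =1 c'.
Proof.
move=> hD e k; have d0 : d%:~R != 0 :> R by rewrite intr_eq0; case: hD; case: ltgtP.
by apply: (mulIf d0); rewrite -!(comb_coef _ _ hD) e.
Qed.

Lemma dot_ge0_cof B a m w : (forall k, a k -> 0 <= dot m (lat R (B k))) ->
  cof B a w -> 0 <= dot m w.
Proof.
move=> h [c [hc ->]]; rewrite dot_comb sumr_ge0 // => k _.
have [c0 ck] := hc k; case: (boolP (a k)) => [/h h0|/ck ->]; last by rewrite mul0r.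
exact: mulr_ge0.
Qed.

(** A sum of nonnegative terms vanishes only if each of them does. *)
Lemma dot_eq0_cof B a m (c : 'I_3 -> R) :
  (forall k, a k -> 0 <= dot m (lat R (B k))) ->
  (forall k, 0 <= c k /\ (~~ a k -> c k = 0)) ->
  dot m (\sum_k c k *: lat R (B k)) = 0 ->
  forall k, dot m (lat R (B k)) != 0 -> c k = 0.
Proof.
move=> h hc; rewrite dot_comb => /eqP; rewrite psumr_eq0; last first.
  move=> k _; have [c0 ck] := hc k.
  by case: (boolP (a k)) => [/h|/ck ->]; rewrite ?mul0r //; exact: mulr_ge0.
move=> /allP e k nz; have := e k (mem_index_enum _); rewrite /= mulf_eq0.
by rewrite (negPf nz) orbF => /eqP.
Qed.

Lemma cof_mono B a a' w : (forall k, a' k -> a k) -> cof B a' w -> cof B a w.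
Proof.
move=> h [c [hc e]]; exists c; split => // k; have [c0 ck] := hc k.
by split => // /negP na; apply: ck; apply/negP => /h.
Qed.

Lemma cof_gen B a k : a k -> cof B a (lat R (B k)).
Proof.
move=> ak; exists (fun i => (i == k)%:R); split.
  move=> i; split; first by rewrite ler0n.
  by case: eqP => // ->; rewrite ak.
rewrite (bigD1 k) //= eqxx scale1r big1 ?addr0 // => i /negPf ->.
by rewrite scale0r.
Qed.

Lemma cof_sub (B B' : 'I_3 -> N) (a a' : pred 'I_3) :
  (forall k, a k -> exists2 j, a' j & B k = B' j) ->
  cof B a `<=` cof B' a'.
Proof.
move=> h; have /choice [f hf] : forall k, exists j, a k -> a' j /\ B k = B' j.
  move=> k; case: (boolP (a k)) => [/h [j aj e]|_]; last by exists k.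
  by exists j.
move=> _ [c [hc ->]]; exists (fun j => \sum_(k | f k == j) c k); split.
  move=> j; split; first by apply: sumr_ge0 => k _; case: (hc k).
  move=> aj; rewrite big1 // => k /eqP fk; apply: (proj2 (hc k)).
  by apply/negP => /hf []; rewrite fk (negPf aj).
rewrite (partition_big f predT) //=; apply: eq_bigr => j _.
rewrite scaler_suml; apply: eq_bigr => k /eqP fk.
case: (boolP (a k)) => [/hf [_ ->]|/(proj2 (hc k)) ->]; first by rewrite fk.
by rewrite !scale0r.
Qed.

(** The part of a cone on which a nonnegative functional vanishes is spanned by
  the generators on which it vanishes. *)
Lemma cof_common B B' a a' (m : N) w : (forall k, a k -> 0 <= pr m (B k)) ->
  (forall k, a k -> pr m (B k) = 0 -> exists2 j, a' j & B k = B' j) ->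
  cof B a w -> dot (lat R m) w = 0 -> cof B' a' w.
Proof.
move=> hm h0 [c [hc ew]] w0.
suff : cof B (fun k => a k && (pr m (B k) == 0)) w.
  by apply: cof_sub => k /andP[ak /eqP]; exact: h0.
exists c; split => // k; split; first exact: (proj1 (hc k)).
rewrite negb_and => /orP[/(proj2 (hc k)) //|nk]; rewrite ew in w0.
case: (boolP (a k)) => [ak|/(proj2 (hc k)) //].
apply: (dot_eq0_cof (a := a) _ hc w0); last by rewrite dot_lat intr_eq0.
by move=> j /hm; rewrite dot_lat ler0z.
Qed.

Lemma cof_genP B D d a k : dualb B D d -> cof B a (lat R (B k)) -> a k.
Proof.
move=> hD [c [hc e]]; apply/negPn/negP => /(proj2 (hc k)) ck.
have := comb_coef c k hD; rewrite -e dot_lat (proj2 hD) eqxx ck mul0r mulr1n.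
by move/eqP; rewrite intr_eq0; case: hD; case: ltgtP.
Qed.

Lemma eq_cof B B' a a' : B =1 B' -> a =1 a' -> cof B a = cof B' a'.
Proof. by move=> /funext -> /funext ->. Qed.

Lemma face_cof B a F : face F (cof B a) ->
  exists a', (forall k, a' k -> a k) /\ F = cof B a'.
Proof.
move=> [m hm ->]; exists (fun k => a k && (dot m (lat R (B k)) == 0)).
split=> [k /andP[] //|]; apply/seteqP; split => [w [[c [hc e]] hw]|w [c [hc ->]]].
  exists c; split => // k; have [c0 ck] := hc k; split => //.
  rewrite negb_and => /orP[//|]; rewrite /= e in hw.
  by apply: (dot_eq0_cof _ hc hw) => j aj; apply: hm; exact: cof_gen.
split; first by exists c; split => // k; have [c0 ck] := hc k; split => // /negPf ak; apply: ck; rewrite ak.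
rewrite /= dot_comb big1 // => k _; have [c0 ck] := hc k.
case: (boolP (a k && (dot m (lat R (B k)) == 0))) => [/andP[_ /eqP ->]|/ck ->].
  by rewrite mulr0.
by rewrite mul0r.
Qed.

Lemma cof_face B D d a a' : dualb B D d -> (forall k, a' k -> a k) ->
  face (cof B a') (cof B a).
Proof.
move=> hD sub; pose m := lat R (\sum_(k | a k && ~~ a' k) D k).
have hm j : dot m (lat R (B j)) = (d *+ (a j && ~~ a' j))%:~R.
  rewrite /m dot_lat pr_sum (eq_bigr (fun k => if k == j then d else 0)); last first.
    by move=> k _; rewrite (proj2 hD); case: eqP.
  rewrite -big_mkcondr /=; case: (boolP (a j && ~~ a' j)) => aj; last first.
    by rewrite big1 // => k /andP[h /eqP ?]; subst k; rewrite h in aj.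
  rewrite (big_pred1 j) // => k /=; case: eqP => [->|]; by rewrite ?aj ?andbF.
have d0 := proj1 hD.
have ge0 k : a k -> 0 <= dot m (lat R (B k)).
  by move=> _; rewrite hm ler0z; case: (_ && _); rewrite ?mulr0n ?mulr1n // ltW.
exists m; first by move=> w; exact: dot_ge0_cof.
apply/seteqP; split => [w [c [hc ->]]|w [[c [hc ->]] h]].
  split; first by apply: (cof_mono sub); exists c.
  rewrite /= dot_comb big1 // => k _; rewrite hm.
  case: (boolP (a' k)) => [_|/(proj2 (hc k)) ->]; last by rewrite mul0r.
  by rewrite andbF mulr0n mulr0.
exists c; split => // k; split; first exact: (proj1 (hc k)).
move=> a'k; case: (boolP (a k)) => [ak|/(proj2 (hc k)) //].
apply: (dot_eq0_cof ge0 hc h); rewrite hm ak a'k mulr1n intr_eq0.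
by case: ltgtP d0.
Qed.

Lemma cof_rational B a : rational_cone (cof B a).
Proof.
exists [set B k | k in a]; first by apply: finite_image; exact: finite_finset.
apply/seteqP; split => [w [c [hc e]]|w [n [l [x [hx ->]]]]].
  have [[k0 ak]|a0] := pselect (exists k, a k); last first.
    exists 0%N, (fun _ => 0), (fun _ => 0); split; first by case.
    rewrite big_ord0 e big1 // => k _; rewrite (proj2 (hc k)) ?scale0r //.
    by apply/negP => ak; apply: a0; exists k.
  exists 3%N, c, (fun k => if a k then lat R (B k) else lat R (B k0)); split.
    move=> k; split; first exact: (proj1 (hc k)).
    by case: ifPn => h; [exists (B k) => //; exists k|exists (B k0) => //; exists k0].
  rewrite e; apply: eq_bigr => k _; case: ifPn => // /(proj2 (hc k)) ->.
  by rewrite !scale0r.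
have H : forall i, exists k : 'I_3, a k /\ x i = lat R (B k).
  by move=> i; have [_ [u [k ak <-] <-]] := hx i; exists k.
have [f hf] := choice H.
exists (fun k => \sum_(i | f i == k) l i); split.
  move=> k; split; first by apply: sumr_ge0 => i _; case: (hx i).
  by move=> ak; rewrite big_pred0 // => i; apply/negbTE/eqP => e;
    case: (hf i) => h _; rewrite e (negPf ak) in h.
rewrite (partition_big f predT) //=; apply: eq_bigr => k _.
rewrite scaler_suml; apply: eq_bigr => i /eqP <-; by case: (hf i) => _ ->.
Qed.

Lemma cof_pointed B D d a : dualb B D d -> strongly_convex (cof B a).
Proof.
move=> hD w [c [hc ew]] [c' [hc' ew']].
have h k : c k = 0.
  have : c k + c' k = 0.
    have := comb_inj (c := fun k => c k + c' k) (c' := fun _ => 0) hD; apply.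
    under eq_bigr do rewrite scalerDl.
    by rewrite big_split /= -ew -ew' subrr big1 // => i _; rewrite scale0r.
  move/eqP; rewrite paddr_eq0; [by move=> /andP[/eqP] | |].
    exact: (proj1 (hc k)). exact: (proj1 (hc' k)).
by rewrite ew big1 // => k _; rewrite h scale0r.
Qed.

Lemma rayE B k : ray R (B k) = cof B (pred1 k).
Proof.
apply/seteqP; split => [w [n [l [x [hx ->]]]]|w [c [hc ->]]].
  exists (fun i => (\sum_j l j) *+ (i == k)); split.
    move=> i; split; last by move=> /negPf /= ->.
    by rewrite mulrn_wge0 // sumr_ge0 // => j _; case: (hx j).
  rewrite (bigD1 k) //= eqxx mulr1n [X in _ + X]big1 ?addr0 => [|i /negPf ->]; last first.
    by rewrite mulr0n scale0r.
  by rewrite scaler_suml; apply: eq_bigr => j _; case: (hx j) => _ ->.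
exists 1%N, (fun _ => c k), (fun _ => lat R (B k)); split.
  by move=> i; split => //; case: (hc k).
rewrite [RHS]big_ord1 (bigD1 k) //= big1 ?addr0 // => i ik.
by rewrite (proj2 (hc i)) ?scale0r.
Qed.

Lemma cof_cone_dim B D d a : dualb B D d -> cone_dim (cof B a) #|a|.
Proof.
move=> hD; have d0 : d%:~R != 0 :> R by rewrite intr_eq0; case: hD; case: ltgtP.
pose A : 'M[R]_(#|a|, 3) := \matrix_i lat R (B (enum_val i)).
exists A; split.
- apply/row_freeP; exists (d%:~R^-1 *: \matrix_(i, j) (D (enum_val j) 0 i)%:~R).
  apply/matrixP => i j; rewrite -scalemxAr !mxE.
  have -> : \sum_k A i k * (\matrix_(i0, j0) (D (enum_val j0) 0 i0)%:~R) k j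
      = (pr (D (enum_val j)) (B (enum_val i)))%:~R :> R.
    by rewrite -dot_lat; apply: eq_bigr => k _; rewrite !mxE mulrC.
  rewrite (proj2 hD) (inj_eq enum_val_inj) eq_sym.
  by case: eqP; rewrite ?mulr1n ?mulVf ?mulr0n ?mulr0.
- by move=> i; rewrite rowK; apply: cof_gen; exact: enum_valP.
- move=> w [c [hc ->]]; apply: summx_sub => k _.
  case: (boolP (a k)) => [ak|/(proj2 (hc k)) ->]; last by rewrite scale0r sub0mx.
  apply: scalemx_sub.
  have -> : lat R (B k) = row (enum_rank_in ak k) A by rewrite rowK enum_rankK_in.
  exact: row_sub.
Qed.

Lemma cone_dim_sub (C C' : set V) d d' :
  C `<=` C' -> cone_dim C d -> cone_dim C' d' -> (d <= d')%N.
Proof.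
move=> sub [A [fA hA _]] [A' [fA' _ hA']].
have : (A <= A')%MS by apply/row_subP => i; apply/hA'/sub/hA.
by move=> /mxrankS; rewrite (eqP fA) (eqP fA').
Qed.

Lemma cone_dim_uniq (C : set V) d d' : cone_dim C d -> cone_dim C d' -> d = d'.
Proof.
by move=> h h'; apply/eqP; rewrite eqn_leq (cone_dim_sub _ h h') // (cone_dim_sub _ h' h).
Qed.

(** An easily verified condition that implies primitivity. *)
Definition visible u : Prop := exists m : N, pr m u = 1.

Lemma visible_primitive u : visible u -> primitive u.
Proof.
move=> [m hm]; split => [u0|k w e].
  by move: hm; rewrite u0 prC pr0.
move: hm; rewrite e prC prMn => /(congr1 absz).
by rewrite -mulr_natr natz abszM absz_nat => /eqP; rewrite muln_eq1 => /andP[_ /eqP].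
Qed.

(** A primitive vector on the ray of a vector on which some integral
  functional takes the value 1 is an integral multiple of that vector. *)
Lemma visible_ray u u' (l : R) : primitive u -> visible u' -> 0 <= l ->
  lat R u = l *: lat R u' -> u = u'.
Proof.
move=> [u0 pu] [m hm] l0 e.
have hl : l = (pr m u)%:~R by rewrite -dot_lat e dotZr dot_lat hm mulr1.
have p0 : 0 <= pr m u by rewrite -(ler0z R) -hl.
have : u = u' *+ `|pr m u|%N.
  by apply: lat_inj; rewrite e hl -lat_MZ -scaler_nat natz gez0_abs.
by move=> eu; rewrite eu (pu _ _ eu) mulr1n.
Qed.

Lemma prim_gens_cof B D d a : dualb B D d -> (forall k, visible (B k)) ->
  prim_gens (cof B a) = [set B k | k in a].
Proof.
move=> hD vis; apply/seteqP; split => [u [pu fu]|_ [k ak <-]]; last first.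
  split; first exact: visible_primitive.
  by rewrite rayE; apply: (cof_face hD) => i /= /eqP ->.
have [a' [sub e]] := face_cof fu.
have hu : ray R u (lat R u).
  by exists 1%N, (fun _ => 1), (fun _ => lat R u); split; rewrite ?big_ord1 ?scale1r.
have [k ak] : exists k, a' k.
  apply: contrapT => h; move: hu; rewrite e => -[c [hc eu]].
  case: pu => u0 _; apply: u0; apply: lat_inj; rewrite eu lat0 big1 // => k _.
  by rewrite (proj2 (hc k)) ?scale0r //; apply/negP => ?; apply: h; exists k.
exists k; first exact: sub.
have : ray R u (lat R (B k)) by rewrite e; exact: cof_gen.
move=> [n [l [x [hx ex]]]].
pose l0 := \sum_i l i.
have l0_ge : 0 <= l0 by apply: sumr_ge0 => i _; case: (hx i).
have {ex} ex : lat R (B k) = l0 *: lat R u.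
  by rewrite ex scaler_suml; apply: eq_bigr => i _; case: (hx i) => _ ->.
have l0n : l0 != 0.
  apply: contraPneq ex => ->; rewrite scale0r -lat0 => /lat_inj b0.
  by have := vis k; rewrite b0 => -[m]; rewrite prC pr0.
apply/esym/(@visible_ray _ _ l0^-1) => //; first by rewrite invr_ge0.
by rewrite ex scalerA mulVf // scale1r.
Qed.

End Cones.

(** * Spaces with functions *)

Section Spaces.
Variable R : realType.
Local Notation C := R[i].
Implicit Types X Y Z : space R.

(** The properties of a sheaf of functions that pass to arbitrary subspaces:
  neither affine charts nor separatedness are asked for. *)
Record good X : Prop := Good {
  goodT : zopen [set: X];
  goodI : forall U V : set X, zopen U -> zopen V -> zopen (U `&` V);
  goodU : forall F : set (set X), F `<=` @zopen R X ->
    zopen (\bigcup_(U in F) U);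
  good_loc : forall (U : set X) (g : X -> C), zopen U ->
    (forall x, U x -> exists V : set X, exists h : X -> C,
      [/\ zopen V, V x, regular V h & forall y, U y -> V y -> g y = h y]) ->
    regular U g;
  good_cst : forall c, regular [set: X] (fun=> c);
  good_add : forall (U : set X) g h, zopen U -> regular U g -> regular U h ->
    regular U (fun x => g x + h x);
  good_mul : forall (U : set X) g h, zopen U -> regular U g -> regular U h ->
    regular U (fun x => g x * h x);
  good_inv : forall (U : set X) g, zopen U -> regular U g ->
    (forall x, U x -> g x != 0) -> regular U (fun x => (g x)^-1);
  good_neq0 : forall (U : set X) g, zopen U -> regular U g ->
    zopen (U `&` [set x | g x != 0])
}.

Lemma around_pt X (p : X) P : around p P -> P p.
Proof. by move=> [U [_ Up h]]; exact: h. Qed.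

Lemma around_mono X (p : X) (P Q : X -> Prop) :
  (forall y, P y -> Q y) -> around p P -> around p Q.
Proof. by move=> PQ [U [oU Up h]]; exists U; split => // y /h /PQ. Qed.

Lemma open_around X (U : set X) p : zopen U -> U p -> around p U.
Proof. by move=> oU Up; exists U. Qed.

Section Good.
Variables (X : space R) (gX : good X).
Implicit Types (p : X) (U V A : set X) (g h : X -> C).

Lemma around_and p P Q : around p P -> around p Q ->
  around p (fun y => P y /\ Q y).
Proof.
move=> [U [oU Up h]] [V [oV Vp k]]; exists (U `&` V); split => //.
  exact: goodI.
by move=> y [/h ? /k ?].
Qed.

Lemma around_all p : forall P : X -> Prop, (forall y, P y) -> around p P.
Proof. by move=> P h; exists setT; split => //; exact: goodT. Qed.

Lemma around_forall (I : finType) p (P : I -> X -> Prop) :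
  (forall i, around p (P i)) -> around p (fun y => forall i, P i y).
Proof.
move=> h; suff : around p (fun y => forall i, i \in enum I -> P i y).
  by apply: around_mono => y hy i; apply: hy; rewrite mem_enum.
elim: (enum I) => [|i s IH]; first exact: around_all.
have := around_and (h i) IH; apply: around_mono => y [h1 h2] j.
by rewrite inE => /orP[/eqP ->|/h2].
Qed.

Lemma around_mono2 p (P Q S : X -> Prop) :
  (forall y, P y -> Q y -> S y) -> around p P -> around p Q -> around p S.
Proof.
by move=> h hP hQ; have := around_and hP hQ; apply: around_mono => y [/h]; apply.
Qed.

Lemma openP U : (forall p, U p -> around p U) -> zopen U.
Proof.
move=> h; have -> : U = \bigcup_(V in [set V | zopen V /\ V `<=` U]) V.
  apply/seteqP; split => [x /h [V [oV Vx VU]]|x [V [_ VU] /VU //]].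
  by exists V.
by apply: (goodU gX) => V [].
Qed.

Lemma germ_of U g p : zopen U -> regular U g -> U p -> germ p g.
Proof. by move=> oU rU Up; exists U. Qed.

Lemma regular_germ U g : zopen U -> (forall p, U p -> germ p g) -> regular U g.
Proof.
move=> oU h; apply: (good_loc gX) => // x /h [V [oV Vx rV]].
by exists V, g; split.
Qed.

Lemma regular_sub U V g : zopen U -> zopen V -> V `<=` U -> regular U g ->
  regular V g.
Proof.
move=> oU oV VU rU; apply: regular_germ => // p /VU Up; exact: germ_of rU Up.
Qed.

Lemma germ_eq p g h : germ p g -> around p (fun y => h y = g y) -> germ p h.
Proof.
move=> [U [oU Up rU]] [V [oV Vp e]]; exists (U `&` V); split => //.
  exact: goodI.
apply: good_loc => //; first exact: goodI.
by move=> x [Ux Vx]; exists U, g; split => // y [_ /e].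
Qed.

Lemma germ_around p g : germ p g -> around p (fun q => germ q g).
Proof. by move=> [U [oU Up rU]]; exists U; split => // q Uq; exists U. Qed.

Lemma germ_cst p (c : C) : germ p (fun=> c).
Proof. by exists setT; split; [exact: goodT| |exact: good_cst]. Qed.

Lemma germ2 (F : (X -> C) -> (X -> C) -> X -> C) p g h :
  (forall U, zopen U -> regular U g -> regular U h -> regular U (F g h)) ->
  germ p g -> germ p h -> germ p (F g h).
Proof.
move=> H [U [oU Up rU]] [V [oV Vp rV]]; exists (U `&` V).
have oUV : zopen (U `&` V) by exact: goodI.
split => //; apply: H => //.
  by apply: regular_sub rU => // x [].
by apply: regular_sub rV => // x [].
Qed.

Lemma germD p g h : germ p g -> germ p h -> germ p (fun x => g x + h x).
Proof.
by apply: (germ2 (F := fun g h x => g x + h x)) => U; exact: good_add.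
Qed.

Lemma germM p g h : germ p g -> germ p h -> germ p (fun x => g x * h x).
Proof.
by apply: (germ2 (F := fun g h x => g x * h x)) => U; exact: good_mul.
Qed.

Lemma germN p g : germ p g -> germ p (fun x => - g x).
Proof.
move=> hg; have := germM (germ_cst p (-1)) hg.
by congr germ; apply/funext => x; rewrite mulN1r.
Qed.

Lemma germB p g h : germ p g -> germ p h -> germ p (fun x => g x - h x).
Proof. by move=> hg hh; apply: germD => //; exact: germN. Qed.

Lemma germX p g n : germ p g -> germ p (fun x => g x ^+ n).
Proof.
move=> hg; elim: n => [|n IH]; first exact: germ_cst.
have := germM hg IH; congr germ; by apply/funext => x; rewrite exprS.
Qed.

Lemma germ_sum (I : Type) (r : seq I) p (F : I -> X -> C) :
  (forall i, germ p (F i)) -> germ p (fun x => \sum_(i <- r) F i x).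
Proof.
move=> h; elim: r => [|i r IH].
  have := germ_cst p 0; congr germ; by apply/funext => x; rewrite big_nil.
have := germD (h i) IH; congr germ; by apply/funext => x; rewrite big_cons.
Qed.

Lemma germ_prod (I : Type) (r : seq I) p (F : I -> X -> C) :
  (forall i, germ p (F i)) -> germ p (fun x => \prod_(i <- r) F i x).
Proof.
move=> h; elim: r => [|i r IH].
  have := germ_cst p 1; congr germ; by apply/funext => x; rewrite big_nil.
have := germM (h i) IH; congr germ; by apply/funext => x; rewrite big_cons.
Qed.

Lemma germ_neq0 p g : germ p g -> g p != 0 -> around p (fun y => g y != 0).
Proof.
move=> [U [oU Up rU]] g0; exists (U `&` [set x | g x != 0]); split => //.
  exact: good_neq0.
by move=> y [].
Qed.

Lemma germV p g : germ p g -> g p != 0 -> germ p (fun x => (g x)^-1).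
Proof.
move=> hg g0; have [U [oU Up rU]] := hg.
exists (U `&` [set x | g x != 0]).
have oU' : zopen (U `&` [set x | g x != 0]) by exact: good_neq0.
split => //; apply: good_inv => //; last by move=> x [].
by apply: regular_sub rU => // x [].
Qed.

Lemma germXz p g (n : int) : germ p g -> (n < 0 -> g p != 0) ->
  germ p (fun x => g x ^ n).
Proof.
case: n => n hg hn; first exact: germX.
by apply: germV; [exact: germX|rewrite expf_neq0 // hn].
Qed.

Lemma irreducibleP (A : set X) : irreducible A <-> A !=set0 /\
  forall U V, zopen U -> zopen V -> A `&` U !=set0 -> A `&` V !=set0 ->
    exists x, [/\ A x, U x & V x].
Proof.
split=> [[A0 h]|[A0 h]]; split => //.
  move=> U V oU oV [x [Ax Ux]] [y [Ay Vy]]; apply: contrapT => no.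
  have [] := h (~` U) (~` V); rewrite /zclosed ?setCK //.
  - move=> z Az; have [Uz|] := pselect (U z); last by left.
    by right => Vz; apply: no; exists z.
  - by move=> s; have := s _ Ax.
  - by move=> s; have := s _ Ay.
move=> F G cF cG AFG; have [|nF] := pselect (A `<=` F); first by left.
right => y Ay; apply: contrapT => nG.
have [x [Ax nFx]] : exists x, A x /\ ~ F x.
  apply: contrapT => no; apply: nF => x Ax; apply: contrapT => nFx.
  by apply: no; exists x.
have [z [Az nFz nGz]] : exists z, [/\ A z, (~` F) z & (~` G) z].
  by apply: h => //; [exists x|exists y].
by case: (AFG _ Az).
Qed.

Lemma irreducible_closure A : irreducible A -> irreducible (zclosure A).
Proof.
move=> /irreducibleP [[a Aa] h]; apply/irreducibleP; split.
  by exists a => U oU Ua; exists a.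
move=> U V oU oV [x [cx Ux]] [y [cy Vy]].
have [x' [Ux' Ax']] := cx _ oU Ux; have [y' [Vy' Ay']] := cy _ oV Vy.
have [z [Az Uz Vz]] : exists z, [/\ A z, U z & V z].
  by apply: h => //; [exists x'|exists y'].
by exists z; split => // W oW Wz; exists z.
Qed.

Lemma closure_closed A : zclosed (zclosure A : set X).
Proof.
apply: openP => p /existsNP [U /not_implyP [oU /not_implyP [Up h]]].
by exists U; split => // y Uy cy; apply: h; exact: cy.
Qed.

Lemma sub_closure A : A `<=` (zclosure A : set X).
Proof. by move=> x Ax U oU Ux; exists x. Qed.

Lemma closure_min A F : zclosed F -> A `<=` F -> (zclosure A : set X) `<=` F.
Proof.
by move=> cF AF x cx; apply: contrapT => nF; have [y [nFy /AF]] := cx _ cF nF.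
Qed.

Lemma closed_bigU (I : finType) (F : I -> set X) :
  (forall i, zclosed (F i)) -> zclosed (\bigcup_i F i).
Proof.
move=> h; apply: openP => p hp.
have : around p (fun y => forall i, ~ F i y).
  apply: around_forall => i; exists (~` F i); split => //; first exact: h.
    by move=> Fp; apply: hp; exists i.
by apply: around_mono => y hy [i _ /hy].
Qed.

Lemma irreducible_bigU (I : finType) (F : I -> set X) A :
  (forall i, zclosed (F i)) -> irreducible A -> A `<=` \bigcup_i F i ->
  exists i, A `<=` F i.
Proof.
move=> h irA AF.
have H (s : seq I) : A `<=` \bigcup_(i in [set i | i \in s]) F i -> exists i, A `<=` F i.
  elim: s => [|i s IH] hs.
    by case: irA => [[a Aa] _]; case: (hs _ Aa) => i.
  set G := \bigcup_(j in [set j | j \in s]) F j.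
  have cG : zclosed G.
    have -> : G = \bigcup_j (if j \in s then F j else set0).
      apply/seteqP; split => [x [j js Fj]|x [j _]].
        by exists j => //; rewrite js.
      by case: ifP => // js Fj; exists j.
    apply: closed_bigU => j; case: ifP => _ //.
    by rewrite /zclosed setC0; exact: goodT.
  have sub : A `<=` F i `|` G.
    move=> x /hs [j]; rewrite /= inE => /orP[/eqP ->|js] Fj; first by left.
    by right; exists j.
  by case: irA => _ /(_ _ _ (h i) cG sub) [|/IH]; first by exists i.
apply: (H (enum I)) => x /AF [i _ Fi]; exists i => //=.
by rewrite mem_enum.
Qed.

End Good.

(** Being a morphism at a point: continuity there, and composition sends the
  local ring of the image into the local ring of the point. *)
Definition mor_at X Y (f : X -> Y) (p : X) : Prop :=
  (forall O : set Y, zopen O -> O (f p) -> around p (fun y => O (f y))) /\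
  (forall h, germ (f p) h -> germ p (h \o f)).

Lemma mor_regular X Y (f : X -> Y) : good X -> (forall p, mor_at f p) ->
  regular_map f.
Proof.
move=> gX h V oV.
have o : zopen (f @^-1` V) by apply: (openP gX) => p Vp; exact: (proj1 (h p)).
split => // g rV; apply: (regular_germ gX) => // p Vp.
by apply: (proj2 (h p)); exists V.
Qed.

Lemma regular_mor X Y (f : X -> Y) p : regular_map f -> mor_at f p.
Proof.
move=> h; split => [O oO Op|g [V [oV Vp rV]]].
  by exists (f @^-1` O); split => //; case: (h _ oO).
by exists (f @^-1` V); case: (h _ oV) => ? H; split => //; exact: H.
Qed.

Lemma mor_comp X Y Z (f : X -> Y) (g : Y -> Z) p :
  mor_at f p -> mor_at g (f p) -> mor_at (g \o f) p.
Proof.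
move=> [f1 f2] [g1 g2]; split => [O oO Op|h hh]; last exact: f2 (g2 _ hh).
have [U [oU Up hU]] := g1 _ oO Op.
by apply: around_mono (f1 _ oU Up) => y /hU.
Qed.

Lemma mor_around X Y (f : X -> Y) p P :
  mor_at f p -> around (f p) P -> around p (fun y => P (f y)).
Proof.
by move=> [h _] [U [oU Up hU]]; apply: around_mono (h _ oU Up) => y /hU.
Qed.

Lemma mor_eq X Y (f g : X -> Y) p : good X ->
  around p (fun y => g y = f y) -> mor_at f p -> mor_at g p.
Proof.
move=> gX e [h1 h2]; have ep := around_pt e; split.
  move=> O oO; rewrite ep => Op.
  by apply: (around_mono2 gX _ e (h1 _ oO Op)) => y /= ->.
move=> h; rewrite ep => /h2 gh; apply: germ_eq gh _ => //.
by apply: around_mono e => y /= ->.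
Qed.

Lemma irreducible_image X Y (f : X -> Y) A : good X -> good Y ->
  (forall p, A p -> mor_at f p) -> irreducible A -> irreducible (f @` A).
Proof.
move=> gX gY hf /irreducibleP [[a Aa] h]; apply/irreducibleP; split.
  by exists (f a), a.
move=> U V oU oV [_ [[x Ax <-] Ux]] [_ [[y Ay <-] Vy]].
have [U' [oU' U'x hU]] := proj1 (hf _ Ax) _ oU Ux.
have [V' [oV' V'y hV]] := proj1 (hf _ Ay) _ oV Vy.
have [z [Az /hU Uz /hV Vz]] : exists z, [/\ A z, U' z & V' z].
  by apply: h => //; [exists x|exists y].
by exists (f z); split => //; exists z.
Qed.

(** A common treatment of iterated subspaces: the topology is induced and the
  germs are the restrictions of germs of the ambient space. *)
Record emb Y X (f : Y -> X) : Prop := Emb {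
  emb_inj : injective f;
  emb_open : forall U : set Y, zopen U -> exists2 V : set X, zopen V &
    U = f @^-1` V;
  emb_openr : forall V : set X, zopen V -> zopen (f @^-1` V);
  emb_germ : forall p g, germ p g -> exists2 h, germ (f p) h &
    around p (fun y => g y = h (f y));
  emb_germr : forall p h, germ (f p) h -> germ p (h \o f)
}.

Lemma emb_mor Y X (f : Y -> X) p : emb f -> mor_at f p.
Proof.
move=> e; split => [O oO Op|h]; last exact: emb_germr.
by exists (f @^-1` O); split => //; exact: emb_openr.
Qed.

Lemma emb_comp X Y Z (f : X -> Y) (g : Y -> Z) : good X -> emb f -> emb g ->
  emb (g \o f).
Proof.
move=> gX ef eg; split.
- by move=> x y /(emb_inj eg) /(emb_inj ef).
- move=> U /(emb_open ef) [V /(emb_open eg) [W oW ->] ->]; by exists W.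
- by move=> V /(emb_openr eg) /(emb_openr ef).
- move=> p h /(emb_germ ef) [h1 /(emb_germ eg) [h2 g2 a2] a1]; exists h2 => //.
  have := mor_around (emb_mor p ef) a2.
  by apply: (around_mono2 gX _ a1) => y /= -> ->.
- by move=> p h /(emb_germr eg) /(emb_germr ef).
Qed.

Lemma emb_factor Y Y' X (i : Y' -> X) (f : Y -> Y') p : good Y -> emb i ->
  mor_at (i \o f) p -> mor_at f p.
Proof.
move=> gY ei [h1 h2]; split => [O /(emb_open ei) [V oV ->] Op|].
  exact: (h1 _ oV Op).
move=> h gh; have [g gg a] := emb_germ ei gh.
apply: germ_eq (h2 _ gg) _ => //; case: a => U [/(emb_open ei) [V oV ->] Vp hV].
by apply: around_mono (h1 _ oV Vp) => y /hV.
Qed.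

Lemma sub_open X (A : set X) (U : set (sub_space A)) : good X ->
  (forall x, U x -> exists V : set X,
     [/\ zopen V, V (sval x) & forall y : sub_space A, V (sval y) -> U y]) ->
  zopen U.
Proof.
move=> gX h; exists (\bigcup_(V in [set V | zopen V /\
    forall y : sub_space A, V (sval y) -> U y]) V).
  by apply: (goodU gX) => // V [].
apply/seteqP; split => [x /h [V [oV Vx hV]]|x [V [oV hV] /hV //]].
by exists V.
Qed.

Lemma good_sub X (A : set X) : good X -> good (sub_space A).
Proof.
move=> gX; split.
- by exists setT; [exact: goodT|].
- move=> _ _ [U oU ->] [V oV ->]; exists (U `&` V) => //; exact: goodI.
- move=> F hF; apply: (sub_open gX) => x [U FU Ux].
  have [V oV e] := hF _ FU; exists V; split => //; first by rewrite e in Ux.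
  by move=> y Vy; exists U => //; rewrite e.
- move=> U g oU h x Ux; have [_ [k [[V oV ->] Vx rk e]]] := h _ Ux.
  have [W [l [oW Wx rl e']]] := rk _ Vx.
  exists (V `&` W), l; split => //; first exact: goodI.
    by apply: (regular_sub gX oW _ _ rl); [exact: goodI|move=> ? []].
  by move=> y Uy [Vy Wy]; rewrite (e y Uy Vy) (e' y Vy Wy).
- move=> c x _; exists setT, (fun=> c); split => //; first exact: goodT.
  exact: good_cst.
- move=> U g h oU rg rh x Ux.
  have [V [g' [oV Vx rg' eg]]] := rg _ Ux; have [W [h' [oW Wx rh' eh]]] := rh _ Ux.
  exists (V `&` W), (fun x => g' x + h' x).
  have oVW : zopen (V `&` W) by exact: goodI.
  split => //; last by move=> y Uy [Vy Wy]; rewrite eg ?eh.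
  apply: good_add => //.
    by apply: regular_sub rg' => // ? [].
  by apply: regular_sub rh' => // ? [].
- move=> U g h oU rg rh x Ux.
  have [V [g' [oV Vx rg' eg]]] := rg _ Ux; have [W [h' [oW Wx rh' eh]]] := rh _ Ux.
  exists (V `&` W), (fun x => g' x * h' x).
  have oVW : zopen (V `&` W) by exact: goodI.
  split => //; last by move=> y Uy [Vy Wy]; rewrite eg ?eh.
  apply: good_mul => //.
    by apply: regular_sub rg' => // ? [].
  by apply: regular_sub rh' => // ? [].
- move=> U g oU rg g0 x Ux; have [V [g' [oV Vx rg' eg]]] := rg _ Ux.
  exists (V `&` [set x | g' x != 0]), (fun x => (g' x)^-1).
  have o : zopen (V `&` [set x | g' x != 0]) by exact: good_neq0.
  split => //; last by move=> y Uy [Vy _]; rewrite eg.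
    by split => //=; rewrite -eg // g0.
  apply: good_inv => //; last by move=> y [].
  by apply: regular_sub rg' => // ? [].
- move=> _ g [W oW ->] rg; apply: (sub_open gX) => x [Wx gx].
  have [V [g' [oV Vx rg' eg]]] := rg _ Wx.
  exists (W `&` (V `&` [set x | g' x != 0])); split.
  + by apply: goodI => //; exact: good_neq0.
  + by split => //; split => //=; rewrite -eg.
  + by move=> y [Wy [Vy g'y]]; split => //=; rewrite eg.
Qed.

Lemma emb_sval X (A : set X) : good X -> emb (sval : sub_space A -> X).
Proof.
move=> gX; split.
- by move=> [x Ax] [y Ay] /= e; subst y; congr exist; exact: Prop_irrelevance.
- by move=> U [V oV ->]; exists V.
- by move=> V oV; exists V.
- move=> p g [U [oU Up rg]]; have [V [h [oV Vp rh e]]] := rg _ Up.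
  exists h; first by exists V.
  have [W oW eW] := oU; exists (sval @^-1` (W `&` V)); split.
  + by exists (W `&` V) => //; exact: goodI.
  + by split => //; rewrite eW in Up.
  + by move=> y [Wy Vy]; apply: e => //; rewrite eW.
- move=> p h [U [oU Up rh]]; exists (sval @^-1` U); split => //.
    by exists U.
  by move=> x Ux; exists U, h; split.
Qed.

Lemma sub_mor X Y (A : set Y) (f : X -> sub_space A) p : good X -> good Y ->
  mor_at (sval \o f) p -> mor_at f p.
Proof. by move=> gX gY; apply: emb_factor => //; exact: emb_sval. Qed.

Lemma closed_sub X (A : set X) (F : set X) : zclosed F ->
  zclosed (trace F : set (sub_space A)).
Proof. by move=> cF; exists (~` F). Qed.

Lemma irreducible_trace X (A F : set X) : good X -> F `<=` A ->
  irreducible F -> irreducible (trace F : set (sub_space A)).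
Proof.
move=> gX FA /irreducibleP [[a Fa] h].
apply/irreducibleP; split; first by exists (exist _ a (FA _ Fa)).
move=> _ _ [U oU ->] [V oV ->] [x [Fx Ux]] [y [Fy Vy]].
have [z [Fz Uz Vz]] : exists z, [/\ F z, U z & V z].
  by apply: h => //; [exists (sval x)|exists (sval y)].
by exists (exist _ z (FA _ Fz)).
Qed.

End Spaces.

(** * Spaces glued from charts; affine space *)

Section Glue.
Variables (R : realType) (T I : Type) (ok : I -> Prop) (ch : I -> set T).
Local Notation C := R[i].
Variable Fn : I -> set (T -> C).

(** Affine space and the toric varieties share this shape: the functions of a
  chart form an algebra, and regular functions are locally quotients. *)
Definition glue : space R :=
  @Space R T
    [set U | forall i x, ok i -> ch i x -> U x ->
       exists Q, [/\ Fn i Q, Q x != 0 & forall y, ch i y -> Q y != 0 -> U y]]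
    (fun U => [set g | forall x, U x -> exists i P Q,
       [/\ ok i, ch i x, Fn i P /\ Fn i Q, Q x != 0 &
           forall y, U y -> ch i y -> Q y != 0 -> g y = P y / Q y]]).

Hypothesis cover : forall x, exists2 i, ok i & ch i x.
Hypothesis FnC : forall i c, ok i -> exists2 P, Fn i P & forall x, ch i x -> P x = c.
Hypothesis FnD : forall i P Q, ok i -> Fn i P -> Fn i Q ->
  exists2 S, Fn i S & forall x, ch i x -> S x = P x + Q x.
Hypothesis FnM : forall i P Q, ok i -> Fn i P -> Fn i Q ->
  exists2 S, Fn i S & forall x, ch i x -> S x = P x * Q x.
Hypothesis trans : forall i j x Q, ok i -> ok j -> ch i x -> ch j x -> Fn j Q ->
  exists M S, [/\ Fn i M, Fn i S, M x != 0 &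
    forall y, ch i y -> M y != 0 -> ch j y /\ Q y = S y / M y].

(** Near a common point of two charts, a quotient of functions of one chart is a
  quotient of functions of the other. *)
Lemma reloc i j x P Q : ok i -> ok j -> ch i x -> ch j x -> Fn j P -> Fn j Q ->
  Q x != 0 -> exists P' Q', [/\ Fn i P', Fn i Q', Q' x != 0 &
    forall y, ch i y -> Q' y != 0 ->
      [/\ ch j y, Q y != 0 & P y / Q y = P' y / Q' y]].
Proof.
move=> oi oj ix jx FP FQ Qx.
have [M1 [S1 [FM1 FS1 M1x h1]]] := trans oi oj ix jx FP.
have [M2 [S2 [FM2 FS2 M2x h2]]] := trans oi oj ix jx FQ.
have [A FA eA] := FnM oi FM1 FM2.
have [B FB eB] := FnM oi FS2 FA.
have [A' FA' eA'] := FnM oi FM2 FM2.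
have [B' FB' eB'] := FnM oi FS1 FA'.
have [_ Qx2] := h2 _ ix M2x.
exists B', B; split => //.
  rewrite eB // eA //; move: Qx; rewrite Qx2 !mulf_eq0 invr_eq0 !negb_or.
  by rewrite M1x M2x => /andP[-> _].
move=> y iy; rewrite eB // eA // !mulf_eq0 !negb_or => /and3P[s2 m1 m2].
have [jy ->] := h1 _ iy m1; have [_ ->] := h2 _ iy m2.
split => //; first by rewrite mulf_neq0 // invr_eq0.
rewrite eB' // eA' //; field.
by rewrite m1 m2 s2.
Qed.

Lemma glue_openP (U : set glue) : (forall x, U x -> exists i Q, [/\ ok i, ch i x,
    Fn i Q, Q x != 0 & forall y, ch i y -> Q y != 0 -> U y]) -> zopen U.
Proof.
move=> h i x oi ix /h [j [Q [oj jx FQ Qx hQ]]].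
have [P' [Q' [FP' FQ' Q'x h']]] := reloc oi oj ix jx FQ FQ Qx.
exists Q'; split => // y iy Q'y.
by have [jy Qy _] := h' _ iy Q'y; exact: hQ.
Qed.

Lemma glue_local (U : set glue) g : (forall x, U x -> exists i P Q (V : set glue),
    [/\ zopen V, V x, [/\ ok i, ch i x, Fn i P & Fn i Q], Q x != 0 &
     forall y, U y -> V y -> ch i y -> Q y != 0 -> g y = P y / Q y]) ->
  regular U g.
Proof.
move=> h x /h [i [P [Q [V [oV Vx [oi ix FP FQ] Qx e]]]]].
have [K [FK Kx hK]] := oV _ _ oi ix Vx.
have [A FA eA] := FnM oi FP FK; have [B FB eB] := FnM oi FQ FK.
exists i, A, B; split => //; first by rewrite eB // mulf_neq0.
move=> y Uy iy; rewrite eA // eB // mulf_eq0 negb_or => /andP[Qy Ky].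
rewrite e //; last exact: hK.
by field; rewrite Qy Ky.
Qed.

Lemma glue_bin (F : C -> C -> C) :
  (forall i P Q P' Q', ok i -> Fn i P -> Fn i Q -> Fn i P' -> Fn i Q' ->
     exists A B, [/\ Fn i A, Fn i B & forall y, ch i y ->
      (B y != 0 <-> Q y != 0 /\ Q' y != 0) /\
      (B y != 0 -> F (P y / Q y) (P' y / Q' y) = A y / B y)]) ->
  forall (U : set glue) g h, zopen U -> regular U g -> regular U h ->
    regular U (fun x => F (g x) (h x)).
Proof.
move=> H U g h oU rg rh x Ux.
have [i [P [Q [oi ix [FP FQ] Qx e]]]] := rg _ Ux.
have [j [P1 [Q1 [oj jx [FP1 FQ1] Q1x e1]]]] := rh _ Ux.
have [P' [Q' [FP' FQ' Q'x e']]] := reloc oi oj ix jx FP1 FQ1 Q1x.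
have [A [B [FA FB hAB]]] := H _ _ _ _ _ oi FP FQ FP' FQ'.
exists i, A, B; split => //; first by apply/(proj1 (hAB _ ix)).
move=> y Uy iy By; have [hB e2] := hAB _ iy; have [Qy Q'y] := (proj1 hB) By.
rewrite -e2 //.
have [jy Q1y <-] := e' _ iy Q'y.
by rewrite -e // -e1.
Qed.

Lemma good_glue : good glue.
Proof.
split.
- move=> i x oi ix _; have [P FP eP] := FnC 1 oi.
  by exists P; split => //; rewrite eP // oner_neq0.
- move=> U V oU oV i x oi ix [Ux Vx].
  have [P [FP Px hP]] := oU _ _ oi ix Ux; have [Q [FQ Qx hQ]] := oV _ _ oi ix Vx.
  have [A FA eA] := FnM oi FP FQ; exists A; split => //.
    by rewrite eA // mulf_neq0.
  move=> y iy; rewrite eA // mulf_eq0 negb_or => /andP[Py Qy].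
  by split; [exact: hP|exact: hQ].
- move=> F hF i x oi ix [U FU Ux]; have [P [FP Px hP]] := hF _ FU _ _ oi ix Ux.
  by exists P; split => // y iy Py; exists U => //; exact: hP.
- move=> U g oU h; apply: glue_local => x Ux.
  have [V [k [oV Vx rk e]]] := h _ Ux.
  have [i [P [Q [oi ix [FP FQ] Qx e']]]] := rk _ Vx.
  exists i, P, Q, V; split => // y Uy Vy iy Qy.
  by rewrite e // e'.
- move=> c x _; have [i oi ix] := cover x.
  have [P FP eP] := FnC c oi; have [Q FQ eQ] := FnC 1 oi.
  exists i, P, Q; split => //; first by rewrite eQ // oner_neq0.
  by move=> y _ iy _; rewrite eP // eQ // divr1.
- apply: glue_bin => i P Q P' Q' oi FP FQ FP' FQ'.
  have [A FA eA] := FnM oi FP FQ'; have [B FB eB] := FnM oi FP' FQ.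
  have [A' FA' eA'] := FnD oi FA FB; have [B' FB' eB'] := FnM oi FQ FQ'.
  exists A', B'; split => // y iy.
  rewrite eB' // mulf_eq0 negb_or; split; first by split => /andP.
  by move=> /andP[q q']; rewrite eA' // eA // eB //; field; rewrite q q'.
- apply: glue_bin => i P Q P' Q' oi FP FQ FP' FQ'.
  have [A FA eA] := FnM oi FP FP'; have [B' FB' eB'] := FnM oi FQ FQ'.
  exists A, B'; split => // y iy.
  rewrite eB' // mulf_eq0 negb_or; split; first by split => /andP.
  by move=> /andP[q q']; rewrite eA //; field; rewrite q q'.
- move=> U g oU rg g0 x Ux; have [i [P [Q [oi ix [FP FQ] Qx e]]]] := rg _ Ux.
  have Px : P x != 0 by move: (g0 _ Ux); rewrite e // mulf_eq0 negb_or => /andP[].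
  have [A FA eA] := FnM oi FQ FQ; have [B FB eB] := FnM oi FP FQ.
  exists i, A, B; split => //; first by rewrite eB // mulf_neq0.
  move=> y Uy iy; rewrite eA // eB // mulf_eq0 negb_or => /andP[Py Qy].
  by rewrite e //; field; rewrite Py Qy.
- move=> U g oU rg; apply: glue_openP => x [Ux gx].
  have [i [P [Q [oi ix [FP FQ] Qx e]]]] := rg _ Ux.
  have Px : P x != 0 by move: gx; rewrite /= e // mulf_eq0 negb_or => /andP[].
  have [K [FK Kx hK]] := oU _ _ oi ix Ux.
  have [A FA eA] := FnM oi FP FQ; have [B FB eB] := FnM oi FA FK.
  exists i, B; split => //; first by rewrite eB // eA // !mulf_neq0.
  move=> y iy; rewrite eB // eA // !mulf_eq0 !negb_or => /andP[/andP[Py Qy] Ky].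
  have Uy := hK _ iy Ky.
  by split => //=; rewrite e // mulf_neq0 // invr_eq0.
Qed.

End Glue.

Section Affine.
Variable R : realType.
Local Notation C := R[i].
Local Notation A := (affine_space R).

Section Poly.
Variable n : nat.
Implicit Types (P Q : {mpoly C[n]}) (d : 'rV[C]_n).

Lemma evalC c (x : 'rV[C]_n) : eval (c%:MP : {mpoly C[n]}) x = c.
Proof. by rewrite /eval mevalC. Qed.

Lemma evalD P Q (x : 'rV[C]_n) : eval (P + Q) x = eval P x + eval Q x.
Proof. by rewrite /eval mevalD. Qed.

Lemma evalM P Q (x : 'rV[C]_n) : eval (P * Q) x = eval P x * eval Q x.
Proof. by rewrite /eval mevalM. Qed.

Lemma evalB P Q (x : 'rV[C]_n) : eval (P - Q) x = eval P x - eval Q x.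
Proof. by rewrite /eval mevalB. Qed.

Lemma evalXn P k (x : 'rV[C]_n) : eval (P ^+ k) x = eval P x ^+ k.
Proof. by rewrite /eval rmorphXn. Qed.

Lemma evalX i (x : 'rV[C]_n) : eval ('X_i : {mpoly C[n]}) x = x 0 i.
Proof. by rewrite /eval mevalXU. Qed.

Lemma eval_ind (K : {mpoly C[n]} -> Prop) :
  (forall c, K c%:MP) -> (forall i, K 'X_i) ->
  (forall P Q, K P -> K Q -> K (P + Q)) ->
  (forall P Q, K P -> K Q -> K (P * Q)) -> forall P, K P.
Proof.
move=> hC hX hD hM P.
have hm (m : 'X_{1..n}) : K 'X_[m].
  rewrite mpolyXE_id; elim/big_ind: _ => //; first exact: (hC 1).
  move=> i _; elim: (m i) => [|k IH]; first exact: (hC 1).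
  by rewrite exprS; apply: hM.
rewrite [P]mpolyE; elim/big_ind: _ => //; first by rewrite -mpolyC0; exact: hC.
by move=> m _; rewrite -mul_mpolyC; apply: hM.
Qed.

Lemma affine_glue : A n = @glue R 'rV[C]_n unit (fun=> True) (fun=> setT)
  (fun=> [set g | exists P, g = eval P]).
Proof.
rewrite /affine_space /glue; congr Space.
  apply/seteqP; split => U /=.
    move=> [S eS] [] x _ _ Ux; have : ~ zero_locus S x.
      by rewrite -eS; apply: contrapT => h; apply: h => /(_ Ux).
    move=> /existsNP [P /not_implyP [SP /eqP Px]]; exists (eval P); split => //.
      by exists P.
    move=> y _ Py; apply: contrapT => nU; have : (~` U) y by [].
    by rewrite eS => /(_ _ SP) e; rewrite e eqxx in Py.
  move=> h; exists [set P | forall y, ~ U y -> eval P y = 0].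
  apply/seteqP; split => [x nU P /(_ _ nU) //|x hx Ux].
  have [_ [[P ->] Px hP]] := h tt x I I Ux; move: Px.
  rewrite hx ?eqxx // => y nU; apply: contrapT => /eqP Py; apply: nU.
  exact: hP.
apply/funext => U; apply/seteqP; split => g /= h x Ux.
  have [P [Q [Qx e]]] := h _ Ux; exists tt, (eval P), (eval Q); split => //.
    by split; [exists P|exists Q].
  by move=> y Uy _; exact: e.
have [_ [_ [_ [_ _ [[P ->] [Q ->]] Qx e]]]] := h _ Ux.
by exists P, Q; split => // y Uy; exact: e.
Qed.

Lemma good_affine : good (A n).
Proof.
rewrite affine_glue; apply: good_glue.
- by move=> x; exists tt.
- by move=> _ c _; exists (eval c%:MP); [exists c%:MP|move=> x _; rewrite evalC].
- move=> _ _ _ _ [P ->] [Q ->]; exists (eval (P + Q)); first by exists (P + Q).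
  by move=> x _; rewrite evalD.
- move=> _ _ _ _ [P ->] [Q ->]; exists (eval (P * Q)); first by exists (P * Q).
  by move=> x _; rewrite evalM.
- move=> _ _ x _ _ _ _ _ [Q ->]; exists (eval 1%:MP), (eval Q); split.
  + by exists 1%:MP.
  + by exists Q.
  + by rewrite evalC oner_neq0.
  + by move=> y _ _; rewrite evalC divr1.
Qed.

Lemma affine_open (U : set (A n)) (p : A n) : zopen U -> U p ->
  exists2 Q, eval Q p != 0 & forall y, eval Q y != 0 -> U y.
Proof.
move=> [S eS] Up; have : ~ zero_locus S p.
  by rewrite -eS; apply: contrapT => h; apply: h => /(_ Up).
move=> /existsNP [P /not_implyP [SP /eqP Px]]; exists P => //.
move=> y Py; apply: contrapT => nU; have : (~` U) y by [].
by rewrite eS => /(_ _ SP) e; rewrite e eqxx in Py.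
Qed.

Lemma around_affine (p : A n) K : around p K ->
  exists2 Q, eval Q p != 0 & forall y, eval Q y != 0 -> K y.
Proof.
move=> [U [oU Up h]]; have [Q Qp hQ] := affine_open oU Up.
by exists Q => // y /hQ /h.
Qed.

Lemma coord_germ i (p : A n) : germ p (fun x : A n => x 0 i).
Proof.
exists setT; split => //; first exact: goodT good_affine.
move=> x _; exists 'X_i, 1%:MP; split; first by rewrite evalC oner_neq0.
by move=> y _ _; rewrite evalC evalX divr1.
Qed.

Lemma germ_eval (X : space R) (gX : good X) (f : X -> A n) (x : X) Q :
  (forall i, germ x (fun y => f y 0 i)) -> germ x (fun y => eval Q (f y)).
Proof.
move=> hf; elim/eval_ind: Q => [c|i|P Q|P Q].
- by have := germ_cst gX x c; congr germ; apply/funext => y; rewrite evalC.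
- by have := hf i; congr germ; apply/funext => y; rewrite evalX.
- by move=> h1 h2; have := germD gX h1 h2; congr germ; apply/funext => y; rewrite evalD.
- by move=> h1 h2; have := germM gX h1 h2; congr germ; apply/funext => y; rewrite evalM.
Qed.

Lemma poly_germ Q (p : A n) : germ p (eval Q).
Proof. by apply: (germ_eval good_affine (f := id)) => i; exact: coord_germ. Qed.

Lemma poly_open Q : zopen [set x : A n | eval Q x != 0].
Proof.
by apply: (openP good_affine) => p; exact: germ_neq0 good_affine _ _ (poly_germ _ _).
Qed.

Lemma germ_quot (p : A n) g : germ p g -> exists P Q, eval Q p != 0 /\
  around p (fun y => eval Q y != 0 /\ g y = eval P y / eval Q y).
Proof.
move=> [U [oU Up rg]]; have [P [Q [Qp e]]] := rg _ Up.
exists P, Q; split => //.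
exists (U `&` [set x | eval Q x != 0]); split => //.
  by apply: (goodI good_affine) => //; exact: poly_open.
by move=> y [Uy Qy]; rewrite -e.
Qed.

Lemma mor_affine (X : space R) (f : X -> A n) (x : X) : good X ->
  (forall i, germ x (fun y => f y 0 i)) -> mor_at f x.
Proof.
move=> gX hf; have hQ Q := germ_eval gX Q hf; split => [O oO Ox|h /germ_quot].
  have [Q Qx hO] := affine_open oO Ox.
  by apply: around_mono (germ_neq0 gX (hQ Q) Qx) => y /hO.
move=> [P [Q [Qx /around_affine [K Kx hK]]]].
have := germM gX (hQ P) (germV gX (hQ Q) Qx).
move=> /(germ_eq gX); apply.
by apply: around_mono (germ_neq0 gX (hQ K) Kx) => y /hK [].
Qed.

Lemma poly_line Q (p : A n) d : exists r : {poly C},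
  forall l, r.[l] = eval Q (p + l *: d).
Proof.
elim/eval_ind: Q => [c|i|P Q|P Q].
- by exists c%:P => l; rewrite evalC hornerC.
- exists ((p 0 i)%:P + (d 0 i) *: 'X) => l.
  by rewrite evalX !mxE !hornerE mulrC.
- by move=> [r hr] [s hs]; exists (r + s) => l; rewrite hornerD hr hs evalD.
- by move=> [r hr] [s hs]; exists (r * s) => l; rewrite hornerM hr hs evalM.
Qed.

Lemma line_open (U : set (A n)) (p : A n) d : zopen U -> U p ->
  exists r : {poly C}, r.[0] != 0 /\ forall l, r.[l] != 0 -> U (p + l *: d).
Proof.
move=> oU Up; have [Q Qp hQ] := affine_open oU Up.
have [r hr] := poly_line Q p d; exists r; split.
  by rewrite hr scale0r addr0.
by move=> l; rewrite hr => /hQ.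
Qed.

Lemma poly_nonroot (r : {poly C}) : r != 0 -> exists l, r.[l] != 0.
Proof.
move=> r0; apply: contrapT => h.
have := @max_poly_roots _ r [seq k%:R | k <- iota 0 (size r)] r0.
rewrite size_map size_iota ltnn => H; suff : false by [].
apply: H; first by apply/allP => _ /mapP [k _ ->]; apply/negPn/negP => ?; apply: h; exists k%:R.
by rewrite map_inj_uniq ?iota_uniq //; exact: (mulrIn (oner_neq0 _)).
Qed.

Lemma nz_at0 (r : {poly C}) l : r.[l] != 0 -> r != 0.
Proof. by apply: contraNneq => ->; rewrite horner0. Qed.

(** A set that contains almost all points of any line through two of its points
  is irreducible: two nonempty open subsets of it already meet on a line. *)
Lemma irreducible_lines (Z : set (A n)) : Z !=set0 ->
  (forall p q, Z p -> Z q -> exists r : {poly C}, r != 0 /\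
    forall l, r.[l] != 0 -> Z (p + l *: (q - p))) -> irreducible Z.
Proof.
move=> Z0 hl; apply/irreducibleP; split => // U V oU oV [p [Zp Up]] [q [Zq Vq]].
have [r [r0 hr]] := hl _ _ Zp Zq.
have [s [s0 hs]] := line_open (q - p) oU Up.
have [t [t0 ht]] := line_open (p - q) oV Vq.
pose t' := t \Po (1 - 'X).
have t'0 : t' != 0 by apply: (@nz_at0 _ 1); rewrite horner_comp !hornerE subrr.
have : r * s * t' != 0 by rewrite !mulf_neq0 // (nz_at0 s0).
move=> /poly_nonroot [l]; rewrite !hornerM !mulf_eq0 !negb_or => /andP[/andP[rl sl] tl].
exists (p + l *: (q - p)); split; [exact: hr|exact: hs|].
have -> : p + l *: (q - p) = q + (1 - l) *: (p - q).
  rewrite scalerBl scale1r addrA addrCA subrr addr0 -(opprB q p) scalerN opprK //.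
apply: ht; move: tl; by rewrite horner_comp !hornerE.
Qed.

Lemma irreducible_linear (L : set (A n)) Q :
  (forall p q l, L p -> L q -> L (p + l *: (q - p))) ->
  L `&` [set x | eval Q x != 0] !=set0 ->
  irreducible (L `&` [set x | eval Q x != 0]).
Proof.
move=> hL h0; apply: irreducible_lines => // p q [Lp Qp] [Lq Qq].
have [r hr] := poly_line Q p (q - p); exists r; split.
  by apply: (@nz_at0 _ 0); rewrite hr scale0r addr0.
by move=> l; rewrite hr => ?; split => //; exact: hL.
Qed.

(** The coordinate functions centred at a point generate its maximal ideal. *)
Lemma poly_max_ideal P (p : A n) : exists F : 'I_n -> {mpoly C[n]},
  forall x, eval P x = eval P p + \sum_i (x 0 i - p 0 i) * eval (F i) x.
Proof.
elim/eval_ind: P => [c|i|P Q [F hF] [G hG]|P Q [F hF] [G hG]].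
- exists (fun=> 0%:MP) => x; rewrite !evalC big1 ?addr0 // => i _.
  by rewrite mulr0.
- exists (fun j => (j == i)%:R%:MP) => x; rewrite !evalX (bigD1 i) //= big1.
    by rewrite evalC eqxx mulr1 addr0 addrC subrK.
  by move=> j /negPf ->; rewrite evalC mulr0.
- exists (fun i => F i + G i) => x; rewrite !evalD {1}hF {1}hG.
  under [in RHS]eq_bigr do rewrite evalD mulrDr.
  by rewrite big_split /=; ring.
- exists (fun i => F i * Q + (eval P p)%:MP * G i) => x.
  transitivity (eval P p * eval Q p +
    ((\sum_i (x 0 i - p 0 i) * eval (F i) x) * eval Q x +
     eval P p * \sum_i (x 0 i - p 0 i) * eval (G i) x)).
    rewrite evalM; have e := hF x; have e' := hG x.
    by rewrite [in LHS]e mulrDl {1}e'; ring.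
  rewrite evalM; congr (_ + _); rewrite mulr_suml mulr_sumr -big_split.
  by apply: eq_bigr => i _; rewrite evalD !evalM evalC /=; ring.
Qed.

Lemma germ_max_ideal (p : A n) h : germ p h ->
  exists q : 'I_n -> A n -> C, (forall i, germ p (q i)) /\
    around p (fun x => h x = h p + \sum_i (x 0 i - p 0 i) * q i x).
Proof.
move=> /germ_quot [P [Q [Qp aQ]]]; have [_ hp] := around_pt aQ.
have [F hF] := poly_max_ideal (P * (eval Q p)%:MP - (eval P p)%:MP * Q) p.
exists (fun i x => eval (F i) x / (eval Q x * eval Q p)); split.
  move=> i; apply: (germM good_affine); first exact: poly_germ.
  apply: (germV good_affine); last by rewrite mulf_neq0.
  apply: (germM good_affine); [exact: poly_germ|exact: germ_cst good_affine _ _].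
apply: around_mono aQ => x [Qx ->]; rewrite hp.
under eq_bigr do rewrite mulrA; rewrite -mulr_suml.
have := hF x; rewrite !evalB !evalM !evalC mulrC subrr add0r => <-.
by field; rewrite Qx Qp.
Qed.

Definition flat (k : 'I_n) (x : 'rV[C]_n) : 'rV[C]_n :=
  \row_i (if i == k then 0 else x 0 i).

Lemma flat_id k (x : 'rV[C]_n) : x 0 k = 0 -> flat k x = x.
Proof. by move=> h; apply/rowP => i; rewrite mxE; case: eqP => // ->. Qed.

Lemma flat_germ k (p : A n) i : germ p (fun x : A n => flat k x 0 i).
Proof.
have [e|e] := eqVneq i k.
  have := germ_cst good_affine p 0; congr germ; apply/funext => x.
  by rewrite mxE e eqxx.
have := coord_germ i p; congr germ; apply/funext => x.
by rewrite mxE (negPf e).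
Qed.

Lemma poly_flat k P : exists F, forall x,
  eval P x = eval P (flat k x) + x 0 k * eval F x.
Proof.
elim/eval_ind: P => [c|i|P Q [F hF] [G hG]|P Q [F hF] [G hG]].
- by exists 0%:MP => x; rewrite !evalC mulr0 addr0.
- exists (i == k)%:R%:MP => x; rewrite !evalX evalC mxE.
  by case: eqP => [->|_]; rewrite ?mulr1 ?mulr0 ?add0r ?addr0.
- by exists (F + G) => x; rewrite !evalD {1}hF {1}hG; ring.
- exists (F * Q + (P - 'X_k * F) * G) => x.
  have -> : eval (P * Q) (flat k x) =
      (eval P x - x 0 k * eval F x) * (eval Q x - x 0 k * eval G x).
    by rewrite evalM (hF x) (hG x) !addrK.
  by rewrite !(evalB, evalM, evalD, evalX); ring.
Qed.

(** A germ that vanishes on the coordinate hyperplane is divisible by the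
  coordinate, because its numerator is constant along the projection to the
  hyperplane up to multiples of that coordinate. *)
Lemma local_eq_coord k (p : A n) : p 0 k = 0 ->
  local_equation [set x : A n | x 0 k = 0] p (fun x : A n => x 0 k).
Proof.
move=> pk; split; first exact: coord_germ.
  by apply: (around_all good_affine).
move=> h /germ_quot [P [Q [Qp aQ]]] a0.
have [F hF] := poly_flat k P.
exists (fun x => eval F x / eval Q x).
  apply: (germM good_affine); first exact: poly_germ.
  by apply: (germV good_affine) => //; exact: poly_germ.
have mf : mor_at (flat k : A n -> A n) p.
  by apply: (mor_affine good_affine) => i; exact: flat_germ.
have := around_and good_affine aQ a0; rewrite -{1}(flat_id pk) => /(mor_around mf).
apply: (around_mono2 good_affine _ aQ) => x [Qx ->] [[Qf e] z].
have zf : h (flat k x) = 0 by apply: z; rewrite /= mxE eqxx.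
have Pf : eval P (flat k x) = 0.
  by move: e; rewrite zf => /esym/eqP; rewrite mulf_eq0 invr_eq0 (negPf Qf) orbF => /eqP.
by rewrite hF Pf add0r; field.
Qed.

(** Distinct coordinates are independent in the cotangent space: on the line
  in direction [k] an element of the square of the maximal ideal vanishes to
  second order. *)
Lemma coord_cotangent (p : A n) (c : 'I_n -> C) :
  max_ideal_sqr p (fun x : A n => \sum_i c i * (x 0 i - p 0 i)) ->
  forall k, c k = 0.
Proof.
move=> [m [a [b [ha hb ab]]]] k; apply/eqP/negPn/negP => ck.
have /choice [qa hqa] : forall j, exists q : 'I_n -> A n -> C,
  (forall i, germ p (q i)) /\
  around p (fun x => a j x = \sum_i (x 0 i - p 0 i) * q i x).
  move=> j; have [ga aj] := ha j; have [q [gq aq]] := germ_max_ideal ga.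
  by exists q; split => //; move: aq; rewrite aj; apply: around_mono => y; rewrite add0r.
have /choice [qb hqb] : forall j, exists q : 'I_n -> A n -> C,
  (forall i, germ p (q i)) /\
  around p (fun x => b j x = \sum_i (x 0 i - p 0 i) * q i x).
  move=> j; have [ga aj] := hb j; have [q [gq aq]] := germ_max_ideal ga.
  by exists q; split => //; move: aq; rewrite aj; apply: around_mono => y; rewrite add0r.
pose g (x : A n) := c k - (x 0 k - p 0 k) * \sum_j qa j k x * qb j k x.
have gg : germ p g.
  apply: (germB good_affine); first exact: (germ_cst good_affine).
  apply: (germM good_affine).
    by apply: (germB good_affine); [exact: coord_germ|exact: (germ_cst good_affine)].
  apply: (germ_sum good_affine) => j; apply: (germM good_affine).
    by case: (hqa j).
  by case: (hqb j).
have g0 : g p != 0 by rewrite /g subrr mul0r subr0.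
have nz := germ_neq0 good_affine gg g0.
have aa := around_forall good_affine (fun j => proj2 (hqa j)).
have bb := around_forall good_affine (fun j => proj2 (hqb j)).
have [U [oU Up hU]] := around_and good_affine (around_and good_affine ab nz)
  (around_and good_affine aa bb).
pose d : 'rV[C]_n := \row_i (i == k)%:R.
have [r [r0 hr]] := line_open d oU Up.
have : r * 'X != 0 by rewrite mulf_neq0 ?polyX_eq0 // (nz_at0 r0).
move=> /poly_nonroot [l]; rewrite hornerM hornerX mulf_eq0 negb_or => /andP[rl l0].
have [[e]] := hU _ (hr _ rl); rewrite /g => nzl [eA eB].
have hd i : (p + l *: d) 0 i - p 0 i = l * (i == k)%:R.
  by rewrite !mxE addrAC subrr add0r.
have S (f : 'I_n -> C) : \sum_i l * (i == k)%:R * f i = l * f k.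
  rewrite (bigD1 k) //= eqxx mulr1 big1 ?addr0 // => i /negPf ->.
  by rewrite mulr0 mul0r.
move: nzl => /eqP; apply; rewrite hd eqxx mulr1.
have : c k * l = l * l * \sum_j qa j k (p + l *: d) * qb j k (p + l *: d).
  rewrite mulr_sumr; transitivity (\sum_i c i * ((p + l *: d) 0 i - p 0 i)).
    under eq_bigr do rewrite hd mulrC.
    by rewrite S mulrC.
  rewrite e; apply: eq_bigr => j _; rewrite eA eB.
  under eq_bigr do rewrite hd; under [X in _ * X = _]eq_bigr do rewrite hd.
  by rewrite !S; ring.
rewrite (mulrC (c k)) -mulrA => /(mulfI l0) ->; by rewrite subrr.
Qed.

End Poly.
End Affine.

(** * A unimodular triangulation of the orthant *)

Definition zvec : Type := int * int * int.
Definition simplex : Type := zvec * zvec * zvec.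
HB.instance Definition _ := Equality.on zvec.
HB.instance Definition _ := Equality.on simplex.

(** Unimodular triangles, grouped by the chambers in which x^5, y^3 and z^2 are
  initial. *)
Definition tris : seq simplex :=
  [:: ((0, 0, 1), (1, 2, 3), (0, 1, 0));
  ((0, 0, 1), (3, 5, 8), (1, 2, 3));
  ((0, 1, 0), (1, 2, 3), (2, 4, 5));
  ((1, 2, 3), (3, 5, 8), (2, 4, 5));
  ((2, 4, 5), (3, 5, 8), (4, 7, 10));
  ((3, 5, 8), (6, 10, 15), (4, 7, 10));
  ((0, 0, 1), (1, 0, 0), (1, 1, 2));
  ((0, 0, 1), (1, 1, 2), (2, 3, 5));
  ((0, 0, 1), (2, 3, 5), (3, 5, 8));
  ((1, 0, 0), (2, 2, 3), (1, 1, 2));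
  ((1, 1, 2), (2, 2, 3), (2, 3, 5));
  ((2, 2, 3), (3, 4, 6), (2, 3, 5));
  ((2, 3, 5), (3, 4, 6), (3, 5, 8));
  ((3, 4, 6), (4, 6, 9), (3, 5, 8));
  ((3, 5, 8), (4, 6, 9), (5, 8, 12));
  ((3, 5, 8), (5, 8, 12), (6, 10, 15));
  ((0, 1, 0), (1, 1, 1), (1, 0, 0));
  ((0, 1, 0), (1, 2, 2), (1, 1, 1));
  ((0, 1, 0), (2, 4, 5), (1, 2, 2));
  ((1, 0, 0), (1, 1, 1), (2, 2, 3));
  ((1, 1, 1), (1, 2, 2), (2, 2, 3));
  ((1, 2, 2), (2, 3, 4), (2, 2, 3));
  ((1, 2, 2), (2, 4, 5), (2, 3, 4));
  ((2, 2, 3), (2, 3, 4), (3, 4, 6));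
  ((2, 3, 4), (2, 4, 5), (3, 4, 6));
  ((2, 4, 5), (3, 5, 7), (3, 4, 6));
  ((2, 4, 5), (4, 7, 10), (3, 5, 7));
  ((3, 4, 6), (3, 5, 7), (4, 6, 9));
  ((3, 5, 7), (4, 7, 10), (4, 6, 9));
  ((4, 6, 9), (4, 7, 10), (5, 8, 12));
  ((4, 7, 10), (6, 10, 15), (5, 8, 12))].

Definition dotz (s t : zvec) : int :=
  s.1.1 * t.1.1 + s.1.2 * t.1.2 + s.2 * t.2.
Definition cross (s t : zvec) : zvec :=
  (s.1.2 * t.2 - s.2 * t.1.2, s.2 * t.1.1 - s.1.1 * t.2,
   s.1.1 * t.1.2 - s.1.2 * t.1.1).
Definition addz (s t : zvec) : zvec :=
  (s.1.1 + t.1.1, s.1.2 + t.1.2, s.2 + t.2).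
Definition scalez (c : int) (t : zvec) : zvec :=
  (c * t.1.1, c * t.1.2, c * t.2).
Definition sel (T : Type) (t : T * T * T) (k : nat) : T :=
  if k is 0 then t.1.1 else if k is 1 then t.1.2 else t.2.

(** The weight of a vector for the monomials x^5, y^3, z^2 . *)
Definition wt (u : zvec) (a : nat) : int :=
  sel (5%:Z * u.1.1, 3%:Z * u.1.2, 2%:Z * u.2) a.

(** The triangulation is induced by the convex piecewise linear function that
  interpolates these values.  The second term dominates, and bends exactly
  along the walls of the Groebner fan; the first bends enough inside the
  three chambers to make every lattice point a vertex.  The linear parts -15z
  and 143 * 2z only keep the values small. *)
Definition height (u : zvec) : int :=
  u.2 * (u.2 - 15%:Z) +
  143%:Z * (wt u 2 - Order.min (wt u 0) (Order.min (wt u 1) (wt u 2))).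

(** For a unimodular triple the cross products of its members form the dual
  basis. *)
Definition dualz (t : simplex) k :=
  sel (cross t.1.2 t.2, cross t.2 t.1.1, cross t.1.1 t.1.2) k.
(** The linear function that takes the prescribed heights at the vertices. *)
Definition linz (t : simplex) := addz (scalez (height t.1.1) (dualz t 0))
  (addz (scalez (height t.1.2) (dualz t 1)) (scalez (height t.2) (dualz t 2))).

Definition ok_dual (t : simplex) := all (fun i => all (fun j =>
  dotz (dualz t i) (sel t j) == (i == j)%:R) (iota 0 3)) (iota 0 3).
Definition ok_orth (t : simplex) := all (fun k =>
  [&& 0 <= (sel t k).1.1, 0 <= (sel t k).1.2 & 0 <= (sel t k).2]) (iota 0 3).
(** Strict convexity: the linear function of a triangle lies below the heights,
  and reaches them only at its own vertices. *)
Definition ok_conv (t t' : simplex) := let l := linz t in all (fun k =>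
  let v := sel t' k in let c := dotz l v - height v in
  (c <= 0) && ((c == 0) ==> has (fun j => v == sel t j) (iota 0 3))) (iota 0 3).
(** A side of a triangle either lies in a coordinate plane or is shared with a
  triangle whose linear function differs by a negative multiple of the
  functional that vanishes on that side. *)
Definition ok_wall (t : simplex) := let l := linz t in all (fun k =>
  [&& 0 <= (dualz t k).1.1, 0 <= (dualz t k).1.2 & 0 <= (dualz t k).2] ||
  has (fun t' => let l' := linz t' in all (fun j =>
     let c := dotz l' (sel t j) - dotz l (sel t j) in
     if j == k then c < 0 else c == 0) (iota 0 3)) tris) (iota 0 3).
(** This makes the triangulation a refinement of the Groebner fan. *)
Definition ok_groebner (t : simplex) := has (fun a => all (fun k => all (fun b =>
  wt (sel t k) a <= wt (sel t k) b) (iota 0 3)) (iota 0 3)) (iota 0 3).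

Lemma tris_check : all (fun t => [&& ok_dual t, ok_orth t, all (ok_conv t) tris,
  ok_wall t & ok_groebner t]) tris.
Proof. by vm_compute. Qed.

Definition gen (t : simplex) (k : 'I_3) : N := vz (sel t k).
Definition dgen (t : simplex) (k : 'I_3) : N := vz (dualz t k).
Definition lin (t : simplex) : N := vz (linz t).

Lemma ord3E (k : 'I_3) : (k : nat) \in iota 0 3.
Proof. by rewrite mem_iota /=. Qed.

Lemma pr_dotz u v : pr (vz u) (vz v) = dotz u v.
Proof. exact: pr_vz. Qed.

Lemma vz_inj : injective vz.
Proof.
move=> [[a b] c] [[a' b'] c'] /rowP h.
by have := h 0; have := h 1; have := h 2%:R; rewrite !mxE /= => -> -> ->.
Qed.

Lemma tri_ok t : t \in tris -> [&& ok_dual t, ok_orth t, all (ok_conv t) tris,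
  ok_wall t & ok_groebner t].
Proof. by move: t; apply/allP; exact: tris_check. Qed.

Lemma tri_dual t : t \in tris -> dualb (gen t) (dgen t) 1.
Proof.
move=> /tri_ok /and5P[/allP h _ _ _ _]; split=> // i j; rewrite pr_dotz.
by have /allP/(_ _ (ord3E j))/eqP -> := h _ (ord3E i).
Qed.

Lemma tri_orth t k i : t \in tris -> 0 <= gen t k 0 i.
Proof.
move=> /tri_ok /and5P[_ /allP h _ _ _].
have /and3P[h0 h1 h2] := h _ (ord3E k); rewrite mxE.
by case: i => [[|[|[|//]]]].
Qed.

Lemma pr_lin_gen t k : t \in tris -> pr (lin t) (gen t k) = height (sel t k).
Proof.
move=> tt; have [_ hD] := tri_dual tt.
have e : lin t = \sum_(j < 3) height (sel t j) *: dgen t j.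
  rewrite !big_ord_recl big_ord0 addr0 /lin /linz /dgen.
  by apply/rowP => i; rewrite !mxE; case: i => [[|[|[|//]]]].
rewrite e pr_sum (bigD1 k) //= prZ hD eqxx mulr1n mulr1 big1 ?addr0 // => j /negPf jk.
by rewrite prZ hD jk mulr0n mulr0.
Qed.

Lemma tri_conv t t' k : t \in tris -> t' \in tris ->
  pr (lin t) (gen t' k) <= pr (lin t') (gen t' k) /\
  (pr (lin t) (gen t' k) = pr (lin t') (gen t' k) -> exists j, gen t' k = gen t j).
Proof.
move=> tt tt'; rewrite (pr_lin_gen _ tt') pr_dotz.
have /and5P[_ _ /allP/(_ _ tt')/allP/(_ _ (ord3E k)) hc _ _] := tri_ok tt.
move: hc; cbv zeta; rewrite subr_le0 subr_eq0 => /andP[-> /implyP h].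
split=> // /eqP/h /hasP [j]; rewrite mem_iota /= => j3 /eqP e.
by exists (Ordinal j3); rewrite /gen e.
Qed.

(** Across a wall of the triangulation the convex function bends upwards; the
  other walls lie in coordinate planes. *)
Lemma tri_wall t k : t \in tris -> (forall i, 0 <= dgen t k 0 i) \/
  exists t' c, [/\ t' \in tris, 0 < c & lin t' - lin t = - c *: dgen t k].
Proof.
move=> tt; have /and5P[_ _ _ /allP/(_ _ (ord3E k)) hw _] := tri_ok tt.
case/orP: hw => [/and3P[h0 h1 h2]|].
  by left => i; rewrite mxE; case: i => [[|[|[|//]]]].
move=> /hasP [t' tt' /allP h]; right.
pose c := pr (lin t) (gen t k) - pr (lin t') (gen t k).
have [_ hD] := tri_dual tt.
exists t', c; split => //.
  by have := h _ (ord3E k); rewrite eqxx /= -!pr_dotz subr_lt0 -subr_gt0.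
have hB j : pr (lin t' - lin t) (gen t j) = pr (- c *: dgen t k) (gen t j).
  rewrite prB prZ hD; have := h _ (ord3E j) => /=; rewrite -!pr_dotz.
  have [->|jk] := eqVneq j k.
    by move=> _; rewrite mulr1n mulr1 /c opprB.
  rewrite -[(j == k :> nat)]/(j == k) (negPf jk) subr_eq0 mulr0n mulr0.
  by move=> /eqP ->; rewrite subrr.
pose G : 'M[int]_3 := \matrix_(i, j) gen t j 0 i.
pose D : 'M[int]_3 := \matrix_(i, j) dgen t i 0 j.
have GD : G *m D = 1%:M.
  apply: mulmx1C; apply/matrixP => i j; rewrite !mxE -hD.
  by apply: eq_bigr => l _; rewrite !mxE.
rewrite -[LHS]mulmx1 -[RHS]mulmx1 -GD !mulmxA; congr (_ *m _).
apply/rowP => j; have := hB j; rewrite /pr !mxE => e.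
by transitivity (\sum_i (lin t' - lin t) 0 i * gen t j 0 i);
  [apply: eq_bigr => i _; rewrite !mxE | rewrite e; apply: eq_bigr => i _; rewrite !mxE].
Qed.

Lemma dual_expand (F : comPzRingType) (f : {rmorphism int -> F}) B D (w : 'rV[F]_3) :
  dualb B D 1 -> w = \sum_k (\sum_i f (D k 0 i) * w 0 i) *: map_mx f (B k).
Proof.
move=> [_ hD].
pose G : 'M[int]_3 := \matrix_(i, j) B j 0 i.
pose E : 'M[int]_3 := \matrix_(i, j) D i 0 j.
have GE : G *m E = 1%:M.
  apply: mulmx1C; apply/matrixP => i j; rewrite !mxE -hD.
  by apply: eq_bigr => l _; rewrite !mxE.
apply/rowP => j; rewrite summxE.
have e : map_mx f G *m map_mx f E = 1%:M by rewrite -map_mxM GE map_mx1.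
transitivity (\sum_i (\sum_k f (B k 0 j) * f (D k 0 i)) * w 0 i).
  have ei i : \sum_k f (B k 0 j) * f (D k 0 i) = (j == i)%:R.
    have /matrixP/(_ j i) := e; rewrite !mxE => <-.
    by apply: eq_bigr => k _; rewrite !mxE.
  rewrite (bigD1 j) //= ei eqxx mul1r big1 ?addr0 // => i /negPf.
  by rewrite ei eq_sym => ->; rewrite mul0r.
under eq_bigr do rewrite mulr_suml.
rewrite exchange_big /=; apply: eq_bigr => k _; rewrite !mxE mulr_suml.
by apply: eq_bigr => i _; ring.
Qed.

Lemma exists_max (T : eqType) d (F : orderType d) (s : seq T) (P : pred T) (f : T -> F) :
  (exists2 x, x \in s & P x) ->
  exists x, [/\ x \in s, P x & forall y, y \in s -> P y -> (f y <= f x)%O].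
Proof.
move=> [x xs Px]; pose s' := [seq y <- s | P y].
have xs' : x \in s' by rewrite mem_filter Px.
suff [z zs' hz] : exists2 z, z \in s' & forall y, y \in s' -> (f y <= f z)%O.
  move: (zs'); rewrite mem_filter => /andP[Pz zs]; exists z; split => // y ys Py.
  by apply: hz; rewrite mem_filter Py.
elim: s' x xs' {xs Px} => // a s' IH x _; case: s' IH => [_|b s' IH].
  by exists a; rewrite ?mem_seq1 // => y; rewrite mem_seq1 => /eqP ->.
have [z zs hz] := IH b (mem_head _ _).
case: (leP (f a) (f z)) => h; [exists z|exists a]; rewrite ?mem_head // 1?in_cons ?zs ?orbT //.
  by move=> y; rewrite in_cons => /orP[/eqP -> //|/hz].
move=> y; rewrite in_cons => /orP[/eqP -> //|/hz hy]; exact: le_trans hy (ltW h).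
Qed.

(** * The fan of the triangulation *)

Section Fan.
Variable R : realType.
Local Notation V := 'rV[R]_3.

Definition e8fan : set (set V) :=
  [set C | exists t a, t \in tris /\ C = cof (gen t) a].

Lemma e8fan_cof t a : t \in tris -> e8fan (cof (gen t) a).
Proof. by move=> tt; exists t, a. Qed.

(** The difference of the two linear functions that interpolate the convex
  function separates the simplices; a small multiple of the dual basis then
  singles out the common face. *)
Lemma tri_sep t t' (a a' : pred 'I_3) : t \in tris -> t' \in tris -> exists m,
  [/\ forall k, a k -> 0 <= pr m (gen t k),
      forall k, a' k -> pr m (gen t' k) <= 0 &
      forall k, a k -> pr m (gen t k) = 0 -> exists2 j, a' j & gen t k = gen t' j].
Proof.
move=> tt tt'; have [_ hD] := tri_dual tt'.
pose m' := \sum_(k | ~~ a' k) dgen t' k.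
have hm' j : pr m' (gen t' j) = (~~ a' j)%:R.
  rewrite /m' pr_sum (eq_bigr (fun k => if k == j then 1 else 0)); last first.
    by move=> k _; rewrite hD; case: eqP.
  rewrite -big_mkcondr /=; case: (boolP (a' j)) => aj.
    by rewrite big1 // => k /andP[h /eqP ?]; subst k; rewrite aj in h.
  by rewrite (big_pred1 j) // => k /=; case: eqP => [->|]; rewrite ?aj ?andbF.
pose K := \sum_k `|pr m' (gen t k)|.
have hK k : - K <= pr m' (gen t k).
  rewrite lerNl; apply: le_trans (ler_norm _) _; rewrite normrN /K (bigD1 k) //= lerDl.
  by apply: sumr_ge0.
have K0 : 0 <= K by apply: sumr_ge0.
pose m := (1 + K) *: (lin t - lin t') + m'.
have hm u : pr m u = (1 + K) * (pr (lin t) u - pr (lin t') u) + pr m' u.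
  by rewrite prD prZ prB.
have key k : pr m (gen t k) = 0 \/ 0 < pr m (gen t k).
  have [le eq] := tri_conv k tt' tt; rewrite hm.
  have [e|ne] := eqVneq (pr (lin t') (gen t k)) (pr (lin t) (gen t k)).
    rewrite e subrr mulr0 add0r; have [j ->] := eq e; rewrite hm'.
    by case: (a' j); [left|right].
  right; have : 1 <= pr (lin t) (gen t k) - pr (lin t') (gen t k) by move/eqP: ne; lia.
  move=> h1; have := hK k; nia.
exists m; split => [k _|k ak|k ak e].
- by case: (key k) => [->|/ltW].
- have [le _] := tri_conv k tt tt'; rewrite hm hm' ak addr0.
  by rewrite mulr_ge0_le0 ?subr_le0 // addr_ge0.
- have [le eq] := tri_conv k tt' tt; move: e; rewrite hm => e.
  have [e'|ne] := eqVneq (pr (lin t') (gen t k)) (pr (lin t) (gen t k)).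
    move: e; rewrite e' subrr mulr0 add0r; have [j ej] := eq e'; rewrite ej hm'.
    by case: (boolP (a' j)) => // aj _; exists j.
  have h1 : 1 <= pr (lin t) (gen t k) - pr (lin t') (gen t k) by move/eqP: ne; lia.
  have := hK k; nia.
Qed.

(** Intersections are computed generator by generator, because a separating
  functional vanishes on the intersection. *)
Lemma tri_inter t t' (a a' : pred 'I_3) : t \in tris -> t' \in tris ->
  @cof R (gen t) a `&` cof (gen t') a' =
  cof (gen t) (fun k => a k && [exists j, a' j && (gen t k == gen t' j)]).
Proof.
move=> tt tt'; have [m [hm hm' hm0]] := tri_sep a a' tt tt'.
apply/seteqP; split => [w [hw h']|w hw]; last first.
  split; first by apply: cof_mono hw => k /andP[].
  by apply: cof_sub hw => k /andP[_ /existsP [j /andP[aj /eqP e]]]; exists j.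
apply: (cof_common hm _ hw) => [k ak /(hm0 _ ak) [j aj e]|].
  by exists k => //; rewrite ak; apply/existsP; exists j; rewrite aj e eqxx.
apply/eqP; rewrite eq_le; apply/andP; split; last first.
  by apply: dot_ge0_cof hw => k /hm; rewrite dot_lat ler0z.
rewrite -oppr_ge0 dotC -dotNr dotC -latN; apply: dot_ge0_cof h' => k /hm'.
by rewrite dot_lat ler0z prN oppr_ge0.
Qed.

Lemma e8fan_face C F : e8fan C -> face F C -> e8fan F.
Proof.
by move=> [t [a [tt ->]]] /face_cof [a' [_ ->]]; exact: e8fan_cof.
Qed.

Lemma e8fan_inter C C' : e8fan C -> e8fan C' -> face (C `&` C') C.
Proof.
move=> [t [a [tt ->]]] [t' [a' [tt' ->]]]; rewrite tri_inter //.
by apply: (cof_face _ (tri_dual tt)) => k /andP[].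
Qed.

Lemma e8fan_fan : fan e8fan.
Proof.
split.
- pose F (x : seq_sub tris * {set 'I_3}) : set V :=
    cof (gen (val x.1)) (mem x.2).
  apply: (@sub_finite_set _ _ (range F)); last first.
    by apply: finite_image; exact: finite_finset.
  move=> _ [t [a [tt ->]]]; exists (SeqSub tt, [set k | a k]%SET) => //.
  by rewrite /F /=; apply: eq_cof => // k; rewrite /= inE.
- move=> _ [t [a [tt ->]]]; split; first exact: cof_rational.
  exact: (cof_pointed (tri_dual tt)).
- exact: e8fan_face.
- by move=> C D hC hD; split; [|rewrite setIC]; exact: e8fan_inter.
Qed.

Lemma gen_visible t k : t \in tris -> visible (gen t k).
Proof. by move=> /tri_dual [_ h]; exists (dgen t k); rewrite h eqxx. Qed.

Lemma e8fan_regular : regular_fan e8fan.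
Proof.
split; first exact: e8fan_fan.
move=> _ [t [a [tt ->]]]; have [_ hD] := tri_dual tt.
exists (\matrix_k gen t k).
  suff : (\matrix_k gen t k) *m (\matrix_k dgen t k)^T = 1%:M.
    by move=> /mulmx1_unit [].
  apply/matrixP => i j; rewrite !mxE eq_sym -hD; apply: eq_bigr => k _.
  by rewrite !mxE mulrC.
exists [set k | a k]%SET; rewrite (prim_gens_cof _ _ (tri_dual tt)); last first.
  by move=> k; exact: gen_visible.
apply/seteqP; split => [_ [k ak <-]|_ [k ak <-]].
  by exists k; rewrite ?rowK //= inE.
by rewrite rowK; exists k => //; rewrite /= inE in ak.
Qed.

Lemma lat_expand t (w : V) : t \in tris ->
  w = \sum_k dot (lat R (dgen t k)) w *: lat R (gen t k).
Proof.
move=> tt; rewrite [LHS](dual_expand (intr : {rmorphism int -> R}) w (tri_dual tt)).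
by apply: eq_bigr => k _; congr (_ *: _); apply: eq_bigr => i _; rewrite /lat [in RHS]mxE.
Qed.

Lemma tri_in (t : simplex) (w : V) : t \in tris ->
  (forall k, 0 <= dot (lat R (dgen t k)) w) -> cof (gen t) predT w.
Proof.
move=> tt h; exists (fun k => dot (lat R (dgen t k)) w); split; last exact: lat_expand.
by move=> k; split.
Qed.

(** The cone containing a vector is the one whose linear function is the
  largest there: a negative coordinate would allow to cross a wall towards
  larger values. *)
Lemma e8fan_cover (w : V) : orthant R w -> exists2 t, t \in tris & cof (gen t) predT w.
Proof.
move=> ow.
have [|t [tt _ hmax]] := @exists_max _ _ R tris predT (fun t => dot (lat R (lin t)) w).
  by exists (head ((0, 0, 0), (0, 0, 0), (0, 0, 0)) tris).
exists t => //; apply: tri_in => // k.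
have [h|[t' [c [tt' c0 e]]]] := tri_wall k tt.
  by apply: sumr_ge0 => i _; rewrite mulr_ge0 // mxE ler0z.
have : dot (lat R (lin t' - lin t)) w <= 0.
  by rewrite latD latN dotDl dotC [X in _ + X]dotC dotNr !(dotC w) subr_le0 hmax.
by rewrite e lat_MZ dotC dotZr dotC mulrNz mulNr oppr_le0 pmulr_rge0 ?ltr0z.
Qed.

Lemma cof_orthant t a w : t \in tris -> @cof R (gen t) a w -> orthant R w.
Proof.
move=> tt [c [hc ->]] i; rewrite summxE sumr_ge0 // => k _; rewrite mxE mulr_ge0 //.
  exact: (proj1 (hc k)).
rewrite /lat mxE.
by rewrite ler0z tri_orth.
Qed.

Lemma e8fan_support : fan_support e8fan = orthant R.
Proof.
apply/seteqP; split => [w [_ [t [a [tt ->]]]] |w /e8fan_cover [t tt h]].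
  exact: cof_orthant.
by exists (cof (gen t) predT) => //; exact: e8fan_cof.
Qed.

End Fan.

(** * The Groebner fan *)

Definition monoz (a : nat) : zvec := sel ((5%:Z, 0, 0), (0, 3%:Z, 0), (0, 0, 2%:Z)) a.
Definition mono (a : 'I_3) : N := vz (monoz a).

Definition apexz : zvec := (6%:Z, 10%:Z, 15%:Z).
Definition apex_coord (a : nat) : int := sel apexz a.

(** On each chamber this functional takes the value 1 at the three generators:
  the profile lies between the origin and the plane where it equals 1. *)
Definition levelz (a : nat) : zvec :=
  sel ((-4%:Z, 1, 1), (1, -2%:Z, 1), (1, 1, -1)) a.

Definition minz (u : zvec) a := all (fun b => wt u a <= wt u b) (iota 0 3).
Definition on_level (u : zvec) a :=
  [&& dotz (levelz a) u == 1, 0 <= u.1.1, 0 <= u.1.2, 0 <= u.2 & minz u a].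
Definition posz (u : zvec) := [&& 0 < u.1.1, 0 < u.1.2 & 0 < u.2].
Definition tiez (u : zvec) :=
  has (fun a => has (fun b => [&& a != b, minz u a & minz u b]) (iota 0 3)) (iota 0 3).

(** The lattice points of the profiles inside the walls: a chain of four points
  from the x-axis to the apex, the apex, a chain of two points from the y-axis
  and one point on the way from the z-axis. *)
Definition exc_pts : seq zvec :=
  [:: (2%:Z, 2%:Z, 3%:Z); (3%:Z, 4%:Z, 6%:Z); (4%:Z, 6%:Z, 9%:Z); (5%:Z, 8%:Z, 12%:Z);
      (6%:Z, 10%:Z, 15%:Z); (2%:Z, 4%:Z, 5%:Z); (4%:Z, 7%:Z, 10%:Z); (3%:Z, 5%:Z, 8%:Z)].

Definition vertices : seq zvec := flatten [seq [:: t.1.1; t.1.2; t.2] | t <- tris].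

(** The lattice points of the profiles are found by searching this box, which
  contains the profiles because the apex is their largest vertex. *)
Definition box : seq zvec := [seq (x.1%:Z, x.2%:Z, z%:Z) |
  x <- [seq (x, y) | x <- iota 0 7, y <- iota 0 11], z <- iota 0 16].

Lemma box_check : all (fun u : zvec => has (on_level u) (iota 0 3) ==> (u \in vertices)) box.
Proof. by vm_compute. Qed.

Lemma vertices_check : all (fun u : zvec => has (on_level u) (iota 0 3) &&
  (posz u && tiez u ==> (u \in exc_pts))) vertices.
Proof. by vm_compute. Qed.

Lemma exc_check : all (fun u : zvec => [&& u \in vertices, posz u & tiez u]) exc_pts.
Proof. by vm_compute. Qed.

Lemma mem_vertices t (k : 'I_3) : t \in tris -> (sel t k : zvec) \in vertices.
Proof.
move=> tt; apply/flattenP; exists [:: t.1.1; t.1.2; t.2].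
  by apply/mapP; exists t.
by case: k => [[|[|[|//]]]] ?; rewrite /= !inE eqxx ?orbT.
Qed.

Lemma verticesP (u : zvec) : u \in vertices ->
  exists t, exists2 k : 'I_3, t \in tris & u = sel t k.
Proof.
move=> /flattenP [_ /mapP [t tt ->]]; rewrite !inE => /or3P[]/eqP ->; exists t.
- by exists 0.
- by exists 1.
- by exists 2%:R.
Qed.

Lemma mem_box (u : zvec) : [&& 0 <= u.1.1, 0 <= u.1.2 & 0 <= u.2] ->
  [&& u.1.1 <= 6%:Z, u.1.2 <= 10%:Z & u.2 <= 15%:Z] -> u \in box.
Proof.
case: u => [[x y] z] /= /and3P[]; case: x => // x _; case: y => // y _; case: z => // z _.
move=> /and3P[hx hy hz].
apply/allpairsP; exists ((x, y), z); split => //; last by rewrite mem_iota add0n ltnS /=; move: hx hy hz; rewrite !lez_nat; lia.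
by apply/allpairsP; exists (x, y); split => //; rewrite mem_iota add0n ltnS /=; move: hx hy hz; rewrite !lez_nat; lia.
Qed.

Lemma pr_mono a u : pr (mono a) (vz u) = wt u a.
Proof.
rewrite pr_dotz; case: a => [[|[|[|//]]]] ? /=; rewrite /dotz /wt /=; ring.
Qed.

Lemma forall3 (P : pred nat) : reflect (forall k : 'I_3, P k) (all P (iota 0 3)).
Proof.
apply: (iffP allP) => h k; first exact: h (ord3E k).
by rewrite mem_iota /= => k3; exact: (h (Ordinal k3)).
Qed.

Lemma exists3 (P : pred nat) : reflect (exists k : 'I_3, P k) (has P (iota 0 3)).
Proof.
apply: (iffP hasP) => [[k]|[k hk]]; last by exists (k : nat) => //; exact: ord3E.
by rewrite mem_iota /= => k3 hk; exists (Ordinal k3).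
Qed.

Section Groebner.
Variable R : realType.
Local Notation V := 'rV[R]_3.
Implicit Types (w v : V) (T : pred 'I_3).

Definition wv (a : 'I_3) w : R := dot (lat R (mono a)) w.

Lemma wvD a w v : wv a (w + v) = wv a w + wv a v.
Proof. exact: dotDr. Qed.

Lemma wvZ a c w : wv a (c *: w) = c * wv a w.
Proof. exact: dotZr. Qed.

Lemma wvE a w : wv a w = [:: 5%:R; 3%:R; 2%:R]`_a * w 0 a.
Proof.
rewrite /wv /dot (bigD1 a) //= big1 ?addr0 => [|i ia].
  by rewrite /lat /mono !mxE; case: a => [[|[|[|//]]]].
rewrite /lat /mono !mxE; case: a ia => [[|[|[|//]]]] ?; case: i => [[|[|[|//]]]] ? //= _;
  by rewrite mul0r.
Qed.

(** The initial form depends on a vector only through the set of the monomials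
  of minimal weight. *)
Definition minset w : pred 'I_3 := fun a => [forall b, wv a w <= wv b w].

Definition gcone T : set V :=
  [set w | orthant R w /\ forall a b, T a -> wv a w <= wv b w].

Lemma minset_nonempty w : exists a, minset w a.
Proof.
have [|a [_ _ h]] := @exists_max _ _ R (enum 'I_3) predT (fun a => - wv a w).
  by exists 0 => //; rewrite mem_enum.
by exists a; apply/forallP => b; rewrite -lerN2 h // mem_enum.
Qed.

Definition mon (a : 'I_3) : 'X_{1..3} :=
  (U_(a) *+ nth 0%N [:: 5; 3; 2] a)%MM.

Lemma mon_inj : injective mon.
Proof.
move=> a b /mnmP /(_ a); rewrite !mulmnE !mnm1E eqxx.
case: eqP => [-> //|ne]; rewrite mul1n mul0n.
by case: a ne => [[|[|[|//]]]].
Qed.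

Lemma E8_msupp m : (m \in msupp (E8_poly R)) = [exists a, m == mon a].
Proof.
rewrite mcoeff_msupp /E8_poly !mpolyXn !mcoeffD !mcoeffX.
have -> : (U_(2%R) *+ 2)%MM = mon 2%R by [].
have -> : (U_(1%R) *+ 3)%MM = mon 1 by [].
have -> : (U_(0%R) *+ 5)%MM = mon 0 by [].
rewrite -!natrD pnatr_eq0 !addn_eq0 !eqb0 !negb_and !negbK.
apply/idP/existsP => [/orP[/orP[]|] h|[a /eqP ->]].
- by exists 2%:R; rewrite eq_sym.
- by exists 1; rewrite eq_sym.
- by exists 0; rewrite eq_sym.
rewrite !(inj_eq mon_inj); case: a => [[|[|[|//]]]] ? //=; by rewrite ?orbT.
Qed.

Lemma mon_weight w a : exp_weight w (mon a) = wv a w.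
Proof.
rewrite wvE /exp_weight (bigD1 a) //= big1 ?addr0 => [|i /negPf ia].
  rewrite mulmnE mnm1E eqxx mul1n mulrC; congr (_ * _).
  by case: a => [[|[|[|//]]]].
by rewrite mulmnE mnm1E eq_sym ia mul0n mulr0.
Qed.

Lemma E8_initial w v :
  initial_form w (E8_poly R) = initial_form v (E8_poly R) <-> minset w =1 minset v.
Proof.
have H u m : (initial_form u (E8_poly R))@_m = (E8_poly R)@_m *
    [exists a, (m == mon a) && minset u a]%:R.
  rewrite /initial_form (raddf_sum (mcoeff m)) /=.
  rewrite (eq_bigr (fun i => (E8_poly R)@_m * (if i == m then 1 else 0))); last first.
    by move=> i _; rewrite mcoeffZ mcoeffX; case: eqP => [->|]; rewrite ?mulr0.
  have all_min a : all (fun b => exp_weight u (mon a) <= exp_weight u b)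
      (msupp (E8_poly R)) = minset u a.
    apply/allP/forallP => [h b|h b].
      by rewrite -!mon_weight h // E8_msupp; apply/existsP; exists b.
    by rewrite E8_msupp => /existsP [c /eqP ->]; rewrite !mon_weight.
  rewrite -mulr_sumr; congr (_ * _); rewrite -big_mkcondr /=.
  case: existsP => [[a /andP[/eqP -> ha]]|no].
    rewrite big_mkcond (bigD1_seq (mon a)) ?msupp_uniq //=; last first.
      by rewrite E8_msupp; apply/existsP; exists a.
    rewrite all_min ha eqxx big1 ?addr0 // => i /negPf ->.
    by rewrite andbF.
  rewrite big_seq_cond big_pred0 // => m'; apply/negP.
  move=> /and3P[ms hm /eqP e]; apply: no; subst m'.
  move: ms; rewrite E8_msupp => /existsP [a /eqP e]; exists a.
  by rewrite e eqxx /= -all_min -e.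
split => [e a|e]; last first.
  apply/mpolyP => m; rewrite !H; congr (_ * (nat_of_bool _)%:R).
  by apply: eq_existsb => a; rewrite e.
have nz : (E8_poly R)@_(mon a) != 0.
  by rewrite -mcoeff_msupp E8_msupp; apply/existsP; exists a.
have Hm u : [exists b, (mon a == mon b) && minset u b] = minset u a.
  apply/existsP/idP => [[b /andP[/eqP/mon_inj -> //]]|h].
  by exists a; rewrite eqxx.
have : (initial_form w (E8_poly R))@_(mon a) = (initial_form v (E8_poly R))@_(mon a).
  by rewrite e.
rewrite !H !Hm => /(mulfI nz); by do 2!case: (minset _ a) => //; move/eqP;
  rewrite ?oner_eq0 // eq_sym oner_eq0.
Qed.

Lemma closure_rV (S : set V) w : closure S w <->
  forall e, 0 < e -> exists2 w', S w' & forall i, `|w 0 i - w' 0 i| < e.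
Proof.
split => [h e e0|h B].
  have [w' [Sw' bw]] := h (ball w e) (nbhsx_ballx w e e0).
  by exists w' => // i; exact: (proj2 bw).
rewrite -nbhs_ballE => -[e /= e0 hB]; have [w' Sw' hw] := h e e0.
by exists w'; split => //; apply: hB; split => // i j; rewrite ord1; exact: hw.
Qed.

Lemma wv_close a w w' e : (forall i, `|w 0 i - w' 0 i| < e) ->
  `|wv a w - wv a w'| <= 5%:R * e.
Proof.
move=> h; rewrite !wvE -mulrBr normrM ler_pM //; last exact: ltW.
by case: a => [[|[|[|//]]]] ? /=; rewrite ger0_norm ?ler_nat.
Qed.

(** The closure of a Groebner stratum: moving from a point of the cone a little
  in the direction of the given vector breaks exactly the right ties. *)
Lemma groebner_closure v : orthant R v ->
  closure [set w | orthant R w /\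
    initial_form w (E8_poly R) = initial_form v (E8_poly R)] = gcone (minset v).
Proof.
move=> ov; apply/seteqP; split => w; rewrite closure_rV.
  move=> h; split => [i|a b ma].
    rewrite leNgt; apply/negP => wi; have [|w' [/(_ i) ow' _] /(_ i) hi] := h (- w 0 i).
      by rewrite oppr_gt0.
    move: hi; rewrite ler0_norm; first by rewrite opprB; lra.
    lra.
  rewrite leNgt; apply/negP => lt.
  have [|w' [_ /E8_initial e] hw] := h ((wv a w - wv b w) / 20%:R).
    by rewrite divr_gt0 ?subr_gt0.
  have := wv_close a hw; have := wv_close b hw; rewrite !ler_norml => /andP[h1 h2] /andP[h3 h4].
  have : minset w' a by rewrite e.
  by move=> /forallP /(_ b); lra.
move=> [ow hw] e e0; pose K := 1 + \sum_i `|v 0 i|.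
have K0 : 0 < K by rewrite ltr_pwDl // sumr_ge0.
have d0 : 0 < e / K by rewrite divr_gt0.
exists (w + (e / K) *: v); last first.
  move=> i; rewrite !mxE opprD addNKr normrN normrM gtr0_norm //.
  rewrite mulrAC ltr_pdivrMr // ltr_pM2l // /K (bigD1 i) //= .
  by rewrite addrCA ltrDl ltr_pwDl // sumr_ge0.
split => [i|]; first by rewrite !mxE addr_ge0 // mulr_ge0 // ltW.
apply/E8_initial => a; have [a0 h0] := minset_nonempty v.
apply/idP/idP => [|ha]; last first.
  apply/forallP => b; rewrite !wvD !wvZ lerD ?hw // ler_pM2l //.
  exact: (forallP ha).
apply: contraLR => na; apply/negP => /forallP/(_ a0).
rewrite leNgt => /negP; apply; rewrite !wvD !wvZ ler_ltD //; first exact: hw.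
rewrite ltr_pM2l // ltNge; apply: contra na => le.
by apply/forallP => b; apply: le_trans le _; exact: (forallP h0).
Qed.

Lemma groebner_conesP C : groebner_cones (E8_poly R) C <->
  exists2 v, orthant R v & C = gcone (minset v).
Proof.
split=> [[v ov <-]|[v ov ->]]; exists v => //; first exact: groebner_closure.
exact: groebner_closure.
Qed.

Lemma cof_supp (B : 'I_3 -> N) (c : 'I_3 -> R) :
  (forall k, 0 <= c k) -> cof B (fun k => c k != 0) (\sum_k c k *: lat R (B k)).
Proof.
move=> hc; exists c; split => // k; split => //.
by rewrite negbK => /eqP.
Qed.

Lemma wv_gen a t k : wv a (lat R (gen t k)) = (wt (sel t k) a)%:~R.
Proof. by rewrite /wv dot_lat pr_mono. Qed.

Lemma gcone_cof T (B : 'I_3 -> N) (a : pred 'I_3) w : (forall k, a k -> gcone T (lat R (B k))) ->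
  cof B a w -> gcone T w.
Proof.
move=> h [c [hc ->]]; split => [i|x b Tx].
  rewrite summxE sumr_ge0 // => k _; rewrite mxE.
  case: (boolP (a k)) => [ak|/(proj2 (hc k)) ->]; last by rewrite mul0r.
  by rewrite mulr_ge0 //; [case: (hc k)|case: (h _ ak)].
rewrite /wv !dot_comb ler_sum // => k _.
case: (boolP (a k)) => [ak|/(proj2 (hc k)) ->]; last by rewrite !mul0r.
by rewrite ler_wpM2l //; [case: (hc k)|case: (h _ ak) => _; exact].
Qed.

(** Every Groebner cone is a union of cones of the fan: the monomial that is
  minimal on a whole simplex has at a point of the cone the same weight as
  the monomials of the initial form, so the weights agree at the vertices. *)
Lemma gcone_union T w : (exists a, T a) -> gcone T w ->
  exists2 C, e8fan C & C w /\ C `<=` gcone T.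
Proof.
move=> [a1 Ta1] [ow hw]; have [t tt [c [hc ew]]] := e8fan_cover ow.
exists (cof (gen t) (fun k => c k != 0)); first exact: e8fan_cof.
split; first by rewrite ew; apply: cof_supp => k; case: (hc k).
move=> w' hw'; apply: (gcone_cof _ hw') => k ck.
split => [i|a b Ta]; first by rewrite /lat mxE ler0z tri_orth.
have /and5P[_ _ _ _ /exists3 [a0 /forall3 h0]] := tri_ok tt.
have hd j : 0 <= dot (lat R (mono a - mono a0)) (lat R (gen t j)).
  by rewrite dot_lat prB !pr_mono ler0z subr_ge0; exact: (forall3 _ (h0 j)).
have d0 : dot (lat R (mono a - mono a0)) (\sum_k c k *: lat R (gen t k)) = 0.
  apply/eqP; rewrite eq_le; apply/andP; split.
    by rewrite -ew latD latN dotDl dotC [X in _ + X]dotC dotNr !(dotC w) subr_le0; exact: hw.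
  by apply: (@dot_ge0_cof _ _ predT) => //; exists c.
have e := dot_eq0_cof (a := predT) (fun j _ => hd j) hc d0 (k := k).
have {}e : wt (sel t k) a = wt (sel t k) a0.
  apply/eqP; rewrite -subr_eq0 -!pr_mono -prB; apply: contraNT ck => ne.
  by rewrite e // dot_lat intr_eq0.
by rewrite !wv_gen e ler_int; exact: (forall3 _ (h0 k)).
Qed.

Lemma e8fan_refines : refines (@e8fan R) (groebner_fan (E8_poly R)).
Proof.
move=> F [C /groebner_conesP [v ov ->] [m hm ->]].
set G := gcone _; exists [set D | e8fan D /\ D `<=` G `&` [set w | dot m w = 0]].
  by move=> D [].
apply/seteqP; split => [w [Gw mw]|w [D [_ DF] /DF //]].
have [D SD [Dw DG]] := gcone_union (minset_nonempty v) Gw.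
exists (D `&` [set w | dot m w = 0]) => //; split.
  apply: e8fan_face SD _; exists m => // x /DG; exact: hm.
by move=> x [/DG].
Qed.

(** The generators of the chamber in which the monomial [a] is initial. *)
Definition cgen (a k : 'I_3) : N := if k == a then vz apexz else delta_mx 0 k.
Definition cdual (a k : 'I_3) : N :=
  if k == a then delta_mx 0 a
  else apex_coord a *: delta_mx 0 k - apex_coord k *: delta_mx 0 a.

Lemma apexE (i : 'I_3) : vz apexz 0 i = apex_coord i.
Proof. by rewrite mxE; case: i => [[|[|[|//]]]]. Qed.

Lemma apex_gt0 (i : 'I_3) : 0 < apex_coord i.
Proof. by case: i => [[|[|[|//]]]]. Qed.

Lemma chamber_dual a : dualb (cgen a) (cdual a) (apex_coord a).
Proof.
split => [|i j]; first exact: apex_gt0.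
rewrite /cdual /cgen; case: (eqVneq i a) => [->|ia]; rewrite ?prB ?prZ !pr_delta.
  case: (eqVneq j a) => [_|ja]; first by rewrite apexE.
  by rewrite mxE eqxx /= eq_sym (negPf ja) mulr0n.
case: (eqVneq j a) => [->|ja]; first by rewrite !apexE (negPf ia) mulr0n mulrC subrr.
rewrite !mxE !eqxx /= (eq_sym a j) (negPf ja) mulr0 subr0.
by case: eqP; rewrite ?mulr1n ?mulr0n ?mulr1 ?mulr0.
Qed.

Lemma chamber_visible a k : visible (cgen a k).
Proof.
rewrite /cgen; case: eqP => _; last by exists (delta_mx 0 k); rewrite pr_delta mxE !eqxx.
by exists (vz (1, 1, -1)); rewrite pr_dotz.
Qed.

Lemma wv_apex a : wv a (lat R (vz apexz)) = 30%:R.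
Proof. by rewrite /wv dot_lat pr_mono; case: a => [[|[|[|//]]]]. Qed.

Lemma wv_delta a k : a != k -> wv a (lat R (delta_mx 0 k)) = 0.
Proof. by move=> ak; rewrite wvE /lat !mxE (negPf ak) mulr0. Qed.

Lemma orthant_gen a k : orthant R (lat R (cgen a k)).
Proof.
move=> i; rewrite /lat mxE ler0z /cgen; case: eqP => _.
  by rewrite apexE ltW ?apex_gt0.
by rewrite mxE eqxx /=; case: eqP.
Qed.

Lemma wv_ge0 a w : orthant R w -> 0 <= wv a w.
Proof.
move=> ow; rewrite wvE mulr_ge0 //.
by case: a => [[|[|[|//]]]] ? /=; rewrite ler0n.
Qed.

Lemma chamberE a : gcone (pred1 a) = cof (cgen a) predT.
Proof.
apply/seteqP; split => w; last first.
  move=> h; apply: (gcone_cof _ h) => k _; split; first exact: orthant_gen.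
  move=> _ b /eqP ->; rewrite /cgen; case: eqP => [_|/eqP ka].
    by rewrite !wv_apex.
  rewrite wv_delta 1?eq_sym // wv_ge0 //.
  by have := orthant_gen a k; rewrite /cgen (negPf ka).
move=> [ow hw]; pose va : R := (apex_coord a)%:~R.
have va0 : 0 < va by rewrite ltr0z apex_gt0.
exists (fun k => if k == a then w 0 a / va else w 0 k - (apex_coord k)%:~R * (w 0 a / va)).
have e30 (k : 'I_3) : ([:: 5%:R; 3%:R; 2%:R]`_k : R) * (apex_coord k)%:~R = 30%:R.
  case: k => [[|[|[|//]]]] ? /=; by rewrite /apex_coord /= -pmulrn -natrM.
have c0 (k : 'I_3) : 0 < ([:: 5%:R; 3%:R; 2%:R]`_k : R).
  by case: k => [[|[|[|//]]]] ? /=; rewrite ltr0n.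
split.
  move=> k; split => //; case: eqP => [_|_]; first by rewrite divr_ge0 // ltW.
  rewrite subr_ge0 -(ler_pM2l (c0 k)) mulrA e30 -(e30 a) -mulrA (mulrC va) mulfVK ?gt_eqF //.
  by rewrite -!wvE hw /=.
apply/rowP => i; rewrite summxE (bigD1 a) //= eqxx /cgen eqxx.
have [->|ia] := eqVneq i a.
  rewrite big1 ?addr0; first by rewrite mxE /lat mxE apexE mulfVK ?gt_eqF.
  move=> k /negPf ka; rewrite ka /lat !mxE eqxx /= eq_sym ka mulr0 //.
rewrite (bigD1 i) //= (negPf ia) big1 ?addr0.
  by rewrite mxE [X in _ + X]mxE /lat mxE [X in _ * X%:~R + _]apexE !mxE !eqxx /=; ring.
move=> k /andP[/negPf ka /negPf ki]; rewrite ka /lat !mxE eqxx /= eq_sym ki mulr0 //.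
Qed.

End Groebner.

(** * Profiles and lattice points *)

Section GroebnerPoints.
Variable R : realType.
Local Notation V := 'rV[R]_3.
Implicit Types (w v : V) (T : pred 'I_3) (a b k : 'I_3).

Lemma dot_latB (m m' : N) w : dot (lat R (m - m')) w = dot (lat R m) w - dot (lat R m') w.
Proof. by rewrite latD latN dotDl (dotC (- _)) dotNr !(dotC w). Qed.

Lemma card3 : #|(predT : pred 'I_3)| = 3%N.
Proof. by rewrite cardT size_enum_ord. Qed.

Lemma eq_gcone T T' : T =1 T' -> gcone (R := R) T = gcone T'.
Proof. by move=> /funext ->. Qed.

(** The Groebner cone of a set of monomials is attained at the sum of the
  axes of the other variables. *)
Lemma gcone_groebner T : (exists a, T a) -> groebner_cones (E8_poly R) (gcone T).
Proof.
move=> [a0 Ta0]; pose v : V := \row_i (~~ T i)%:R.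
have ov : orthant R v by move=> i; rewrite mxE ler0n.
have pos (k : 'I_3) : 0 < ([:: 5%:R; 3%:R; 2%:R]`_k : R).
  by case: k => [[|[|[|//]]]] ? /=; rewrite ltr0n.
apply/groebner_conesP; exists v => //; apply: eq_gcone => a.
apply/idP/forallP => [Ta b|/(_ a0)].
  by rewrite wvE mxE Ta mulr0; exact: wv_ge0.
rewrite !wvE !mxE Ta0 mulr0 pmulr_rle0 //; case: (T a) => //.
by rewrite ler10.
Qed.

Lemma gcone_tie a b w T : T a -> T b -> gcone T w -> wv a w = wv b w.
Proof. by move=> Ta Tb [_ h]; apply/eqP; rewrite eq_le !h. Qed.

(** A tie between two monomials confines a cone to a plane. *)
Lemma tie_cone_dim T a b : T a -> T b -> a != b -> ~ cone_dim (gcone (R := R) T) 3.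
Proof.
move=> Ta Tb ab [A [fA hA _]].
have uA : A \in unitmx by rewrite -row_free_unit.
pose m : 'cV[R]_3 := (lat R (mono a - mono b))^T.
have Am : A *m m = 0.
  apply/matrixP => i j; have e : dot (lat R (mono a - mono b)) (row i A) = 0.
    by rewrite dot_latB; apply/eqP; rewrite subr_eq0; apply/eqP/(gcone_tie Ta Tb).
  rewrite mxE [RHS]mxE; transitivity (dot (row i A) (lat R (mono a - mono b))).
    by apply: eq_bigr => k _; rewrite [in RHS]mxE /m mxE ord1.
  by rewrite dotC.
have m0 : m = 0 by rewrite -[m](mulKmx uA) Am mulmx0.
have : lat R (mono a - mono b) = lat R 0 by rewrite lat0 -[LHS]trmxK -/m m0 trmx0.
move/lat_inj => e; have := pr_mono a (sel ((1, 0, 0), (0, 1, 0), (0, 0, 1)) a).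
have := pr_mono b (sel ((1, 0, 0), (0, 1, 0), (0, 0, 1)) a).
move: e => /eqP; rewrite subr_eq0 => /eqP -> ->.
by case: a b ab {Ta Tb m Am m0} => [[|[|[|//]]]] ? [[|[|[|//]]]].
Qed.

Lemma max_groebnerP C : max_groebner_cones (E8_poly R) C <->
  exists a, C = cof (cgen a) predT.
Proof.
split=> [[/groebner_conesP [v ov ->] d3]|[a ->]]; last first.
  split; first by rewrite -chamberE; apply: gcone_groebner; exists a; rewrite /=.
  by have := cof_cone_dim R predT (chamber_dual a); rewrite card3.
have [a ma] := minset_nonempty v; exists a; rewrite -chamberE.
apply: eq_gcone => b; apply/idP/eqP => [mb|-> //].
by apply/eqP/negPn/negP => ba; exact: (tie_cone_dim mb ma ba).
Qed.

Lemma pr_level_cgen a k : pr (vz (levelz a)) (cgen a k) = 1.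
Proof.
rewrite /cgen; case: eqP => [_|/eqP].
  by rewrite pr_dotz; case: a => [[|[|[|//]]]].
rewrite prC pr_delta mxE.
by case: a => [[|[|[|//]]]] ?; case: k => [[|[|[|//]]]].
Qed.

Lemma chamber_level a (c : 'I_3 -> R) :
  dot (lat R (vz (levelz a))) (\sum_k c k *: lat R (cgen a k)) = \sum_k c k.
Proof.
by rewrite dot_comb; apply: eq_bigr => k _; rewrite dot_lat pr_level_cgen mulr1.
Qed.

Lemma level_ge1 a u : cof (cgen a) predT (lat R u) -> u <> 0 ->
  1 <= pr (vz (levelz a)) u.
Proof.
move=> [c [hc e]] u0; rewrite -gtz0_ge1 -(ltr0z R) -dot_lat e chamber_level.
rewrite lt_neqAle sumr_ge0 ?andbT; last by move=> k _; case: (hc k).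
apply/eqP => s0; apply: u0; apply: (@lat_inj R); rewrite lat0 e big1 // => k _.
have /eqP := esym s0; rewrite psumr_eq0; last by move=> j _; case: (hc j).
by move=> /allP /(_ k (mem_index_enum _)) /eqP ->; rewrite scale0r.
Qed.

(** The generators of a chamber have level 1 and the nonzero lattice points
  have level at least 1, so the nonzero lattice points of the profile, which
  have level at most 1, are those of level 1. *)
Lemma profileP a u : profile_points (cof (cgen a) predT : set V) u <->
  cof (cgen a) predT (lat R u) /\ pr (vz (levelz a)) u = 1.
Proof.
rewrite /profile_points /profile.
rewrite (prim_gens_cof _ _ (chamber_dual a) (chamber_visible a)) /=.
split=> [[[n [l [x [hx sl e]]]] u0]|[[c [hc e]] lev]]; last first.
  split; last by move=> u0; move: lev; rewrite u0 prC pr0.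
  exists 3%N, c, (fun k => lat R (cgen a k)); split => //.
    move=> k; split; first by case: (hc k).
    by right; exists (cgen a k) => //; exists k.
  by rewrite -(chamber_level a) -e dot_lat lev.
have Cu : cof (cgen a) predT (lat R u).
  have H i : exists o : option 'I_3, x i = if o is Some k then lat R (cgen a k) else 0.
    case: (hx i) => _ [->|[_ [k _ <-] <-]]; first by exists None.
    by exists (Some k).
  have [f hf] := choice H.
  exists (fun k => \sum_(i | f i == Some k) l i); split.
    by move=> k; split => //; apply: sumr_ge0 => i _; case: (hx i).
  rewrite e (bigID (fun i => f i == None)) /= big1 ?add0r; last first.
    by move=> i /eqP fi; rewrite hf fi scaler0.
  under [RHS]eq_bigr do rewrite scaler_suml.
  rewrite (exchange_big_dep (fun i => f i != None)) /=; last first.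
    by move=> k i _ /eqP ->.
  apply: eq_bigr => i; case fi: (f i) => [k|//] _.
  rewrite (big_pred1 k); first by rewrite hf fi.
  by move=> j; rewrite /= (inj_eq Some_inj) eq_sym.
split => //; apply/eqP; rewrite eq_le level_ge1 // andbT.
rewrite -(lerz1 R) -dot_lat e dot_sumr -sl ler_sum // => i _; rewrite dotZr.
case: (hx i) => li [->|[_ [k _ <-] <-]]; first by rewrite dot0r mulr0.
by rewrite dot_lat pr_level_cgen mulr1.
Qed.

(** The level is additive, and a sum of two nonzero lattice vectors of the
  chamber has level at least 2. *)
Lemma profile_irreducible a u : profile_points (cof (cgen a) predT : set V) u ->
  irreducible_in (cof (cgen a) predT : set V) u.
Proof.
move=> hu; have [Cu lev] := proj1 (profileP _ _) hu; split => //; first by case: hu.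
move=> [b [c [b0 c0 Cb Cc e]]].
have := level_ge1 Cb b0; have := level_ge1 Cc c0.
by move: lev; rewrite e prC prD !(prC _ (vz _)); lia.
Qed.

Lemma minz_wv (u : zvec) (a : 'I_3) :
  minz u a <-> forall b, wv a (lat R (vz u)) <= wv b (lat R (vz u)).
Proof.
by split=> [/forall3 h b|h]; [|apply/forall3 => b];
  have := h b; rewrite /wv !dot_lat !pr_mono ler_int.
Qed.

Lemma on_levelP (u : zvec) a : on_level u (a : 'I_3) <->
  profile_points (cof (cgen a) predT : set V) (vz u).
Proof.
rewrite profileP -chamberE pr_dotz.
split=> [/and5P[/eqP l h0 h1 h2 /minz_wv hm]|[[ou hw] l]].
  split => //; split; last by move=> _ b /eqP ->.
  move=> i; rewrite /lat mxE ler0z mxE; by case: i => [[|[|[|//]]]].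
have o i : 0 <= vz u 0 i by have := ou i; rewrite /lat mxE ler0z.
have := o 0; have := o 1; have := o 2%:R; rewrite !mxE /= => h2 h1 h0.
rewrite /on_level l eqxx h0 h1 h2 /=; apply/minz_wv => b; apply: hw; exact: eqxx.
Qed.

Lemma on_level_box (u : zvec) a : on_level u (a : 'I_3) -> u \in box.
Proof.
move=> h; have /and5P[_ h0 h1 h2 _] := h; apply: mem_box; first by rewrite h0 h1.
have /on_levelP/profileP [[c [hc e]] lev] := h.
have sc : \sum_k c k = 1 by rewrite -(chamber_level a) -e dot_lat lev.
have key (i : 'I_3) : vz u 0 i <= apex_coord i.
  rewrite -(ler_int R); have -> : (vz u 0 i)%:~R = lat R (vz u) 0 i by rewrite [RHS]mxE.
  rewrite e summxE -[leRHS]mul1r -[X in _ <= X * _]sc mulr_suml ler_sum // => k _; rewrite mxE.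
  rewrite ler_wpM2l //; first by case: (hc k).
  rewrite /lat mxE ler_int /cgen; case: eqP => _; first by rewrite apexE.
  rewrite mxE; case: (i == k); last by rewrite andbF ltW ?apex_gt0.
  by case: i => [[|[|[|//]]]].
by have := key 0; have := key 1; have := key 2%:R; rewrite !mxE /= => -> -> ->.
Qed.

Lemma groebner_pointsP u : groebner_points (E8_poly R) u <->
  exists t k, t \in tris /\ u = gen t k.
Proof.
split=> [[C /max_groebnerP [a ->] hu]|[t [k [tt ->]]]].
  move: hu; rewrite (vzP u); set z := (_, _, _) => hz; have hl := proj2 (on_levelP z a) hz.
  have /allP /(_ _ (on_level_box hl)) /implyP := box_check.
  move=> /(_ _)/verticesP [|t [k tt ->]]; last by exists t, k.
  by apply/hasP; exists (a : nat) => //; exact: ord3E.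
have /allP /(_ _ (mem_vertices k tt)) /andP[/exists3 [a /on_levelP h] _] := vertices_check.
by exists (cof (cgen a) predT) => //; apply/max_groebnerP; exists a.
Qed.

Lemma e8fan_rays : rays (@e8fan R) = [set ray R u | u in groebner_points (E8_poly R)].
Proof.
apply/seteqP; split => [_ [[t [a [tt ->]]] d1]|_ [u /groebner_pointsP [t [k [tt ->]]] <-]].
  have c1 := cone_dim_uniq d1 (cof_cone_dim R a (tri_dual tt)).
  have /card1P [k hk] : #|a| == 1%N by rewrite -c1.
  exists (gen t k); first by apply/groebner_pointsP; exists t, k.
  by rewrite rayE; apply: eq_cof => // j; have := hk j; rewrite !inE.
rewrite rayE; split; first exact: e8fan_cof.
by have := cof_cone_dim R (pred1 k) (tri_dual tt); rewrite card1.
Qed.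

(** A cone of dimension at most 2 lies in a proper face of a chamber; a positive
  vector in such a face lies on a wall, where two monomials tie.  Conversely
  the set where two monomials tie with the minimum is a face of a chamber. *)
Lemma exc_pointsP u : interior_skeleton_points (E8_poly R) u <->
  exists2 z, z \in exc_pts & u = vz z.
Proof.
split=> [[/groebner_pointsP [t [k [tt eu]]] pos [F [[C /groebner_conesP [v ov eC] fF] [d d2 dF]] Fu]]|].
  exists (sel t k) => //; have /allP /(_ _ (mem_vertices k tt)) /andP[_ /implyP] := vertices_check.
  apply; apply/andP; split.
    by have := pos 0; have := pos 1; have := pos 2%:R; rewrite eu !mxE /= /posz => -> -> ->.
  have pos' (i : 'I_3) : 0 < lat R u 0 i by rewrite /lat mxE ltr0z.
  suff [a [b [ab ha hb]]] : exists a b, [/\ a != b, minset (lat R u) a & minset (lat R u) b].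
    apply/exists3; exists a; apply/exists3; exists b; apply/and3P; split => //.
      by apply/minz_wv => c; move/forallP: ha => /(_ c); rewrite eu.
    by apply/minz_wv => c; move/forallP: hb => /(_ c); rewrite eu.
  have Cu : C (lat R u) by case: fF Fu => m _ -> [].
  have [a ma] := minset_nonempty v.
  have gu : gcone (minset v) (lat R u) by rewrite -eC.
  have [[b mb ba]|no] := pselect (exists2 b, minset v b & b != a).
    by exists b, a; split => //; apply/forallP => c; apply: (proj2 gu).
  have eC' : C = cof (cgen a) predT.
    rewrite eC -chamberE; apply: eq_gcone => b; apply/idP/eqP => [mb|-> //].
    by apply/eqP/negPn/negP => ba; apply: no; exists b.
  rewrite eC' in fF; have [a' [_ eF]] := face_cof fF.
  have dd := cone_dim_uniq dF; rewrite eF in dd.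
  have {}dd := dd _ (cof_cone_dim R a' (chamber_dual a)).
  have [k' nk] : exists k', ~~ a' k'.
    apply/existsP; rewrite -negb_forall; apply/negP => /forallP h.
    by move: d2; rewrite dd (eq_card (B := predT)) ?card3 // => j; rewrite !inE h.
  move: Fu; rewrite eF => -[c [hc ec]].
  have ck : c k' = 0 by case: (hc k') => _; apply.
  have wa : forall b, minset (lat R u) b <-> wv b (lat R u) = wv a (lat R u).
    move=> b; have le : forall b, wv a (lat R u) <= wv b (lat R u).
      by move=> b'; apply: (proj2 gu).
    split=> [/forallP /(_ a) h|h]; first by apply/eqP; rewrite eq_le h le.
    by apply/forallP => b'; rewrite h.
  have [ka|ka] := eqVneq k' a.
    have := pos' a; rewrite ec summxE big1 ?ltxx // => j _.
    have [->|ja] := eqVneq j a; first by rewrite -ka ck scale0r mxE.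
    by rewrite /cgen (negPf ja) /lat !mxE eq_sym (negPf ja) andbF mulr0.
  exists k', a; split => //; apply/wa => //.
  rewrite ec /wv !dot_comb; apply: eq_bigr => j _.
  have [->|ja] := eqVneq j a; first by rewrite /cgen eqxx -!/(wv _ _) !wv_apex.
  have [->|jk] := eqVneq j k'; first by rewrite ck !mul0r.
  by rewrite /cgen (negPf ja) -!/(wv _ _) !wv_delta // eq_sym.
move=> [z zE ->]; have /allP /(_ _ zE) /and3P[zv pz tz] := exc_check.
split.
- by have [t [k tt ->]] := verticesP zv; apply/groebner_pointsP; exists t, k.
- by move=> i; rewrite mxE; case/and3P: pz => *; case: i => [[|[|[|//]]]].
- have /exists3 [a /exists3 [b /and3P[ab /minz_wv ma /minz_wv mb]]] := tz.
  pose T : pred 'I_3 := [pred c | (c == a) || (c == b)].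
  have gz : gcone T (lat R (vz z)).
    split; last by move=> c c' /orP[]/eqP ->.
    move=> i; rewrite /lat mxE ler0z mxE; case/and3P: pz => p0 p1 p2.
    by case: i => [[|[|[|//]]]] ?; rewrite ltW.
  have fT : face (gcone T) (cof (cgen a) predT : set V).
    exists (lat R (mono b - mono a)).
      move=> w; rewrite -chamberE => -[_ h].
      by rewrite dot_latB subr_ge0 h /=.
    rewrite -chamberE; apply/seteqP; split => w.
      move=> [ow h]; split.
        by split => // c c' /eqP ->; apply: h; rewrite /T /= eqxx.
      rewrite /= dot_latB.
      by apply/eqP; rewrite subr_eq0 eq_le !h // /T /= eqxx ?orbT.
    move=> [[ow h]]; rewrite /= dot_latB.
    move=> /eqP; rewrite subr_eq0 => /eqP e; split => // c c' /orP[]/eqP ->.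
      by apply: h => /=.
    by rewrite /wv e; apply: h => /=.
  exists (gcone T) => //; split.
    exists (gcone T); first by apply: gcone_groebner; exists a; rewrite /T /= eqxx.
    exists 0; first by move=> w _; rewrite dot0l.
    by apply/seteqP; split => [w h|w [] //]; split => //=; rewrite dot0l.
  have [a' [_ eT]] := face_cof fT.
  exists #|a'|; last by rewrite eT; exact: cof_cone_dim (chamber_dual a).
  have nb : ~~ a' b.
    apply/negP => /(cof_gen R (cgen a)); rewrite -eT => /(gcone_tie (a := a) (b := b)).
    rewrite /T /= !eqxx orbT => /(_ isT isT).
    rewrite /cgen [b == a]eq_sym (negPf (ab : a != b)) wv_delta // wvE /lat !mxE !eqxx mulr1.
    by case: b {mb T gz fT eT ab} => [[|[|[|//]]]] ? /= /esym/eqP; rewrite pnatr_eq0.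
  have : (#|a'| < #|(predT : pred 'I_3)|)%N.
    by apply: proper_card; apply/properP; split; [exact: subset_predT|exists b].
  by rewrite card3.
Qed.

End GroebnerPoints.

(** * Toric charts *)

(** Isomorphisms between open subsets are given by maps between the ambient
  spaces, which are easier to compose and to restrict than maps between
  subspaces. *)
Record local_iso (R : realType) (X Y : space R) (f : X -> Y) (g : Y -> X)
    (U : set X) (V : set Y) : Prop := LocalIso {
  li_openU : zopen U;
  li_openV : zopen V;
  li_f : forall x, U x -> V (f x);
  li_g : forall y, V y -> U (g y);
  li_gf : forall x, U x -> g (f x) = x;
  li_fg : forall y, V y -> f (g y) = y;
  li_fm : forall x, U x -> mor_at f x;
  li_gm : forall y, V y -> mor_at g y
}.

Section Toric.
Variable R : realType.
Local Notation C := R[i].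
Local Notation V := 'rV[R]_3.
Local Notation S := (@e8fan R).
Local Notation X := (toric_variety S).
Local Notation pt := (toric_point S).
Local Notation cf := (@chart_functions R S).
Implicit Types (x y : pt) (s : set V) (m : N) (B D : 'I_3 -> N) (a : pred 'I_3).

Lemma dual_cof B a m :
  dual_lattice (@cof R B a) m <-> forall k, a k -> 0 <= pr m (B k).
Proof.
split=> [h k /(cof_gen R B)/h|h w]; first by rewrite dot_lat ler0z.
by apply: dot_ge0_cof => k /h; rewrite dot_lat ler0z.
Qed.

Lemma perp_cof B a m : perp (@cof R B a) m <-> forall k, a k -> pr m (B k) = 0.
Proof.
split=> [h k /(cof_gen R B)/h /eqP|h w [c [hc ->]]].
  by rewrite dot_lat intr_eq0 => /eqP.
rewrite dot_comb big1 // => k _; rewrite dot_lat.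
by case: (boolP (a k)) => [/h ->|/(proj2 (hc k)) ->]; rewrite ?mulr0 ?mul0r.
Qed.

Lemma perp0 s : perp s 0.
Proof. by move=> w _; rewrite lat0 dot0l. Qed.

Lemma perpD s m m' : perp s m -> perp s m' -> perp s (m + m').
Proof. by move=> h h' w sw; rewrite latD dotDl h ?h' ?addr0. Qed.

Lemma perpN s m : perp s m -> perp s (- m).
Proof. by move=> h w sw; rewrite latN dotC dotNr dotC h ?oppr0. Qed.

Lemma perpZ s (z : int) m : perp s m -> perp s (z *: m).
Proof. by move=> h w sw; rewrite lat_MZ dotC dotZr dotC h ?mulr0. Qed.

Lemma chr_neq0 x m : (chr x m != 0) <-> perp (orb x) m.
Proof.
split=> [h|h]; first by apply: contrapT => /chr_out e; rewrite e eqxx in h.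
apply/eqP => e; have := chrD h (perpN h); rewrite subrr chr0 e mul0r => /eqP.
by rewrite oner_eq0.
Qed.

Lemma chr_eq0 x m : chr x m = 0 <-> ~ perp (orb x) m.
Proof.
split=> [e /chr_neq0|/chr_out //]; by rewrite e eqxx.
Qed.

Lemma chr_perpD x m m' : perp (orb x) m -> chr x (m + m') = chr x m * chr x m'.
Proof.
move=> h; have [h'|h'] := pselect (perp (orb x) m'); first exact: chrD.
rewrite (chr_out h') mulr0 chr_out // => h2; apply: h'.
by have := perpD (perpN h) h2; rewrite addKr.
Qed.

Lemma chrN x m : perp (orb x) m -> chr x (- m) = (chr x m)^-1.
Proof.
move=> h; have h0 := proj2 (chr_neq0 _ _) h.
by apply: (mulfI h0); rewrite -chr_perpD // subrr chr0 divff.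
Qed.

Lemma chrMn x m n : perp (orb x) m -> chr x (n%:Z *: m) = chr x m ^+ n.
Proof.
move=> h; elim: n => [|n IH]; first by rewrite scale0r chr0.
by rewrite intS scalerDl scale1r chr_perpD // IH exprS.
Qed.

Lemma chrZ x m (z : int) : perp (orb x) m -> chr x (z *: m) = chr x m ^ z.
Proof.
move=> h; case: z => n; first exact: chrMn.
by rewrite NegzE scaleNr chrN ?chrMn //; exact: perpZ.
Qed.

Lemma chr_sum (I : Type) (r : seq I) x (F : I -> N) :
  (forall i, perp (orb x) (F i)) ->
  chr x (\sum_(i <- r) F i) = \prod_(i <- r) chr x (F i).
Proof.
move=> h; elim: r => [|i r IH]; first by rewrite !big_nil chr0.
by rewrite !big_cons chr_perpD // IH.
Qed.

Lemma toric_eq x y : orb x = orb y -> (forall m, chr x m = chr y m) -> x = y.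
Proof.
case: x => o c h0 h1 h2 h3; case: y => o' c' h0' h1' h2' h3' /= eo ec.
have {}ec : c = c' by apply/funext.
subst o' c'; congr ToricPoint; exact: Prop_irrelevance.
Qed.

Lemma chart_sub x s : S s -> toric_chart s x -> orb x `<=` s.
Proof. by move=> _ [m _ ->] w []. Qed.

Lemma chart_of_sub x s : S s -> orb x `<=` s -> toric_chart s x.
Proof.
move=> Ss sub; have := e8fan_inter Ss (orb_fan x).
by rewrite setIC (_ : orb x `&` s = orb x) //; apply/setIidPl.
Qed.

Lemma chart_self x : toric_chart (orb x) x.
Proof. by apply: chart_of_sub (orb_fan x) _. Qed.

Lemma dual_perp_sub x s m : S s -> toric_chart s x -> dual_lattice s m ->
  chr x m = 0 -> exists2 w, orb x w & 0 < dot (lat R m) w.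
Proof.
move=> Ss xs dm /chr_eq0 /existsNP [w' /not_implyP [ow /eqP nz]].
by exists w' => //; rewrite lt_neqAle eq_sym nz dm //; apply: chart_sub xs _ _.
Qed.

(** Multiplicativity extends from the characters orthogonal to the cone of the
  orbit to all characters of a chart: if one of two nonnegative functionals is
  positive somewhere on that cone then so is their sum. *)
Lemma chrM x s m m' : S s -> toric_chart s x ->
  dual_lattice s m -> dual_lattice s m' -> chr x (m + m') = chr x m * chr x m'.
Proof.
move=> Ss xs dm dm'.
have [h|h] := pselect (perp (orb x) m); first exact: chr_perpD.
have e := proj2 (chr_eq0 _ _) h; rewrite e mul0r; apply/chr_eq0 => h'.
have [w ow w0] := dual_perp_sub Ss xs dm e.
have := h' _ ow; rewrite latD dotDl => /eqP; apply/negP; rewrite gt_eqF //.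
by rewrite ltr_pwDl // dm' //; apply: chart_sub xs _ _.
Qed.

Lemma dualD s m m' : dual_lattice s m -> dual_lattice s m' ->
  @dual_lattice R s (m + m').
Proof. by move=> h h' w sw; rewrite latD dotDl addr_ge0 ?h ?h'. Qed.

Lemma dual0 s : @dual_lattice R s 0.
Proof. by move=> w _; rewrite lat0 dot0l. Qed.

Lemma cf_fin (I : finType) s (c : I -> C) (m : I -> N) :
  (forall i, dual_lattice s (m i)) ->
  cf s (fun x => \sum_i c i * chr x (m i)).
Proof.
move=> h; exists #|I|, (c \o enum_val), (m \o enum_val); split; first by move=> i; exact: h.
by move=> x; rewrite (big_enum_val (A := predT) (fun i => c i * chr x (m i))).
Qed.

Lemma cf_chr s m : dual_lattice s m -> cf s (fun x => chr x m).
Proof.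
move=> h; have := @cf_fin unit s (fun=> 1) (fun=> m) (fun=> h).
by congr cf; apply/funext => x; rewrite big_const card_unit /= mul1r addr0.
Qed.

Lemma cf_cst s (c : C) : cf s (fun=> c).
Proof.
have := @cf_fin unit s (fun=> c) (fun=> 0) (fun=> @dual0 s).
by congr cf; apply/funext => x;
  rewrite big_const card_unit /= chr0 mulr1 addr0.
Qed.

Lemma cf_add s P Q : cf s P -> cf s Q ->
  cf s (fun x => P x + Q x).
Proof.
move=> [k [c [m [hm eP]]]] [k' [c' [m' [hm' eQ]]]].
have := @cf_fin ('I_k + 'I_k')%type s (fun i => match i with inl j => c j | inr j => c' j end)
  (fun i => match i with inl j => m j | inr j => m' j end).
move=> /(_ (fun i => match i with inl j => hm j | inr j => hm' j end)).
by congr cf; apply/funext => x; rewrite big_sumType /= eP eQ.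
Qed.

Lemma cf_mul s P Q : S s -> cf s P -> cf s Q ->
  exists2 T, cf s T & forall x, toric_chart s x -> T x = P x * Q x.
Proof.
move=> Ss [k [c [m [hm eP]]]] [k' [c' [m' [hm' eQ]]]].
exists (fun x => \sum_(i : 'I_k * 'I_k') (c i.1 * c' i.2) * chr x (m i.1 + m' i.2)).
  by apply: cf_fin => i; exact: dualD.
move=> x xs; rewrite eP eQ mulr_suml -(pair_bigA _ (fun i j => c i * c' j * chr x (m i + m' j))).
apply: eq_bigr => i _; rewrite mulr_sumr; apply: eq_bigr => j _.
by rewrite (chrM Ss) //; ring.
Qed.

(** Points of a chart where a suitable character does not vanish lie in the
  other chart, and a high power of that character clears denominators. *)
Lemma cf_trans s s' x Q : S s -> S s' -> toric_chart s x -> toric_chart s' x ->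
  cf s' Q -> exists M T,
  [/\ cf s M, cf s T, M x != 0 &
    forall y, toric_chart s y -> M y != 0 -> toric_chart s' y /\ Q y = T y / M y].
Proof.
move=> Ss Ss' xs xs' [n [c [l [hl eQ]]]].
have [t [a [tt es]]] := Ss; have [t' [a' [tt' es']]] := Ss'.
have [m [hm hm' hm0]] := tri_sep a a' tt tt'.
have dm : dual_lattice s m by rewrite es; apply/dual_cof.
pose K : int := \sum_i \sum_k `|pr (l i) (gen t k)|.
have hK i k : - K <= pr (l i) (gen t k).
  rewrite lerNl; apply: le_trans (ler_norm _) _; rewrite normrN /K (bigD1 i) //=.
  rewrite (bigD1 k) //= -addrA lerDl addr_ge0 //.
    by apply: sumr_ge0.
  by apply: sumr_ge0 => j _; apply: sumr_ge0.
have K0 : 0 <= K by apply: sumr_ge0 => j _; apply: sumr_ge0.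
have dK : dual_lattice s (K *: m).
  by rewrite es; apply/dual_cof => k /hm h; rewrite prZ mulr_ge0.
have dl i : dual_lattice s (l i + K *: m).
  rewrite es; apply/dual_cof => k ak; rewrite prD prZ.
  have [e|ne] := eqVneq (pr m (gen t k)) 0.
    rewrite e mulr0 addr0; have [j aj ->] := hm0 _ ak e.
    by move: (hl i); rewrite es' => /dual_cof; apply.
  have : 1 <= pr m (gen t k) by move/eqP: ne; have := hm _ ak; lia.
  move=> h1; have := hK i k; nia.
exists (fun y => chr y (m + K *: m)), (fun y => \sum_i c i * chr y (l i + K *: m + m)).
have px : perp (orb x) m.
  have sub : orb x `<=` s `&` s' by move=> w ow; split; exact: chart_sub ow.
  move=> w /sub [sw]; rewrite es' => -[c' [hc' ew]].
  apply/eqP; rewrite eq_le dm // andbT ew dot_comb -oppr_ge0 -sumrN sumr_ge0 // => j _.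
  rewrite -mulrN; case: (boolP (a' j)) => [aj|/(proj2 (hc' j)) ->]; last by rewrite mul0r.
  by rewrite mulr_ge0 ?dot_lat ?oppr_ge0 ?lerz0 ?hm' //; case: (hc' j).
split.
- by apply: cf_chr; apply: dualD.
- by apply: cf_fin => i; apply: dualD.
- by apply/chr_neq0; apply: perpD => //; exact: perpZ.
move=> y ys My.
have py : perp (orb y) m.
  have := proj1 (chr_neq0 _ _) My => py w ow; have := py _ ow.
  have sw := chart_sub Ss ys ow.
  rewrite latD dotDl => /eqP; rewrite paddr_eq0 ?dm ?dK // => /andP[/eqP] //.
split.
  apply: chart_of_sub => // w ow; rewrite es'; apply: (cof_common hm hm0 _ (py _ ow)).
  by rewrite -es; exact: chart_sub ow.
have pK : perp (orb y) (m + K *: m) by apply: perpD => //; exact: perpZ.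
rewrite eQ mulr_suml; apply: eq_bigr => i _.
have -> : l i + K *: m + m = (m + K *: m) + l i by rewrite -addrA addrC [K *: m + m]addrC.
rewrite (chr_perpD _ pK); field.
exact/chr_neq0.
Qed.

Lemma toric_cover x : exists2 s, S s & toric_chart s x.
Proof. by exists (orb x); [exact: orb_fan|exact: chart_self]. Qed.

Lemma good_toric : good X.
Proof.
apply: (@good_glue R pt (set V) S (@toric_chart R S) (@chart_functions R S)).
- exact: toric_cover.
- by move=> s c _; exists (fun=> c) => //; exact: cf_cst.
- by move=> s P Q _ hP hQ; exists (fun x => P x + Q x) => //; exact: cf_add.
- exact: cf_mul.
- exact: cf_trans.
Qed.

Lemma chart_open s : S s -> zopen (toric_chart s : set X).
Proof.
move=> Ss; apply: (@glue_openP R pt (set V) S (@toric_chart R S) (@chart_functions R S)).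
- exact: cf_mul.
- exact: cf_trans.
move=> x xs; exists s, (fun=> 1); split => //; first exact: cf_cst.
exact: oner_neq0.
Qed.

Lemma cf_germ s P (x : X) : S s -> toric_chart s x -> cf s P -> germ x P.
Proof.
move=> Ss xs hP; exists (toric_chart s); split => //; first exact: chart_open.
move=> y ys; exists s, P, (fun=> 1); split => //; [|exact: oner_neq0|].
  by split => //; exact: cf_cst.
by move=> z _ _ _; rewrite divr1.
Qed.

Lemma chr_germ s m (x : X) : S s -> toric_chart s x -> dual_lattice s m ->
  germ x (fun y : X => chr y m).
Proof. by move=> Ss xs dm; apply: cf_germ Ss xs _; exact: cf_chr. Qed.

(** Near a point of a chart the regular functions are quotients of combinations of
  the characters of the chart. *)
Lemma toric_mor (Z : space R) (f : Z -> X) (p : Z) s : good Z -> S s ->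
  around p (fun z => toric_chart s (f z)) ->
  (forall m, dual_lattice s m -> germ p (fun z => chr (f z) m)) -> mor_at f p.
Proof.
move=> gZ Ss af hf; have fs := around_pt af.
have hP P : cf s P -> germ p (P \o f).
  move=> [k [c [m [hm e]]]].
  have : germ p (fun z => \sum_i c i * chr (f z) (m i)).
    apply: germ_sum => // i; apply: germM => //; first exact: germ_cst.
    exact: hf.
  by congr germ; apply/funext => z; rewrite /= e.
have cont O : zopen O -> O (f p) -> around p (fun z => O (f z)).
  move=> oO Op; have [Q [FQ Qp hQ]] := oO _ _ Ss fs Op.
  apply: (around_mono2 gZ _ af (germ_neq0 gZ (hP _ FQ) Qp)) => z zs Qz.
  exact: hQ.
split => // h [O [oO Op rh]]; have [s' [P [Q [Ss' ps' [FP FQ] Qp e]]]] := rh _ Op.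
have [P' [Q' [FP' FQ' Q'p h']]] := @reloc R pt (set V) S (@toric_chart R S)
  (@chart_functions R S) cf_mul cf_trans _ _ _ _ _ Ss Ss' fs ps' FP FQ Qp.
apply: (germ_eq gZ (germM gZ (hP _ FP') (germV gZ (hP _ FQ') Q'p))).
apply: (around_mono2 gZ _ (around_and gZ af (cont _ oO Op)) (germ_neq0 gZ (hP _ FQ') Q'p)).
move=> z [zs Oz] Q'z; have [zs' Qz e'] := h' _ zs Q'z.
by rewrite /= e.
Qed.

Section Chart.
Variables (B D : 'I_3 -> N) (a : pred 'I_3).
Hypotheses (hD : dualb B D 1) (hS : S (cof B a)).
Local Notation U := (toric_chart (cof B a) : set X).

Definition coords (x : X) : affine_space R 3 := \row_k chr x (D k).
Definition chart_image : set (affine_space R 3) :=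
  [set t | forall k, ~~ a k -> t 0 k != 0].

Lemma chart_orb x : U x -> orb x = cof B (fun k => a k && (chr x (D k) == 0)).
Proof.
move=> /face_cof [a' [sub e]]; rewrite e; apply: eq_cof => // k.
have key : (chr x (D k) == 0) = a' k.
  apply/eqP/idP => [/chr_eq0|ak].
    rewrite e perp_cof => /existsNP [j /not_implyP [aj]].
    by rewrite (proj2 hD); case: (eqVneq k j) => [->|].
  apply/chr_eq0; rewrite e perp_cof => /(_ _ ak).
  by rewrite (proj2 hD) eqxx.
by rewrite key; case: (boolP (a' k)) => [/sub ->|]; rewrite ?andbF.
Qed.

Lemma unimod_expand m : m = \sum_k pr m (B k) *: D k.
Proof.
have hD' : dualb D B 1.
  split; first exact: (proj1 hD).
  by move=> i j; rewrite prC (proj2 hD) eq_sym.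
have := @dual_expand int idfun D B m hD'.
move=> e; rewrite [LHS]e; apply: eq_bigr => k _; rewrite map_mx_id //.
by congr (_ *: _); apply: eq_bigr => i _; rewrite mulrC.
Qed.

(** Characters are Laurent monomials in the coordinates of a chart. *)
Lemma chr_monomial x m : U x ->
  (forall k, a k -> chr x (D k) = 0 -> 0 <= pr m (B k)) ->
  chr x m = \prod_k chr x (D k) ^ pr m (B k).
Proof.
move=> Ux hm; have eo := chart_orb Ux.
have [pm|npm] := pselect (perp (orb x) m).
  have hk k : perp (orb x) (pr m (B k) *: D k) /\
      chr x (pr m (B k) *: D k) = chr x (D k) ^ pr m (B k).
    have [pk|/chr_eq0 ck] := pselect (perp (orb x) (D k)).
      by split; [exact: perpZ|exact: chrZ].
    have nk := proj1 (chr_eq0 x (D k)) ck.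
    have -> : pr m (B k) = 0.
      move: pm; rewrite eo perp_cof; apply; rewrite ck eqxx andbT.
      apply: contrapT => /negP ak; apply: nk; rewrite eo perp_cof => j.
      rewrite (proj2 hD) => /andP[aj _]; case: eqP => // kj.
      by rewrite kj aj in ak.
    by rewrite scale0r expr0z chr0; split => //; exact: perp0.
  rewrite [in LHS](unimod_expand m) chr_sum; last by move=> k; case: (hk k).
  by apply: eq_bigr => k _; case: (hk k).
rewrite chr_out //; move: npm; rewrite eo perp_cof => /existsNP [k].
move=> /not_implyP [/andP[ak /eqP ck] nz].
have := hm _ ak ck; case ek: (pr m (B k)) nz => [[|n]|n] // _ _.
by rewrite (bigD1 k) //= ck ek -exprnP expr0n mul0r.
Qed.

End Chart.
End Toric.

Section Chart.
Variable R : realType.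
Local Notation C := R[i].
Local Notation S := (@e8fan R).
Local Notation X := (toric_variety S).
Variables (B D : 'I_3 -> N) (a : pred 'I_3).
Hypotheses (hD : dualb B D 1) (hS : S (cof B a)).
Local Notation U := (toric_chart (cof B a) : set X).
Local Notation W := (@chart_image R a).
Local Notation coords := (@coords R D).
Implicit Types (x y : X) (m : N) (t : affine_space R 3).

Lemma chart_uniq x y : U x -> U y -> coords x = coords y -> x = y.
Proof.
move=> Ux Uy e.
have ek k : chr x (D k) = chr y (D k) by move/rowP: e => /(_ k); rewrite !mxE.
have eo : orb x = orb y.
  by rewrite (chart_orb hD Ux) (chart_orb hD Uy); apply: eq_cof => // k; rewrite ek.
apply: toric_eq => // m.
have [pm|npm] := pselect (perp (orb x) m); last by rewrite !chr_out // -eo.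
have hx k : a k -> chr x (D k) = 0 -> 0 <= pr m (B k).
  move=> ak ck; move: pm; rewrite (chart_orb hD Ux) perp_cof => -> //.
  by rewrite ak ck eqxx.
rewrite (chr_monomial hD Ux hx) (chr_monomial hD Uy).
  by apply: eq_bigr => k _; rewrite ek.
by move=> k ak; rewrite -ek; exact: hx.
Qed.

(** The characters of the point with given coordinates. *)
Definition par_chr t m : C :=
  if `[< perp (@cof R B (fun k => a k && (t 0 k == 0))) m >]
  then \prod_k t 0 k ^ pr m (B k) else 0.

Lemma chart_exists t : W t -> exists2 x, U x & coords x = t.
Proof.
move=> Wt; pose o := @cof R B (fun k => a k && (t 0 k == 0)).
have fo : face o (cof B a) by apply: (cof_face R hD) => k /andP[].
have So : S o by exact: e8fan_face hS fo.
have nz m k : perp o m -> t 0 k = 0 -> pr m (B k) = 0.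
  rewrite perp_cof => h tk; apply: h; rewrite tk eqxx andbT.
  by apply: contrapT => /negP /Wt; rewrite tk eqxx.
have c0 : par_chr t 0 = 1.
  rewrite /par_chr; case: asboolP => [_|[]]; last exact: perp0.
  by rewrite big1 // => k _; rewrite pr0 expr0z.
have cD m m' : perp o m -> perp o m' -> par_chr t (m + m') = par_chr t m * par_chr t m'.
  move=> h h'; rewrite /par_chr !asboolT //; last exact: perpD.
  rewrite -big_split /=; apply: eq_bigr => k _; rewrite prD.
  have [t0|tn] := eqVneq (t 0 k) 0; last by rewrite expfzDr.
  by rewrite (nz m) // (nz m') // addr0 !expr0z mul1r.
have c_out m : ~ perp o m -> par_chr t m = 0 by move=> h; rewrite /par_chr asboolF.
exists (@ToricPoint R S o (par_chr t) So c0 cD c_out) => //.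
apply/rowP => k; rewrite mxE /= /par_chr; case: asboolP => [h|].
  rewrite (bigD1 k) //= (proj2 hD) eqxx big1 ?mulr1 // => j jk.
  by rewrite (proj2 hD) eq_sym (negPf jk).
rewrite perp_cof => /existsNP [j /not_implyP [/andP[_ /eqP tj]]].
by rewrite (proj2 hD); case: (eqVneq k j) => [->|].
Qed.

Lemma W_open : zopen (W : set (affine_space R 3)).
Proof.
have -> : W = [set t | eval (\prod_(k | ~~ a k) 'X_k : {mpoly C[3]}) t != 0].
  apply/seteqP; split => t /=; rewrite /eval rmorph_prod /=.
    by move=> h; apply/prodf_neq0 => k ak; rewrite mevalXU; exact: h.
  by move=> /prodf_neq0 h k ak; have := h _ ak; rewrite mevalXU.
exact: poly_open.
Qed.

Lemma dual_coord k : dual_lattice (@cof R B a) (D k).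
Proof. by apply/dual_cof => j _; rewrite (proj2 hD); case: (k == j). Qed.

(** A unimodular cone of the fan gives a chart: the open set of the points in
  orbits of its faces is a product of lines and punctured lines. *)
Lemma chart_iso : exists par : affine_space R 3 -> X, local_iso coords par U W.
Proof.
have [x1 Ux1 e1] : exists2 x, U x & coords x = const_mx 1.
  by apply: chart_exists => k _; rewrite mxE oner_neq0.
have H t : exists x, W t -> U x /\ coords x = t.
  have [Wt|nW] := pselect (W t); last by exists x1.
  by have [x Ux e] := chart_exists Wt; exists x.
have [par hpar] := choice H.
have UW x : U x -> W (coords x).
  move=> Ux k ak; rewrite mxE; apply/chr_neq0.
  rewrite (chart_orb hD Ux) perp_cof => j /andP[aj _].
  by rewrite (proj2 hD); case: eqP => // kj; rewrite kj aj in ak.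
exists par; split.
- exact: chart_open.
- exact: W_open.
- exact: UW.
- by move=> t Wt; case: (hpar t Wt).
- move=> x Ux; have [Up e] := hpar _ (UW _ Ux); exact: chart_uniq Up Ux e.
- by move=> t Wt; case: (hpar t Wt).
- move=> x Ux; apply: (mor_affine (@good_toric R)) => k.
  have : germ x (fun y : X => chr y (D k)).
    by apply: (chr_germ hS Ux); exact: dual_coord.
  by congr germ; apply/funext => y; rewrite mxE.
- move=> t Wt; apply: (toric_mor (s := cof B a) (good_affine R 3) hS).
    by exists W; split => //; [exact: W_open|move=> y Wy; case: (hpar y Wy)].
  move=> m /dual_cof hm.
  have : germ t (fun y : affine_space R 3 => \prod_k (y 0 k) ^ pr m (B k)).
    apply: (germ_prod (good_affine R 3)) => k.
    apply: (germXz (good_affine R 3)); first exact: coord_germ.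
    move=> neg; apply: Wt; apply/negP => /hm; by rewrite leNgt neg.
  move=> /(germ_eq (good_affine R 3)); apply.
  exists W; split => //; first exact: W_open.
  move=> y Wy; have [Uy ey] := hpar y Wy; rewrite (chr_monomial hD Uy).
    by apply: eq_bigr => k _; rewrite -{2}ey mxE.
  by move=> k ak _; exact: hm.
Qed.

End Chart.

(** * Local isomorphisms, smoothness, separation *)

Section LocalIso.
Variable R : realType.
Local Notation C := R[i].
Implicit Types X Y Z : space R.

Lemma emb_id X : good X -> emb (id : X -> X).
Proof.
move=> gX; split => //; first by move=> U oU; exists U.
by move=> p g gg; exists g => //; exact: around_all.
Qed.

Lemma local_iso_restrict X Y (f : X -> Y) g U V U' : good X -> good Y ->
  local_iso f g U V -> zopen U' -> U' `<=` U ->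
  local_iso f g U' (V `&` g @^-1` U').
Proof.
move=> gX gY l oU' sub; split => //.
- apply: (openP gY) => y [Vy Uy]; apply: around_and => //.
    by exists V; split => //; exact: (li_openV l).
  exact: (proj1 (li_gm l Vy)).
- move=> x Ux; split; first exact: (li_f l (sub _ Ux)).
  by rewrite /= (li_gf l (sub _ Ux)).
- by move=> y [].
- by move=> x /sub; exact: (li_gf l).
- by move=> y [Vy _]; exact: (li_fg l).
- by move=> x /sub; exact: (li_fm l).
- by move=> y [Vy _]; exact: (li_gm l).
Qed.

Lemma local_iso_comp X Y Z (f : X -> Y) g U V (f' : Y -> Z) g' V' W :
  local_iso f g U V -> local_iso f' g' V' W -> V `<=` V' ->
  (forall z, W z -> V (g' z)) -> local_iso (f' \o f) (g \o g') U W.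
Proof.
move=> l l' VV WV; split.
- exact: (li_openU l).
- exact: (li_openV l').
- by move=> x /(li_f l) /VV /(li_f l').
- by move=> z /WV /(li_g l).
- by move=> x Ux /=; rewrite (li_gf l' (VV _ (li_f l Ux))) (li_gf l Ux).
- by move=> z Wz /=; rewrite (li_fg l (WV _ Wz)) (li_fg l' Wz).
- move=> x Ux; apply: mor_comp; first exact: (li_fm l).
  by apply: (li_fm l'); apply: VV; exact: (li_f l).
- move=> z Wz; apply: mor_comp; first exact: (li_gm l').
  by apply: (li_gm l); exact: WV.
Qed.

(** A local isomorphism that matches two subsets induces an isomorphism of the
  spaces embedded there. *)
Lemma emb_iso X Z Y0 Y1 (i : Y0 -> X) (j : Y1 -> Z) (f : X -> Z) g U V
    (A : set X) (B : set Z) : good Y0 -> good Y1 -> emb i -> emb j ->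
  local_iso f g U V -> (forall y, (U `&` A) (i y)) ->
  (forall x, (U `&` A) x -> exists y, i y = x) ->
  (forall y, (V `&` B) (j y)) -> (forall z, (V `&` B) z -> exists y, j y = z) ->
  (forall x, U x -> (A x <-> B (f x))) ->
  exists phi : Y0 -> Y1, isomorphism phi /\ forall y, j (phi y) = f (i y).
Proof.
move=> g0 g1 ei ej l hA sA hB sB AB.
have /choice [phi hphi] : forall y, exists y', j y' = f (i y).
  move=> y; have [Uy Ay] := hA y; apply: sB; split; first exact: (li_f l).
  exact/AB.
have /choice [psi hpsi] : forall y, exists y', i y' = g (j y).
  move=> y; have [Vy By] := hB y; have Ugy := li_g l Vy; apply: sA; split => //.
  by apply/AB => //; rewrite (li_fg l Vy).
have e1 : j \o phi = f \o i by apply/funext.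
have e2 : i \o psi = g \o j by apply/funext.
exists phi; split => //; split.
  apply: mor_regular => // p; apply: (emb_factor g0 ej); rewrite e1.
  by apply: mor_comp; [exact: emb_mor|apply: (li_fm l); case: (hA p)].
exists psi; split.
- apply: mor_regular => // p; apply: (emb_factor g1 ei); rewrite e2.
  by apply: mor_comp; [exact: emb_mor|apply: (li_gm l); case: (hB p)].
- by move=> y; apply: (emb_inj ei); rewrite hpsi hphi (li_gf l) //; case: (hA y).
- by move=> y; apply: (emb_inj ej); rewrite hphi hpsi (li_fg l) //; case: (hB y).
Qed.

Lemma emb_sub_sub X (A : set X) (U : set (sub_space A)) : good X ->
  @emb R (sub_space U) X (fun x => sval (sval x)).
Proof.
move=> gX; have gS := good_sub A gX.
exact: (@emb_comp R (sub_space U) (sub_space A) X sval sval (good_sub U gS)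
  (emb_sval U gS) (emb_sval A gX)).
Qed.

(** A space embedded onto a subset that is cut out, in a chart of the ambient
  space, by polynomials with independent differentials is smooth. *)
Lemma smooth_local d r X Y (i : Y -> X) (A : set X) (f : X -> affine_space R (d + r))
    g U V (G : 'I_r -> {mpoly C[d + r]}) (p : Y) :
  good X -> good Y -> emb i -> (forall y, A (i y)) -> (forall x, A x -> exists y, i y = x) ->
  local_iso f g U V -> U (i p) ->
  (forall x, U x -> (A x <-> forall k, eval (G k) (f x) = 0)) ->
  \rank (\matrix_(k < r, j < d + r) eval (mderiv j (G k)) (f (i p))) = r ->
  smooth_at d p.
Proof.
move=> gX gY ei hA sA l Up hG rk.
pose Z : set (affine_space R (d + r)) := [set x | forall k, eval (G k) x = 0].
have gU := good_sub (i @^-1` U) gY.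
have gV := good_sub (V `&` Z) (good_affine R (d + r)).
have e1 : @emb R (sub_space (i @^-1` U)) X (i \o sval).
  exact: emb_comp gU (emb_sval _ gY) ei.
have e2 := emb_sval (V `&` Z) (good_affine R (d + r)).
have [phi [iphi ephi]] : exists phi : sub_space (i @^-1` U) -> sub_space (V `&` Z),
    isomorphism phi /\ forall y, sval (phi y) = f ((i \o sval) y).
  have H := emb_iso (A := A) (B := Z) gU gV e1 e2 l; apply: H => //.
  - by case=> y Uy; split => //=; exact: hA.
  - by move=> x [Ux /sA [y e]]; rewrite -e in Ux *; exists (exist _ y Ux).
  - by case.
  - by move=> z hz; exists (exist _ z hz).
exists (i @^-1` U), r, G, V, phi, Up; split => //.
- exact: (emb_openr ei) (li_openU l).
- exact: (li_openV l).
- by rewrite ephi.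
Qed.

Section Transfer.
Variables (X Y : space R) (gX : good X) (gY : good Y).
Variables (f : X -> Y) (g : Y -> X) (U : set X) (V : set Y).
Hypothesis l : local_iso f g U V.
Variable p : X.
Hypothesis Up : U p.

Lemma li_aroundU : around p U.
Proof. by exists U; split => //; exact: (li_openU l). Qed.

Lemma li_aroundV : around (f p) V.
Proof. by exists V; split => //; [exact: (li_openV l)|exact: (li_f l)]. Qed.

Lemma li_mor_g : mor_at g (f p).
Proof. by apply: (li_gm l); exact: (li_f l). Qed.

Lemma li_germ h : germ p h -> germ (f p) (h \o g).
Proof. by move=> gh; apply: (proj2 li_mor_g); rewrite (li_gf l Up). Qed.

Lemma li_around P : around p P -> around (f p) (fun y => V y /\ P (g y)).
Proof.
move=> aP; apply: (around_and gY li_aroundV).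
by apply: mor_around li_mor_g _; rewrite (li_gf l Up).
Qed.

Lemma li_around' P : around (f p) P -> around p (fun x => U x /\ P (f x)).
Proof.
move=> aP; apply: (around_and gX li_aroundU).
exact: mor_around (li_fm l Up) aP.
Qed.

Lemma li_local_equation (Z : set X) (Z' : set Y) e :
  (forall x, U x -> (Z x <-> Z' (f x))) ->
  local_equation Z' (f p) e -> local_equation Z p (e \o f).
Proof.
move=> ZZ [ge ae he]; split.
- exact: (proj2 (li_fm l Up)).
- by apply: around_mono (li_around' ae) => x [Ux h] /(ZZ _ Ux).
move=> h gh ah; have [|a ga aa] := he (h \o g) (li_germ gh).
  apply: around_mono (li_around ah) => y [Vy hy] Z'y /=; apply: hy.
  by apply/ZZ; [exact: (li_g l)|rewrite (li_fg l Vy)].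
exists (a \o f); first exact: (proj2 (li_fm l Up)).
by apply: around_mono (li_around' aa) => x [Ux /=]; rewrite (li_gf l Ux).
Qed.

Lemma li_max_ideal_sqr F : max_ideal_sqr p (F \o f) -> max_ideal_sqr (f p) F.
Proof.
move=> [k [a [b [ha hb ab]]]]; exists k, (fun j => a j \o g), (fun j => b j \o g); split.
- by move=> j; have [ga a0] := ha j; split; [exact: li_germ|rewrite /= (li_gf l Up)].
- by move=> j; have [ga a0] := hb j; split; [exact: li_germ|rewrite /= (li_gf l Up)].
by apply: around_mono (li_around ab) => y [Vy /=]; rewrite (li_fg l Vy).
Qed.

End Transfer.

(** Coordinates are local equations of the coordinate planes, and independent in
  the cotangent space. *)
Lemma transversal_coord X n (f : X -> affine_space R n) g U V (p : X) k
    (Z : 'I_k -> set X) (c : 'I_k -> 'I_n) : good X -> local_iso f g U V -> U p ->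
  injective c -> (forall i, Z i p) ->
  (forall i x, U x -> (Z i x <-> f x 0 (c i) = 0)) -> transversal_at p Z.
Proof.
move=> gX l Up ic Zp hZ; have gA := good_affine R n.
have f0 i : f p 0 (c i) = 0 by apply/hZ.
exists (fun i x => f x 0 (c i)).
  move=> i; apply: (li_local_equation gX gA l Up (hZ i) (e := fun y => y 0 (c i))).
  exact: local_eq_coord.
move=> e /(li_max_ideal_sqr gA l Up (F := fun y => \sum_i e i * y 0 (c i))) H i.
pose e' (j : 'I_n) := \sum_(i | c i == j) e i.
have -> : e i = e' (c i).
  by rewrite /e' (big_pred1 i) // => j; rewrite /= (inj_eq ic).
suff : max_ideal_sqr (f p) (fun x : affine_space R n => \sum_j e' j * (x 0 j - f p 0 j)).
  by move/coord_cotangent.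
move: H; congr max_ideal_sqr; apply/funext => x.
rewrite (partition_big c predT) //=; apply: eq_bigr => j _.
rewrite /e' mulr_suml; apply: eq_bigr => i' /eqP <-.
by rewrite f0 subr0.
Qed.

(** ** Separation *)

(** The expression [F] will be the difference of two functions of a common chart,
  or the product of inverse functions of two charts minus 1. *)
Definition split_points Y (p q : Y) : Prop :=
  exists (U V : set Y) (h k : Y -> C) (F : C -> C -> C),
  [/\ [/\ zopen U, zopen V, U p & V q],
      (forall y, U y -> germ y h), (forall y, V y -> germ y k),
      (forall (Z : space R) (z : Z) (u v : Z -> C), good Z -> germ z u ->
         germ z v -> germ z (fun x => F (u x) (v x))) &
      (forall y, U y -> V y -> F (h y) (k y) = 0) /\ F (h p) (k q) != 0].

(** Two maps differ on a neighbourhood of a point where their values can be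
  told apart by functions, one near each value, that agree where both are
  defined. *)
Lemma separated_points Y : good Y ->
  (forall p q : Y, p <> q -> split_points p q) -> zseparated Y.
Proof.
move=> gY hY Z f g [n [Z0 [_ [phi [rphi [psi [rpsi pk kp]]]]]]] rf rg.
have gZ0 : good (sub_space Z0) by apply: good_sub; exact: good_affine.
suff H : zclosed [set z : sub_space Z0 | f (psi z) = g (psi z)].
  have [o _] := rphi _ H; move: o; rewrite /zclosed.
  congr zopen; apply/seteqP; split => z /=; by rewrite pk.
apply: (openP gZ0) => z /= ne.
have [U [V [h [k [F [[oU oV Up Vq] hh hk hF [e0 e1]]]]]]] := hY _ _ ne.
have mf : mor_at (f \o psi) z by apply: mor_comp; exact: regular_mor.
have mg : mor_at (g \o psi) z by apply: mor_comp; exact: regular_mor.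
have gh := proj2 mf _ (hh _ Up); have gk := proj2 mg _ (hk _ Vq).
have := germ_neq0 gZ0 (hF _ _ _ _ gZ0 gh gk) e1.
have aU := proj1 mf _ oU Up; have aV := proj1 mg _ oV Vq.
apply: (around_mono2 gZ0 _ (around_and gZ0 aU aV)) => x [/= Ux Vx] nz e.
by move: nz; rewrite /= -e e0 ?eqxx // e.
Qed.

Lemma split_sub X (A : set X) (p q : sub_space A) : good X ->
  split_points (sval p) (sval q) -> split_points p q.
Proof.
move=> gX [U [V [h [k [F [[oU oV Up Vq] hh hk hF [e0 e1]]]]]]].
have es := emb_sval A gX.
exists (sval @^-1` U), (sval @^-1` V), (h \o sval), (k \o sval), F; split => //.
- by split => //; exact: (emb_openr es).
- by move=> y Uy; apply: (emb_germr es); exact: hh.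
- by move=> y Uy; apply: (emb_germr es); exact: hk.
- by split => // y; exact: e0.
Qed.

End LocalIso.

Section ToricVariety.
Variable R : realType.
Local Notation S := (@e8fan R).
Local Notation X := (toric_variety S).
Local Notation chart t := (toric_chart (cof (gen t) predT) : set X).
Implicit Types (x y : X) (m : N).

Lemma orb_in_chart x t (a : pred 'I_3) : t \in tris ->
  (forall w, orb x w -> cof (gen t) a w) -> toric_chart (cof (gen t) a) x.
Proof. by move=> tt h; apply: chart_of_sub (e8fan_cof R a tt) _. Qed.

Lemma max_chart x : exists2 t, t \in tris & chart t x.
Proof.
have [t [a [tt e]]] := orb_fan x; exists t => //; apply: orb_in_chart => // w.
by rewrite e; exact: cof_mono.
Qed.

(** A separating character of two maximal cones is invertible on the intersection
  of their charts.  If its value at one point is not inverse to the value of its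
  inverse at the other then the points are separated; else both points lie in
  one chart, where some coordinate separates them. *)
Lemma toric_split x y : x <> y -> split_points x y.
Proof.
move=> xy; have [t tt xt] := max_chart x; have [t' tt' yt'] := max_chart y.
have St := e8fan_cof R predT tt; have St' := e8fan_cof R predT tt'.
have [m [hm hm' hm0]] := tri_sep predT predT tt tt'.
have dm : @dual_lattice R (cof (gen t) predT) m by apply/dual_cof => k; exact: hm.
have dm' : @dual_lattice R (cof (gen t') predT) (- m).
  by apply/dual_cof => k _; rewrite prN oppr_ge0 hm'.
have pm z : chart t z -> chart t' z -> perp (orb z) m.
  move=> zt zt' w ow; have w1 := chart_sub St zt ow; have w2 := chart_sub St' zt' ow.
  apply/eqP; rewrite eq_le dm // andbT -oppr_ge0.
  by have := dm' _ w2; rewrite latN dotC dotNr dotC.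
have [h1|h1] := eqVneq (chr x m * chr y (- m)) 1; last first.
  exists (chart t), (chart t'), (fun z => chr z m), (fun z => chr z (- m)), (fun u v => u * v - 1).
  split.
  - by split => //; exact: chart_open.
  - by move=> z zt; exact: chr_germ St zt dm.
  - by move=> z zt; exact: chr_germ St' zt dm'.
  - move=> Z z u v gZ gu gv; apply: germB => //; [exact: germM|exact: germ_cst].
  - split; last by rewrite subr_eq0.
    by move=> z zt zt'; rewrite -chr_perpD ?subrr ?chr0 ?subrr //; exact: pm.
have px : perp (orb x) m.
  by apply/chr_neq0; apply: contra_eq_neq h1 => ->; rewrite mul0r eq_sym oner_eq0.
have xt' : chart t' x.
  apply: orb_in_chart => // w ow.
  exact: (cof_common hm hm0 (chart_sub St xt ow) (px _ ow)).
have [k nk] : exists k, chr x (dgen t' k) <> chr y (dgen t' k).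
  apply: contrapT => /forallNP h; apply: xy.
  apply: (chart_uniq (tri_dual tt') xt' yt'); apply/rowP => k; rewrite !mxE.
  exact: contrapT (h k).
have dk : @dual_lattice R (cof (gen t') predT) (dgen t' k) by apply: dual_coord; exact: tri_dual.
exists (chart t'), (chart t'), (fun z => chr z (dgen t' k)), (fun z => chr z (dgen t' k)), (fun u v => u - v).
split.
- by split => //; exact: chart_open.
- by move=> z zt; exact: chr_germ St' zt dk.
- by move=> z zt; exact: chr_germ St' zt dk.
- by move=> Z z u v gZ; exact: germB.
- by split; [move=> z _ _; rewrite subrr|rewrite subr_eq0; exact/eqP].
Qed.

Lemma closed_variety (A : set X) : zclosed A -> variety (sub_space A).
Proof.
move=> cA; have gX := @good_toric R; have gS := good_sub A gX; split.
- by split; [exact: goodT|exact: goodI|exact: goodU].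
- move=> U g oU; split; last exact: good_loc.
  by move=> rg x Ux; exists U, g.
- exists (size tris), (fun i => trace (chart (nth (head ((0,0,0),(0,0,0),(0,0,0)) tris) tris i))).
  split; last first.
    apply/seteqP; split => // x _; have [t tt xt] := max_chart (sval x).
    have it : (index t tris < size tris)%N by rewrite index_mem.
    by exists (Ordinal it) => //; rewrite /trace /= nth_index.
  move=> i; set t := nth _ _ _; have tt : t \in tris by apply: mem_nth.
  have St := e8fan_cof R predT tt.
  split; first by exists (chart t) => //; exact: chart_open.
  have [par l] := chart_iso (tri_dual tt) St.
  have WT z : chart_image (R := R) predT z by move=> k.
  exists 3%N, [set z | A (par z)]; split.
    apply: (openP (good_affine R 3)) => z nA.
    exact: (proj1 (li_gm l (WT z)) _ cA nA).
  pose B := [set z | A (par z)].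
  have [phi [iphi _]] : exists phi : sub_space (trace (chart t) : set (sub_space A)) ->
      sub_space B, isomorphism phi /\
      forall y : sub_space (trace (chart t) : set (sub_space A)),
        sval (phi y) = coords (dgen t) (sval (sval y)).
    have gV := good_sub B (good_affine R 3).
    have e2 := emb_sval B (good_affine R 3).
    have H := emb_iso (A := A) (B := B) (good_sub _ gS) gV (emb_sub_sub _ gX) e2 l; apply: H => //.
    + by case=> -[x Ax] xt.
    + by move=> x [xt Ax]; exists (exist _ (exist _ x Ax) xt).
    + by case=> z Az; split.
    + by move=> z [_ Az]; exists (exist _ z Az).
    + by move=> x xt; rewrite /B /= (li_gf l xt).
  by exists phi.
- apply: separated_points => // p q pq; apply: split_sub => //; apply: toric_split => e.
  exact: pq (emb_inj (emb_sval A gX) e).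
Qed.

End ToricVariety.

(** * The classical topology *)

Section Classical.
Variable R : realType.
Local Notation C := R[i].
Implicit Types X Y : space R.

Lemma small_pos (F : numFieldType) (I : finType) (d : I -> F) : (forall i, 0 < d i) ->
  exists2 e, 0 < e & forall i, e <= d i.
Proof.
move=> d0; have s0 : 0 <= \sum_i (d i)^-1.
  by apply: sumr_ge0 => i _; rewrite invr_ge0 ltW.
exists (1 + \sum_i (d i)^-1)^-1; first by rewrite invr_gt0 ltr_pwDl.
move=> i; rewrite -[leRHS]invrK lef_pV2 ?posrE ?invr_gt0 //; last by rewrite ltr_pwDl.
rewrite (bigD1 i) //= addrCA lerDl addr_ge0 // sumr_ge0 // => j _.
by rewrite invr_ge0 ltW.
Qed.

Lemma classical_openP X (A : set X) : (forall x, A x -> exists2 B : set X,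
    classical_open B /\ B x & B `<=` A) -> classical_open A.
Proof.
move=> h x Ax; have [B [oB Bx] BA] := h _ Ax.
have [V [k [g [e [oV Vx rg e0 hV]]]]] := oB _ Bx.
by exists V, k, g, e; split => // y Vy /(hV y Vy) /BA.
Qed.

Lemma zopen_classical X (U : set X) : zopen U -> classical_open U.
Proof.
move=> oU x Ux; exists U, 0%N, (fun _ _ => 0), 1; split => //.
by case.
Qed.

Lemma classical_preimage X Y (f : X -> Y) A : regular_map f -> classical_open A ->
  classical_open (f @^-1` A).
Proof.
move=> rf oA x Ax; have [V [k [g [e [oV Vx rg e0 hV]]]]] := oA _ Ax.
exists (f @^-1` V), k, (fun i => g i \o f), e; split => //.
- by case: (rf _ oV).
- by move=> i; apply: (proj2 (rf _ oV)).
- by move=> y Vy hy; exact: hV.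
Qed.

Lemma compact_image X Y (f : X -> Y) K : regular_map f -> classical_compact K ->
  classical_compact (f @` K).
Proof.
move=> rf cK I U oU KU.
have [||k [s hs]] := cK I (fun i => f @^-1` U i).
- by move=> i; exact: classical_preimage.
- by move=> x Kx; have [|i _ Ui] := KU (f x); [exists x|exists i].
by exists k, s => _ [x Kx <-]; have [i _ Ui] := hs _ Kx; exists i.
Qed.

Lemma compact_closed X (K F : set X) : classical_compact K -> classical_open (~` F) ->
  classical_compact (K `&` F).
Proof.
move=> cK oF I U oU KU.
have [||k [s hs]] := cK (option I) (fun o => if o is Some i then U i else ~` F).
- by case.
- move=> x Kx; have [Fx|nF] := pselect (F x); last by exists None.
  by have [i _ Ui] := KU x (conj Kx Fx); exists (Some i).
have [[i0]|ni] := pselect (inhabited I); last first.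
  have s0 : 'I_0 -> I by case.
  exists 0%N, s0 => x KFx; case: ni.
  by have [i _ _] := KU x KFx; exists.
exists k, (fun j => odflt i0 (s j)) => x [Kx Fx].
have [j _] := hs _ Kx; case e: (s j) => [i|] h //.
by exists j => //; rewrite e.
Qed.

Lemma compact_bigU X (T : eqType) (r : seq T) (K : T -> set X) :
  (forall t, t \in r -> classical_compact (K t)) ->
  classical_compact [set x | exists2 t, t \in r & K t x].
Proof.
elim: r => [|t r IH] h I U oU KU.
  have s0 : 'I_0 -> I by case.
  by exists 0%N, s0 => x [].
have [|k1 [s1 h1]] := h t (mem_head _ _) I U oU.
  by move=> x Kx; apply: KU; exists t => //; exact: mem_head.
have hr t' : t' \in r -> classical_compact (K t').
  by move=> tr; apply: h; rewrite in_cons tr orbT.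
have [|k2 [s2 h2]] := IH hr I U oU.
  by move=> x [t' tr Kx]; apply: KU; exists t' => //; rewrite in_cons tr orbT.
exists (k1 + k2)%N, (fun j => match fintype.split j with inl i => s1 i | inr i => s2 i end).
move=> x [t']; rewrite in_cons => /orP[/eqP -> /h1 [j _ Uj]|tr Kx].
  by exists (lshift k2 j) => //=; have -> := unsplitK (inl j : 'I_k1 + 'I_k2).
have [|j _ Uj] := h2 x; first by exists t'.
by exists (rshift k1 j) => //=; have -> := unsplitK (inr j : 'I_k1 + 'I_k2).
Qed.

Lemma basic_open X (V : set X) k (g : 'I_k -> X -> C) (c : 'I_k -> C) (e : C) :
  zopen V -> (forall i, regular V (g i)) ->
  classical_open [set y | V y /\ forall i, `|g i y - c i| < e].
Proof.
move=> oV rg y [Vy hy].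
have [|d d0 hd] := @small_pos C 'I_k (fun i => e - `|g i y - c i|).
  by move=> i; rewrite subr_gt0.
exists V, k, g, d; split => // z Vz hz; split => // i.
have -> : g i z - c i = (g i z - g i y) + (g i y - c i) by ring.
apply: le_lt_trans (ler_normD _ _) _.
by rewrite -ltrBrDr; apply: lt_le_trans (hz i) (hd i).
Qed.

(** The classical topology of a subspace is the induced one: a basic
  neighbourhood extends, since finitely many germs extend to a common open
  set, and balls are classically open by the triangle inequality. *)
Lemma classical_extend X (A : set X) (B : set (sub_space A)) : good X ->
  classical_open B -> exists2 B' : set X, classical_open B' & B = sval @^-1` B'.
Proof.
move=> gX oB.
pose B' := \bigcup_(W in [set W : set X | classical_open W /\ sval @^-1` W `<=` B]) W.
exists B'.
  by apply: classical_openP => x [W [oW WB] Wx]; exists W => // y Wy; exists W.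
apply/seteqP; split => [x Bx|x [W [_ WB] Wx]]; last exact: WB.
have [V [k [g [e [[V0 oV0 eV] Vx rg e0 hV]]]]] := oB _ Bx.
have /choice [h hh] : forall i, exists h : X -> C, germ (sval x) h /\
    around (sval x) (fun z => forall y : sub_space A, sval y = z -> V y -> g i y = h z).
  move=> i; have [W [h [oW Wx rh eh]]] := rg i _ Vx; exists h; split.
    by exists W.
  by exists W; split => // z Wz y yz Vy; rewrite -yz eh // yz.
have [W [oW Wx hW]] := around_and gX
  (around_forall gX (fun i => germ_around (proj1 (hh i))))
  (around_forall gX (fun i => proj2 (hh i))).
have oVW : zopen (V0 `&` W) by exact: goodI.
exists [set y | (V0 `&` W) y /\ forall i, `|h i y - h i (sval x)| < e].
  split; first apply: basic_open => //.
    move=> i; apply: (regular_germ gX) => // y [_ Wy].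
    by case: (hW _ Wy) => /(_ i).
  move=> y [[V0y Wy] hy]; apply: hV => [|i]; first by rewrite eV.
  have hi z : W (sval z) -> V z -> g i z = h i (sval z).
    by move=> Wz Vz; case: (hW _ Wz) => _ /(_ i z erefl Vz).
  by rewrite !hi // eV.
have V0x : V0 (sval x) by rewrite eV in Vx.
by split => // i; rewrite subrr normr0.
Qed.

Lemma compact_trace X (A K : set X) : good X -> zclosed A -> classical_compact K ->
  classical_compact (trace K : set (sub_space A)).
Proof.
move=> gX cA cK I U oU KU.
have /choice [U' hU'] : forall i, exists U' : set X, classical_open U' /\ U i = sval @^-1` U'.
  by move=> i; have [U' oU' e] := classical_extend gX (oU i); exists U'.
have cKA := compact_closed cK (zopen_classical cA).
have [||k [s hs]] := cKA I U'.
- by move=> i; case: (hU' i).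
- move=> x [Kx Ax]; have [|i _ Ui] := KU (exist _ x Ax); first exact: Kx.
  by exists i => //; move: Ui; rewrite (proj2 (hU' i)).
exists k, s => x Kx; have [|j _ Uj] := hs (sval x); first by split => //; exact: (svalP x).
by exists j => //; rewrite (proj2 (hU' _)).
Qed.

Section Affine.
Variable n : nat.
Local Notation A := (affine_space R n).

(** Continuity of complex functions, with bounds in the complex numbers as in the
  definition of the classical topology. *)
Definition ccont (t : A) (h : A -> C) := forall e, 0 < e -> exists2 d, 0 < d &
  forall t' : A, (forall k, `|t' 0 k - t 0 k| < d) -> `|h t' - h t| < e.

Lemma ccont_cst t c : ccont t (fun=> c).
Proof. by move=> e e0; exists 1 => // t' _; rewrite subrr normr0. Qed.

Lemma ccont2 t h k e e' : ccont t h -> ccont t k -> 0 < e -> 0 < e' ->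
  exists2 d, 0 < d & forall t' : A, (forall k, `|t' 0 k - t 0 k| < d) ->
    `|h t' - h t| < e /\ `|k t' - k t| < e'.
Proof.
move=> ch ck e0 e0'; have [d d0 hd] := ch _ e0; have [d' d0' hd'] := ck _ e0'.
have [|m m0 hm] := @small_pos C bool (fun b => if b then d else d'); first by case.
exists m => // t' ht; split; [apply: hd|apply: hd'] => i; apply: lt_le_trans (ht i) _.
  exact: (hm true).
exact: (hm false).
Qed.

Lemma ccontD t h k : ccont t h -> ccont t k -> ccont t (fun x => h x + k x).
Proof.
move=> ch ck e e0; have e2 : 0 < e / 2%:R by rewrite divr_gt0.
have [d d0 hd] := ccont2 ch ck e2 e2; exists d => // t' /hd [h1 h2].
have -> : h t' + k t' - (h t + k t) = (h t' - h t) + (k t' - k t) by ring.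
apply: le_lt_trans (ler_normD _ _) _.
by have := ltrD h1 h2; rewrite -mulrDl -mulr2n -(mulr_natr e) mulfK ?pnatr_eq0.
Qed.

Lemma ccontM t h k : ccont t h -> ccont t k -> ccont t (fun x => h x * k x).
Proof.
move=> ch ck e e0; pose K := 1 + `|h t| + `|k t|.
have K0 : 0 < K by rewrite /K -addrA ltr_pwDl ?addr_ge0.
pose m := e / (K + e); have Ke : 0 < K + e by rewrite addr_gt0.
have m0 : 0 < m by rewrite divr_gt0.
have m1 : m < 1 by rewrite ltr_pdivrMr // mul1r ltrDr.
have [d d0 hd] := ccont2 ch ck m0 m0; exists d => // t' /hd [h1 h2].
have -> : h t' * k t' - h t * k t =
  (h t' - h t) * (k t' - k t) + (h t' - h t) * k t + h t * (k t' - k t) by ring.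
apply: le_lt_trans (ler_normD _ _) _; rewrite normrM.
apply: le_lt_trans (lerD (ler_normD _ _) (lexx _)) _; rewrite !normrM.
apply: (@le_lt_trans _ _ (m * K)); last first.
  by rewrite /m mulrAC ltr_pdivrMr // ltr_pM2l // ltrDl.
rewrite /K !mulrDr mulr1 [m * `|h t|]mulrC -!addrA [X in _ <= m + X]addrC !addrA.
apply: lerD; last by rewrite ler_wpM2l // ltW.
apply: lerD; last by rewrite ler_wpM2r // ltW.
apply: (le_trans (y := m * 1)); last by rewrite mulr1.
by apply: ler_pM => //; [exact: ltW|apply: ltW; exact: lt_trans h2 m1].
Qed.

Lemma ccontV t h : ccont t h -> h t != 0 -> ccont t (fun x => (h x)^-1).
Proof.
move=> ch h0 e e0; pose a := `|h t|; have a0 : 0 < a by rewrite normr_gt0.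
have ea : 0 < 1 + e * a by rewrite addr_gt0 // mulr_gt0.
pose m := e * a ^+ 2 / (1 + e * a).
have m0 : 0 < m by rewrite divr_gt0 // mulr_gt0 // exprn_gt0.
have [d d0 hd] := ch _ m0; exists d => // t' /hd h1.
have ma : m < a.
  by rewrite /m ltr_pdivrMr // expr2 mulrA mulrDr mulr1 [a * _]mulrC ltrDr.
have am : a - m <= `|h t'|.
  rewrite lerBlDl; have -> : a = `|(h t - h t') + h t'| by rewrite subrK.
  apply: le_trans (ler_normD _ _) _; rewrite lerD2r distrC; exact: ltW.
have t'0 : 0 < `|h t'| by apply: lt_le_trans am; rewrite subr_gt0.
have ht' : h t' != 0 by rewrite -normr_gt0.
have -> : (h t')^-1 - (h t)^-1 = (h t - h t') / (h t' * h t).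
  by field; rewrite h0 ht'.
rewrite normrM normfV normrM -/a distrC ltr_pdivrMr ?mulr_gt0 //.
apply: lt_le_trans h1 _; apply: (le_trans (y := e * ((a - m) * a))); last first.
  by rewrite ler_pM2l // ler_pM2r.
suff e1 : m = e * ((a - m) * a) by rewrite [leLHS]e1.
rewrite /m; field.
by rewrite gt_eqF.
Qed.

Lemma ccont_eval t Q : ccont t (eval Q).
Proof.
elim/eval_ind: Q => [c|i|P Q|P Q].
- by rewrite (_ : eval _ = fun=> c); [exact: ccont_cst|apply/funext => x; rewrite evalC].
- by move=> e e0; exists e => // t' h; rewrite !evalX.
- by move=> h k; rewrite (_ : eval _ = fun x => eval P x + eval Q x);
    [exact: ccontD|apply/funext => x; rewrite evalD].
- by move=> h k; rewrite (_ : eval _ = fun x => eval P x * eval Q x);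
    [exact: ccontM|apply/funext => x; rewrite evalM].
Qed.

Lemma ccont_neq0 t h : ccont t h -> h t != 0 -> exists2 d, 0 < d &
  forall t' : A, (forall k, `|t' 0 k - t 0 k| < d) -> h t' != 0.
Proof.
move=> ch; rewrite -normr_gt0 => h0; have [d d0 hd] := ch _ h0; exists d => // t' /hd.
by apply: contraTneq => ->; rewrite sub0r normrN ltxx.
Qed.

(** Rational functions are continuous where their denominators do not vanish. *)
Lemma classical_ball (B : set A) t : classical_open B -> B t -> exists2 d, 0 < d &
  forall t' : A, (forall k, `|t' 0 k - t 0 k| < d) -> B t'.
Proof.
move=> oB Bt; have [V [k [g [e [oV Vt rg e0 hV]]]]] := oB _ Bt.
have [Q Qt hQ] := affine_open oV Vt.
have [d0 d00 hd0] := ccont_neq0 (ccont_eval t Q) Qt.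
have /choice [d hd] : forall i, exists d, 0 < d /\ forall t' : A,
    (forall k, `|t' 0 k - t 0 k| < d) -> V t' -> `|g i t' - g i t| < e.
  move=> i; have [P [Q' [Q't eg]]] := rg i _ Vt.
  have [d d0' hd] := ccontM (ccont_eval t P) (ccontV (ccont_eval t Q') Q't) e0.
  have [d' d0'' hd'] := ccont_neq0 (ccont_eval t Q') Q't.
  have [|m m0 hm] := @small_pos C bool (fun b => if b then d else d'); first by case.
  exists m; split => // t' ht Vt'.
  rewrite !eg //; first by apply: hd => j; apply: lt_le_trans (ht j) (hm true).
  by apply: hd' => j; apply: lt_le_trans (ht j) (hm false).
have [|m m0 hm] := @small_pos C (option 'I_k) (fun o => if o is Some i then d i else d0).
  by case => [i|//]; case: (hd i).
exists m => // t' ht.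
have Vt' : V t' by apply: hQ; apply: hd0 => j; apply: lt_le_trans (ht j) (hm None).
apply: hV => // i; apply: (proj2 (hd i)) => // j.
exact: lt_le_trans (ht j) (hm (Some i)).
Qed.

End Affine.
End Classical.

Section Polydisc.
Variable R : realType.
Local Notation C := R[i].
Variable n : nat.
Local Notation A := (affine_space R n).

Definition of_real (v : 'rV[R]_(n + n)) : A :=
  \row_k (v 0 (lshift n k) +i* v 0 (rshift n k)).

Lemma norm_complex_lt (a b : R) e : `|a| < e -> `|b| < e -> `|a +i* b| < (e + e)%:C.
Proof.
move=> ha hb; have -> : a +i* b = a%:C + 'i%C * b%:C.
  by rewrite [LHS]complexE.
apply: le_lt_trans (ler_normD _ _) _; rewrite normrM.
have -> : `|'i%C| = 1 :> C by rewrite normc_def /= expr0n expr1n add0r sqrtr1.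
have e2 (r : R) : `|r%:C| = `|r|%:C by rewrite normc_def /= expr0n addr0 sqrtr_sqr.
by rewrite mul1r !e2 -rmorphD ltcR ltrD.
Qed.

Definition polydisc (M : R) : set A :=
  [set t | forall k, `|complex.Re (t 0 k)| <= M /\ `|complex.Im (t 0 k)| <= M].

(** Real and imaginary parts identify a polydisc with a product of segments. *)
Lemma polydisc_compact (M : R) : classical_compact (polydisc M).
Proof.
move=> I U oU cov.
pose K : set 'rV[R]_(n + n) := [set v | forall i, `[- M, M]%classic (v ord0 i)].
have cK : compact K.
  apply: (@matrix_normedtype.rV_compact R (n + n) (fun=> `[- M, M]%classic)) => _.
  exact: normed_module.segment_compact.
have Kbox v : K v -> polydisc M (of_real v).
  move=> Kv k; rewrite !mxE /= !ler_norml.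
  by split; [have := Kv (lshift n k)|have := Kv (rshift n k)]; rewrite /= in_itv.
have boxK t : polydisc M t -> exists2 v, K v & of_real v = t.
  move=> bt; exists (\row_i match fintype.split i with
      inl k => complex.Re (t 0 k) | inr k => complex.Im (t 0 k) end).
    move=> i; rewrite mxE /= in_itv /= -ler_norml.
    by case: (fintype.split i) => k; case: (bt k).
  apply/rowP => k; rewrite !mxE.
  have -> := unsplitK (inl k : 'I_n + 'I_n); have -> := unsplitK (inr k : 'I_n + 'I_n).
  by case: (t 0 k).
have [[i0]|ni] := pselect (inhabited I); last first.
  have s0 : 'I_0 -> I by case.
  by exists 0%N, s0 => x Dx; case: ni; have [i _ _] := cov x Dx; exists.
have /choice [f hf] : forall v, exists i, K v -> U i (of_real v).
  move=> v; have [Kv|nK] := pselect (K v); last by exists i0.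
  by have [i _ Ui] := cov _ (Kbox _ Kv); exists i.
pose O v := interior (of_real @^-1` (U (f v))).
have oO v : open (O v) by exact: open_interior.
have nO v : K v -> O v v.
  move=> /hf Uv; have [d d0 hd] := classical_ball (oU (f v)) Uv.
  have dR : (complex.Re d)%:C = d by apply: RRe_real; rewrite realE ltW.
  have d0' : 0 < complex.Re d by rewrite -ltcR dR.
  apply/nbhs_ballP; exists (complex.Re d / 2%:R) => /=; first by rewrite divr_gt0.
  move=> w [_ hw]; apply: hd => k; rewrite !mxE.
  have -> : d = (complex.Re d / 2%:R + complex.Re d / 2%:R)%:C.
    by rewrite -splitr dR.
  have := norm_complex_lt (hw 0 (lshift n k)) (hw 0 (rshift n k)).
  by rewrite -normrN; congr (`|_| < _); apply/eqP; rewrite eq_complex /= !opprB !eqxx.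
have := cK; rewrite compact_cover => /(_ _ K O) [|v Kv|F FK covF].
- by move=> v _; exact: oO.
- by exists v => //; exact: nO.
exists (size (finmap.enum_fset F)), (fun j => f (nth 0 (finmap.enum_fset F) j)) => t /boxK [v Kv <-].
have [w wF wv] := covF _ Kv.
have jw : (index w (finmap.enum_fset F) < size (finmap.enum_fset F))%N by rewrite index_mem.
exists (Ordinal jw) => //=; rewrite nth_index //.
exact: (interior_subset wv).
Qed.

Lemma norm_nat_bound (z : C) : exists m : nat, `|z| < m%:R.
Proof.
pose r := complex.Re `|z|; have e : `|z| = r%:C by rewrite RRe_real ?normr_real.
have r0 : 0 <= r by rewrite -(lecR 0) -e normr_ge0.
exists (Num.bound r); rewrite e.
have -> : (Num.bound r)%:R = (Num.bound r)%:R%:C :> C by rewrite rmorph_nat.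
by rewrite ltcR archi_boundP.
Qed.

Lemma dist_open (y : A) (c : C) :
  classical_open [set t : A | \sum_k `|t 0 k - y 0 k| < c].
Proof.
move=> t /= ht; exists setT, n, (fun k (x : A) => x 0 k), ((c - \sum_k `|t 0 k - y 0 k|) / n.+1%:R).
have gA := good_affine R n; have oT := goodT gA.
split => //.
- by move=> k; apply: (regular_germ gA) => // p _; exact: coord_germ.
- by rewrite divr_gt0 ?subr_gt0 // ltr0n.
move=> z _ hz /=; set e := _ / _ in hz.
apply: (@le_lt_trans _ _ (\sum_k (`|z 0 k - t 0 k| + `|t 0 k - y 0 k|))).
  by apply: ler_sum => k _; rewrite -[X in `|X| <= _](subrKA (t 0 k)) ler_normD.
rewrite big_split /= -ltrBrDr.
apply: (@le_lt_trans _ _ (\sum_(k < n) e)); first by apply: ler_sum => k _; exact: ltW.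
rewrite sumr_const card_ord -mulr_natr /e mulrAC ltr_pdivrMr ?ltr0n //.
by rewrite ltr_pM2l ?subr_gt0 // ltr_nat.
Qed.

Lemma compact_bounded (K : set A) : classical_compact K ->
  exists m : nat, forall t, K t -> forall k, `|t 0 k| <= m%:R.
Proof.
move=> cK; have [||k [s hs]] := cK nat (fun m => [set t : A | \sum_k `|t 0 k - (0 : 'rV[C]_n) 0 k| < m%:R]).
- by move=> m; exact: dist_open.
- move=> t _; have [m hm] := norm_nat_bound (\sum_k `|t 0 k|); exists m => //=.
  apply: le_lt_trans hm; rewrite ger0_norm ?sumr_ge0 // ler_sum // => i _.
  by rewrite mxE subr0.
exists (\sum_j s j)%N => t Kt i; have [j _ /= hj] := hs _ Kt.
apply: le_trans (le_trans (ltW hj) _); last by rewrite ler_nat (bigD1 j) //= leq_addr.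
by rewrite (bigD1 i) //= mxE subr0 lerDl sumr_ge0.
Qed.

Lemma dist_eq0 (t y : A) : \sum_k `|t 0 k - y 0 k| = 0 -> t = y.
Proof.
move=> /eqP; rewrite psumr_eq0 // => /allP h; apply/rowP => k.
have /eqP/eqP := h k (mem_index_enum _).
by rewrite normr_eq0 subr_eq0 => /eqP.
Qed.

(** A compact set that misses a point stays away from it: the sets of the points
  at distance more than 1/m cover it. *)
Lemma compact_compl (K : set A) : classical_compact K -> classical_open (~` K).
Proof.
move=> cK y nK.
pose far m : set A := [set t | 1 < m%:R * \sum_k `|t 0 k - y 0 k|].
have of_ m : classical_open (far m).
  move=> t /= ht; have m0 : (0 < m)%N by rewrite lt0n; apply: contraTneq ht => ->; rewrite mul0r ltr10.
  have mC : 0 < m%:R :> C by rewrite ltr0n.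
  pose e : C := (\sum_k `|t 0 k - y 0 k| - m%:R^-1).
  have e0 : 0 < e by rewrite subr_gt0 -[_^-1]mulr1 ltr_pdivrMl.
  have te : [set z : A | \sum_k `|z 0 k - t 0 k| < e] t.
    by rewrite /= big1 // => k _; rewrite subrr normr0.
  have [V [k [g [d [oV Vt rg d0 hV]]]]] := dist_open te.
  exists V, k, g, d; split => // z Vz hz; have := hV z Vz hz => /= h.
  rewrite /far /= -ltr_pdivrMl // mulr1.
  have : \sum_k `|t 0 k - y 0 k| <= \sum_k `|z 0 k - t 0 k| + \sum_k `|z 0 k - y 0 k|.
    rewrite -big_split; apply: ler_sum => j _; rewrite /= (distrC (z 0 j) (t 0 j)).
    have -> : t 0 j - y 0 j = (t 0 j - z 0 j) + (z 0 j - y 0 j) by ring.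
    exact: ler_normD.
  by move: h; rewrite /e ltrBrDr => h h2; have := lt_le_trans h h2; rewrite ltrD2l.
have [||k [s hs]] := cK nat far.
- exact: of_.
- move=> t Kt; have d0 : 0 < \sum_k `|t 0 k - y 0 k|.
    rewrite lt_neqAle sumr_ge0 // andbT eq_sym; apply/eqP => /dist_eq0 e.
    by apply: nK; rewrite -e.
  have [m hm] := norm_nat_bound (\sum_k `|t 0 k - y 0 k|)^-1; exists m => //=.
  by rewrite /far /= -ltr_pdivrMr // mul1r; apply: le_lt_trans hm; rewrite ger0_norm // invr_ge0 ltW.
pose m := (\sum_j s j).+1.
have mC : 0 < m%:R :> C by rewrite ltr0n.
have ye : [set z : A | \sum_k `|z 0 k - y 0 k| < m%:R^-1] y.
  by rewrite /= big1 ?invr_gt0 // => j _; rewrite subrr normr0.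
have [V [l [g [d [oV Vt rg d0 hV]]]]] := dist_open ye.
exists V, l, g, d; split => // z Vz hz Kz; have /= h := hV z Vz hz.
have [j _ /= hj] := hs _ Kz.
have : 1 < m%:R * \sum_k `|z 0 k - y 0 k|.
  apply: lt_le_trans hj _; rewrite ler_wpM2r ?sumr_ge0 // ler_nat /m (bigD1 j) //=.
  by rewrite ltnW // ltnS leq_addr.
by rewrite -ltr_pdivrMl // mulr1 => /lt_trans /(_ h); rewrite ltxx.
Qed.

End Polydisc.

(** * Properness of the toric morphism *)

Section Proper.
Variable R : realType.
Local Notation C := R[i].
Local Notation S := (@e8fan R).
Local Notation X := (toric_variety S).
Local Notation chart t := (toric_chart (cof (gen t) predT) : set X).
Local Notation A3 := (affine_space R 3).
Local Notation pi := (toric_morphism S).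
Implicit Types (x y : X) (m : N).

Lemma dual_nonneg s m : S s -> (forall i, 0 <= m 0 i) -> @dual_lattice R s m.
Proof.
move=> [t [a [tt ->]]] h; apply/dual_cof => k _; apply: sumr_ge0 => i _.
by rewrite mulr_ge0 // tri_orth.
Qed.

Lemma delta_ge0 (i j : 'I_3) : 0 <= (delta_mx 0 i : N) 0 j.
Proof. by rewrite mxE; case: (_ && _). Qed.

Lemma toric_morphism_mor x : mor_at (pi : X -> A3) x.
Proof.
apply: (mor_affine (@good_toric R)) => i.
have := chr_germ (orb_fan x) (chart_self x) (dual_nonneg (orb_fan x) (delta_ge0 i)).
by congr germ; apply/funext => y; rewrite mxE.
Qed.

Lemma toric_morphism_regular : regular_map (pi : X -> A3).
Proof. by apply: mor_regular; [exact: good_toric|exact: toric_morphism_mor]. Qed.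

Lemma chr_nonneg x m : (forall i, 0 <= m 0 i) ->
  chr x m = \prod_i chr x (delta_mx 0 i) ^+ absz (m 0 i).
Proof.
move=> m0; have Ss := orb_fan x; have xs := chart_self x.
have dd i n : @dual_lattice R (orb x) (delta_mx 0 i *+ n).
  by apply: dual_nonneg => // j; rewrite mulmxnE mulrn_wge0 // delta_ge0.
have cX i n : chr x (delta_mx 0 i *+ n) = chr x (delta_mx 0 i) ^+ n.
  elim: n => [|n IH]; first by rewrite chr0.
  by rewrite mulrS exprS (chrM Ss xs (dd i 1%N)) ?IH //; exact: dd.
have e : m = \sum_i delta_mx 0 i *+ absz (m 0 i).
  apply/rowP => j; rewrite summxE (bigD1 j) //= big1 ?addr0.
    by rewrite mulmxnE mxE !eqxx mulr1n [RHS]natz gez0_abs.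
  by move=> i ij; rewrite mulmxnE mxE eq_sym (negPf ij) andbF mul0rn.
have H (r : seq 'I_3) : @dual_lattice R (orb x) (\sum_(i <- r) delta_mx 0 i *+ absz (m 0 i)) /\
    chr x (\sum_(i <- r) delta_mx 0 i *+ absz (m 0 i)) =
    \prod_(i <- r) chr x (delta_mx 0 i) ^+ absz (m 0 i).
  elim: r => [|i r [IH1 IH2]]; first by rewrite !big_nil chr0; split => //; exact: dual0.
  rewrite !big_cons (chrM Ss xs) // ?IH2 ?cX; split => //; exact: dualD.
by rewrite [in LHS]e (proj2 (H _)).
Qed.

(** On a bounded set this bounds a monomial in x, y, z whose exponents are the
  coefficients of the k-th coordinate character. *)
Definition coord_bound (M : C) (t : simplex) (k : 'I_3) : C :=
  M ^+ (\sum_i absz (dgen t k 0%R i))%N.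

(** The linear pieces of the convex function agree on a common face. *)
Lemma lin_perp x t t' : t \in tris -> t' \in tris -> chart t x -> chart t' x ->
  perp (orb x) (lin t - lin t').
Proof.
move=> tt tt' xt xt' w ow.
have w1 := chart_sub (e8fan_cof R predT tt) xt ow.
have w2 := chart_sub (e8fan_cof R predT tt') xt' ow.
have : (@cof R (gen t) predT `&` cof (gen t') predT) w by [].
rewrite tri_inter // => -[c [hc ->]]; rewrite dot_comb big1 // => k _.
case: (boolP (predT k && [exists j, predT j && (gen t k == gen t' j)])) => [|/(proj2 (hc k)) ->].
  move=> /existsP [j /eqP e]; rewrite dot_lat prB.
  have [l1 _] := tri_conv j tt tt'; have [l2 _] := tri_conv k tt' tt.
  rewrite e in l2 *; have -> : pr (lin t) (gen t' j) = pr (lin t') (gen t' j).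
    by apply/eqP; rewrite eq_le l1 l2.
  by rewrite subrr mulr0.
by rewrite mul0r.
Qed.

(** A point over a bounded set has bounded coordinates in some chart.  Among
  the maximal cones containing its cone, choose the one for which the
  character of the interpolating linear function has the smallest modulus:
  a coordinate larger than 1 would allow to cross a wall, and if the wall
  lies in the boundary the coordinate is a monomial in x, y, z. *)
Lemma toric_bounded (M : C) x : 1 <= M -> (forall i, `|pi x 0 i| <= M) ->
  exists t, [/\ t \in tris, chart t x &
    forall k, `|chr x (dgen t k)| <= coord_bound M t k].
Proof.
move=> M1 hM; have [t0 tt0 xt0] := max_chart x.
pose f t : R := - complex.Re `|chr x (lin t - lin t0)|.
have [|t [tt /asboolP xt hmax]] := @exists_max _ _ R tris (fun t => `[< chart t x >]) f.
  by exists t0 => //; exact/asboolP.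
have hmin t' : t' \in tris -> chart t' x ->
    `|chr x (lin t - lin t0)| <= `|chr x (lin t' - lin t0)|.
  move=> tt' xt'; have /(_ _)/= := hmax t' tt'; rewrite /f lerN2 => h.
  rewrite -[leLHS]RRe_real ?normr_real // -[leRHS]RRe_real ?normr_real // lecR.
  by apply: h; exact/asboolP.
exists t; split => // k.
have cb1 : 1 <= coord_bound M t k by apply: exprn_ege1.
have [c0|cn] := eqVneq (chr x (dgen t k)) 0.
  by rewrite c0 normr0; apply: le_trans cb1; exact: ler01.
have pk := proj1 (chr_neq0 _ _) cn.
have [pos|[t' [c [tt' c0 e]]]] := tri_wall k tt.
  rewrite chr_nonneg // normr_prod /coord_bound expr_sum.
  apply: ler_prod => i _; rewrite normr_ge0 normrX lerXn2r ?nnegrE //.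
    by apply: le_trans M1; exact: ler01.
  by have := hM i; rewrite mxE.
apply: le_trans cb1.
have xt' : chart t' x.
  apply: orb_in_chart => // w ow.
  have eo := chart_orb (tri_dual tt) xt; move: ow; rewrite eo => hw.
  have [c' [hc ->]] := hw.
  have H j : exists j', (j != k) -> gen t j = gen t' j'.
    have [->|jk] := eqVneq j k; first by exists j.
    have [_] := tri_conv j tt' tt => -[|j' ej]; last by exists j'.
    apply/eqP; rewrite -subr_eq0 -prB e prZ (proj2 (tri_dual tt)) [k == j]eq_sym (negPf jk).
    by rewrite mulr0.
  have [g hg] := choice H.
  exists (fun j' => \sum_(j | g j == j') c' j); split.
    by move=> j'; split => //; apply: sumr_ge0 => j _; case: (hc j).
  rewrite (partition_big g predT) //=; apply: eq_bigr => j' _.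
  rewrite scaler_suml; apply: eq_bigr => j /eqP <-.
  have [jk|jk] := eqVneq j k; last by rewrite hg.
  by rewrite (proj2 (hc j)) ?scale0r // jk (negPf cn).
have hm := hmin _ tt' xt'.
have p1 := lin_perp tt tt0 xt xt0.
have z : 0 < `|chr x (lin t - lin t0)| by rewrite normr_gt0; exact/chr_neq0.
have e' : lin t' - lin t0 = (lin t - lin t0) - c *: dgen t k.
  by rewrite -scaleNr -e [RHS]addrC addrA subrK.
move: hm; rewrite e' (chr_perpD _ p1) normrM ler_pMr // chrN ?chrZ //; last exact: perpZ.
case: c c0 {e e'} => [[|n]|//] // _; rewrite -exprnP normfV normrX.
have c1 : 0 < `|chr x (dgen t k)| by rewrite normr_gt0.
rewrite invf_ge1 ?exprn_gt0 //; apply: contraTT.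
rewrite -!real_ltNge ?normr_real ?real1 ?rpredX ?normr_real // => h.
by rewrite exprn_egt1.
Qed.

Lemma norm_Re_Im (z : C) (r : R) : `|z| <= r%:C ->
  `|complex.Re z| <= r /\ `|complex.Im z| <= r.
Proof.
move=> h; split; rewrite -lecR; apply: le_trans h; first exact: normc_ge_Re.
have := normc_ge_Re (z * 'i); rewrite ReiNIm normrN normrM.
by have -> : `|'i%C| = 1 :> C; [rewrite normc_def /= expr0n expr1n add0r sqrtr1|rewrite mulr1].
Qed.

(** The preimage is closed and contained in a finite union of images of
  polydiscs under the charts. *)
Lemma pi_preimage_compact (K : set A3) : classical_compact K ->
  classical_compact (pi @^-1` K : set X).
Proof.
move=> cK; have [m hm] := compact_bounded cK.
have /choice [r hr] : forall t, exists r : R, forall k,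
    coord_bound (m.+1)%:R t k <= r%:C.
  move=> t; exists (\sum_k (m.+1)%:R ^+ (\sum_i absz (dgen t k 0%R i))%N) => k.
  rewrite /coord_bound -(rmorph_nat (real_complex R)) -rmorphXn lecR.
  by rewrite [leRHS](bigD1 k) //= lerDl sumr_ge0 // => j _; rewrite exprn_ge0 // ler0n.
have hpar t : exists par : A3 -> X, t \in tris ->
    local_iso (coords (dgen t)) par (chart t) (chart_image predT).
  have [tt|nt] := boolP (t \in tris).
    have [par l] := chart_iso (tri_dual tt) (e8fan_cof R predT tt).
    by exists par.
  have [par _] := chart_iso (tri_dual (mem_head _ _)) (e8fan_cof R predT (mem_head _ _)).
  by exists par.
have [par l] := choice hpar.
have WT (z : A3) : chart_image (R := R) predT z by move=> k.
have cU : classical_compact [set x : X | exists2 t, t \in tris & (par t @` polydisc (r t)) x].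
  apply: compact_bigU => t tt; apply: compact_image; last exact: polydisc_compact.
  by apply: mor_regular => [|p]; [exact: good_affine|exact: (li_gm (l t tt))].
have -> : (pi @^-1` K : set X) =
   [set x : X | exists2 t, t \in tris & (par t @` polydisc (r t)) x] `&` pi @^-1` K.
  apply/seteqP; split => [x Kx|x [] //]; split => //.
  have [|i|t [tt xt hb]] := @toric_bounded (m.+1)%:R x.
  - by rewrite ler1n.
  - by apply: le_trans (hm _ Kx i) _; rewrite ler_nat.
  exists t => //; exists (coords (dgen t) x); last exact: (li_gf (l t tt)).
  by move=> k; apply: norm_Re_Im; rewrite mxE; apply: le_trans (hb k) (hr t k).
apply: compact_closed => //.
exact: (classical_preimage toric_morphism_regular (compact_compl cK)).
Qed.

Lemma toric_proper : proper_map (pi : X -> A3).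
Proof. by split; [exact: toric_morphism_regular|exact: pi_preimage_compact]. Qed.

Lemma sub_proper (Z : set X) (E : set A3) (rho : sub_space Z -> sub_space E) :
  zclosed Z -> (forall x : sub_space Z, sval (rho x) = pi (sval x)) -> proper_map rho.
Proof.
move=> cZ e; have gX := @good_toric R; have gA := good_affine R 3.
split.
  apply: mor_regular => [|p]; first exact: good_sub.
  apply: sub_mor => //; first exact: good_sub.
  have -> : sval \o rho = pi \o sval by apply/funext.
  by apply: mor_comp; [exact: emb_mor (emb_sval _ gX)|exact: toric_morphism_mor].
move=> K cK.
have rs : regular_map (sval : sub_space E -> A3).
  by apply: mor_regular => [|p]; [exact: good_sub|exact: emb_mor (emb_sval _ gA)].
have := compact_trace gX cZ (pi_preimage_compact (compact_image rs cK)).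
congr classical_compact; apply/seteqP; split => x; rewrite /trace /= -e.
  by move=> [y Ky /(emb_inj (emb_sval E gA)) <-].
by move=> Kx; exists (rho x).
Qed.

End Proper.

(** * The strict transform *)

(** An edge of the tropical part of the triangulation: two consecutive points
  on a segment from a coordinate axis to the apex, completed to a basis of
  the lattice; the two monomials that tie there, the remaining one, and the
  order of the remaining term along the first point. *)
Definition edge : Type := simplex * (nat * nat * nat) * nat.
HB.instance Definition _ := Equality.on edge.

Definition mk_edge (a b w : zvec) (m : nat * nat * nat) (p : nat) : edge :=
  ((a, b, w), m, p).

Definition zv (x y z : nat) : zvec := (x%:Z, y%:Z, z%:Z).

Definition tropical_edges : seq edge :=
  let w1 : zvec := (-3%:Z, -5%:Z, -7%:Z) in let w2 : zvec := (-1, -2%:Z, -3%:Z) in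
  let w3 : zvec := (-2%:Z, -3%:Z, -5%:Z) in
  let m1 := (1, 2, 0)%N in let m2 := (2, 0, 1)%N in let m3 := (0, 1, 2)%N in
  [:: mk_edge (zv 1 0 0) (zv 2 2 3) w1 m1 5; mk_edge (zv 2 2 3) (zv 3 4 6) w1 m1 4;
      mk_edge (zv 3 4 6) (zv 4 6 9) w1 m1 3; mk_edge (zv 4 6 9) (zv 5 8 12) w1 m1 2;
      mk_edge (zv 5 8 12) (zv 6 10 15) w1 m1 1;
      mk_edge (zv 0 1 0) (zv 2 4 5) w2 m2 3; mk_edge (zv 2 4 5) (zv 4 7 10) w2 m2 2;
      mk_edge (zv 4 7 10) (zv 6 10 15) w2 m2 1;
      mk_edge (zv 0 0 1) (zv 3 5 8) w3 m3 2; mk_edge (zv 3 5 8) (zv 6 10 15) w3 m3 1].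

Definition esim (e : edge) : simplex := e.1.1.
Definition emin (e : edge) : nat := e.1.2.1.1.
Definition emid (e : edge) : nat := e.1.2.1.2.
Definition elast (e : edge) : nat := e.1.2.2.
Definition eord (e : edge) : nat := e.2.

Definition subz (s t : zvec) : zvec := addz s (scalez (-1) t).

Definition edge_ok (e : edge) :=
  [&& ok_dual (esim e), (0 < eord e)%N,
      perm_eq [:: emin e; emid e; elast e] (iota 0 3),
      dualz (esim e) 2 == subz (monoz (emid e)) (monoz (emin e)),
      addz (scalez (eord e)%:Z (dualz (esim e) 0)) (scalez (eord e).-1%:Z (dualz (esim e) 1))
        == subz (monoz (elast e)) (monoz (emin e)) &
      minz (esim e).1.1 (emin e) && minz (esim e).1.2 (emin e)] &&
  has (fun t => has (fun k => (esim e).1.1 == sel t k) (iota 0 3) &&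
                has (fun k => (esim e).1.2 == sel t k) (iota 0 3)) tris.

Lemma edges_check : all edge_ok tropical_edges.
Proof. by vm_compute. Qed.

(** This confines the zeros of the reduced equation to the charts of the edges. *)
Lemma tie_check : all (fun t => all (fun d => all (fun b =>
  [&& b != d, minz t.1.1 d, minz t.1.2 d & minz t.2 d] ==>
  has (fun e => all (fun k => (wt (sel t k) b == wt (sel t k) d) ==>
    ((sel t k == (esim e).1.1) || (sel t k == (esim e).1.2))) (iota 0 3)) tropical_edges)
  (iota 0 3)) (iota 0 3)) tris.
Proof. by vm_compute. Qed.

(** The first two members of the triple of an edge are its ends. *)
Definition ea : pred 'I_3 := fun k => k != ord_max.

Section Edges.
Variable R : realType.
Local Notation C := R[i].
Local Notation V := 'rV[R]_3.
Local Notation S := (@e8fan R).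
Local Notation X := (toric_variety S).
Local Notation chart t := (toric_chart (cof (gen t) predT) : set X).
Local Notation pi := (toric_morphism S).
Implicit Types (x y : X) (m u : N) (e : edge) (s : set V).

Lemma edgeP e : e \in tropical_edges -> edge_ok e.
Proof. by move: e; apply/allP; exact: edges_check. Qed.

Lemma edge_dual e : e \in tropical_edges -> dualb (gen (esim e)) (dgen (esim e)) 1.
Proof.
move=> /edgeP /andP[/and5P[/allP h _ _ _ _] _]; split=> // i j; rewrite pr_dotz.
by have /allP/(_ _ (ord3E j))/eqP -> := h _ (ord3E i).
Qed.

Lemma ea_cases k : ea k -> k = 0 \/ k = 1.
Proof.
by case: k => [[|[|[|//]]]] h // _; [left|right]; apply: val_inj.
Qed.

Lemma edge_in_tri e : e \in tropical_edges ->
  exists2 t, t \in tris & forall k, ea k -> exists j, gen (esim e) k = gen t j.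
Proof.
move=> /edgeP /andP[_ /hasP [t tt /andP[/exists3 [j0 /eqP e0] /exists3 [j1 /eqP e1]]]].
exists t => // k /ea_cases [->|->]; [exists j0|exists j1]; by rewrite /gen /= ?e0 ?e1.
Qed.

Lemma edge_fan e : e \in tropical_edges -> S (cof (gen (esim e)) ea).
Proof.
move=> he; have [t tt h] := edge_in_tri he.
pose a j := [exists k, ea k && (gen (esim e) k == gen t j)].
exists t, a; split => //; apply/seteqP; split; apply: cof_sub => k.
  move=> ak; have [j ej] := h k ak; exists j => //; apply/existsP; exists k.
  by rewrite ak ej eqxx.
by move=> /existsP [j /andP[aj /eqP <-]]; exists j.
Qed.

(** The monomial [d] has minimal weight on the set. *)
Definition min_on s (d : 'I_3) := forall b, @dual_lattice R s (mono b - mono d).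

Lemma min_on_sub s s' d : s `<=` s' -> min_on s' d -> min_on s d.
Proof. by move=> sub h b w /sub; exact: h. Qed.

Lemma min_on_cof (B : 'I_3 -> zvec) (a : pred 'I_3) (d : 'I_3) :
  (forall k, a k -> minz (B k) d) -> min_on (cof (fun k => vz (B k)) a) d.
Proof.
move=> h b; apply/dual_cof => k /h /forall3 /(_ b).
by rewrite prB !pr_mono subr_ge0.
Qed.

Lemma tri_min t : t \in tris -> exists d, min_on (cof (gen t) predT) d.
Proof.
move=> /tri_ok /and5P[_ _ _ _ /exists3 [d /forall3 h]]; exists d.
by apply: min_on_cof => k _; exact: h.
Qed.

Lemma orb_min x : exists d, min_on (orb x) d.
Proof.
have [t tt xt] := max_chart x; have [d hd] := tri_min tt; exists d.
exact: min_on_sub (chart_sub (e8fan_cof R predT tt) xt) hd.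
Qed.

(** The equation of the surface divided by the monomial [d]. *)
Definition Feq (d : 'I_3) x : C := \sum_b chr x (mono b - mono d).

Lemma mono_nonneg a i : 0 <= mono a 0 i.
Proof. by rewrite mxE; case: a => [[|[|[|//]]]] ?; case: i => [[|[|[|//]]]]. Qed.

Lemma E8_chr x : E8 R (pi x) <-> \sum_a chr x (mono a) = 0.
Proof.
have hx a : chr x (mono a) = chr x (delta_mx 0 a) ^+ nth 0%N [:: 5; 3; 2] a.
  rewrite (chr_nonneg x (mono_nonneg a)) (bigD1 a) //= big1 ?mulr1.
    by rewrite mxE; case: a => [[|[|[|//]]]].
  move=> i; rewrite mxE; case: a => [[|[|[|//]]]] ?; by case: i => [[|[|[|//]]]].
have ev : eval (E8_poly R) (pi x) = \sum_a chr x (mono a).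
  rewrite /E8_poly !evalD !evalXn !evalX !mxE !big_ord_recl big_ord0 addr0 !hx /=.
  have -> : lift ord0 (ord0 : 'I_2) = 1 :> 'I_3 by apply: val_inj.
  have -> : lift ord0 (lift ord0 (ord0 : 'I_1)) = 2%:R :> 'I_3 by apply: val_inj.
  by rewrite /= addrC [X in _ + X]addrC.
by rewrite -ev; split=> [h|h p ->]; [apply: h|].
Qed.

Lemma mono_dual s a : S s -> @dual_lattice R s (mono a).
Proof. by move=> Ss; apply: dual_nonneg => // i; exact: mono_nonneg. Qed.

(** On the part where the monomial [d] has minimal weight the equation of the
  surface is that monomial times the equation of the strict transform. *)
Lemma total_factor x d : min_on (orb x) d ->
  \sum_a chr x (mono a) = chr x (mono d) * Feq d x.
Proof.
move=> md; rewrite mulr_sumr; apply: eq_bigr => a _.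
rewrite -(chrM (orb_fan x) (chart_self x)) //; last exact: mono_dual (orb_fan x).
by rewrite addrC subrK.
Qed.

Lemma Feq_change x d d' : min_on (orb x) d -> min_on (orb x) d' ->
  Feq d x = 0 -> Feq d' x = 0.
Proof.
move=> md md'.
have p : perp (orb x) (mono d - mono d').
  move=> w ow; apply/eqP; rewrite eq_le md' // andbT -oppr_ge0.
  by have := md d' w ow; rewrite -opprB latN dotC dotNr dotC.
move=> h; have -> : Feq d' x = chr x (mono d - mono d') * Feq d x.
  rewrite mulr_sumr; apply: eq_bigr => b _.
  by rewrite -chr_perpD //; congr (chr x _); rewrite [RHS]addrC addrA subrK.
by rewrite h mulr0.
Qed.

Lemma Feq_cf s d : min_on s d -> @chart_functions R S s (Feq d).
Proof.
move=> md; have := cf_fin (fun=> 1) md; congr (@chart_functions R S s).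
by apply/funext => x; apply: eq_bigr => b _; rewrite mul1r.
Qed.

Local Notation XT := (strict_transform S (E8 R)).

Lemma torus_perp x m : torus x -> perp (orb x) m.
Proof. by move=> -> w ->; rewrite dot0r. Qed.

Lemma strict_Feq x s d : S s -> toric_chart s x -> min_on s d -> XT x -> Feq d x = 0.
Proof.
move=> Ss xs md Xx; apply/eqP/negPn/negP => nz.
have gF := cf_germ Ss xs (Feq_cf md).
have [U [oU Ux hU]] := around_and (@good_toric R)
  (germ_neq0 (@good_toric R) gF nz) (open_around (chart_open Ss) xs).
have [y [Uy [/E8_chr Ey ty]]] := Xx U oU Ux; have [Fy ys] := hU _ Uy.
have mdy := min_on_sub (chart_sub Ss ys) md.
move: Ey; rewrite (total_factor mdy) => /eqP; rewrite mulf_eq0 (negPf Fy) orbF.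
by apply/negP/chr_neq0; exact: torus_perp.
Qed.

Lemma strict_closed : zclosed (XT : set X).
Proof. by apply: closure_closed; exact: good_toric. Qed.

Lemma tie_edge x t d b : t \in tris -> chart t x -> (forall k : 'I_3, minz (sel t k) (d : 'I_3)) ->
  b != d -> chr x (mono b - mono d) != 0 ->
  exists2 e, e \in tropical_edges & toric_chart (cof (gen (esim e)) ea) x.
Proof.
move=> tt xt md bd /chr_neq0 pp.
have /allP/(_ _ tt)/forall3/(_ d)/forall3/(_ b) := tie_check.
have -> : [&& (b != d :> nat), minz t.1.1 d, minz t.1.2 d & minz t.2 d].
  by apply/and4P; split => //; [exact: (md 0)|exact: (md 1)|exact: (md 2%:R)].
move=> /hasP [e he /forall3 hk]; exists e => //.
apply: chart_of_sub; first exact: edge_fan.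
have eo := chart_orb (tri_dual tt) xt; rewrite eo; apply: cof_sub => k ak.
have : pr (mono b - mono d) (gen t k) = 0 by move: pp; rewrite eo perp_cof; apply.
rewrite prB !pr_mono => /eqP; rewrite subr_eq0 => w.
have /implyP/(_ w)/orP[/eqP ek|/eqP ek] := hk k.
  by exists 0; rewrite /gen ?ek.
by exists 1; rewrite /gen ?ek.
Qed.

(** One of the terms of the equation is 1, so at a zero another term does not
  vanish: two monomials tie on the cone of the orbit. *)
Lemma Feq0_edge x d : min_on (orb x) d -> Feq d x = 0 ->
  exists2 e, e \in tropical_edges & toric_chart (cof (gen (esim e)) ea) x.
Proof.
move=> md F0; have [t tt xt] := max_chart x.
have /and5P[_ _ _ _ /exists3 [d' /forall3 hd']] := tri_ok tt.
have md' : min_on (orb x) d'.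
  apply: min_on_sub (chart_sub (e8fan_cof R predT tt) xt) _.
  by apply: min_on_cof => k _; exact: hd'.
have F0' := Feq_change md md' F0.
have [b bd cb] : exists2 b, b != d' & chr x (mono b - mono d') != 0.
  apply: contrapT => h; move: F0'; rewrite /Feq (bigD1 d') //= subrr chr0 big1.
    by rewrite addr0 => /eqP; rewrite oner_eq0.
  by move=> b bd; apply/eqP/negPn/negP => cb; apply: h; exists b.
exact: (tie_edge tt xt hd' bd cb).
Qed.

Lemma strict_edge x : XT x ->
  exists2 e, e \in tropical_edges & toric_chart (cof (gen (esim e)) ea) x.
Proof.
move=> Xx; have [d md] := orb_min x; apply: (Feq0_edge md).
exact: strict_Feq (orb_fan x) (chart_self x) md Xx.
Qed.

End Edges.

Section EdgeCharts.
Variable R : realType.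
Local Notation C := R[i].
Local Notation V := 'rV[R]_3.
Local Notation S := (@e8fan R).
Local Notation X := (toric_variety S).
Local Notation A3 := (affine_space R 3).
Local Notation XT := (strict_transform S (E8 R)).
Local Notation o2 := (ord_max : 'I_3).
Local Notation echart e := (toric_chart (cof (gen (esim e)) ea) : set X).
Implicit Types (x y : X) (m u : N) (e : edge) (s : set V).

Lemma edge_mono e : e \in tropical_edges -> exists d b c : 'I_3,
  [/\ mono b - mono d = dgen (esim e) o2,
      mono c - mono d = (eord e)%:Z *: dgen (esim e) 0 + (eord e).-1%:Z *: dgen (esim e) 1,
      min_on (@cof R (gen (esim e)) ea) d &
      forall F : 'I_3 -> C, \sum_k F k = F d + (F b + F c)].
Proof.
move=> /edgeP /andP[/and5P[_ _ pe /eqP eb /andP[/eqP ec /andP[m1 m2]]] _].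
have hk k : k \in [:: emin e; emid e; elast e] -> (k < 3)%N.
  by rewrite (perm_mem pe) mem_iota.
have hd : (emin e < 3)%N by apply: hk; rewrite !inE eqxx.
have hb : (emid e < 3)%N by apply: hk; rewrite !inE eqxx orbT.
have hc : (elast e < 3)%N by apply: hk; rewrite !inE eqxx !orbT.
exists (Ordinal hd), (Ordinal hb), (Ordinal hc); split.
- have := congr1 vz eb; rewrite /dgen /= => ->; apply/rowP => i; rewrite !mxE /=.
  by case: i => [[|[|[|//]]]] ? /=; rewrite mulN1r.
- have := congr1 vz ec => /esym; rewrite /dgen /= => ec'.
  transitivity (vz (subz (monoz (elast e)) (monoz (emin e)))).
    by apply/rowP => i; rewrite !mxE /=; case: i => [[|[|[|//]]]] ? /=; rewrite mulN1r.
  by rewrite ec'; apply/rowP => i; rewrite !mxE /=; case: i => [[|[|[|//]]]].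
- by apply: min_on_cof => k /ea_cases [->|->].
- have := perm_uniq pe; rewrite iota_uniq /= !inE negb_or andbT.
  move=> /andP[/andP[db dc] bc] F.
  rewrite (bigD1 (Ordinal hd)) //= (bigD1 (Ordinal hb)) //=; last by rewrite -val_eqE /= eq_sym.
  rewrite (bigD1 (Ordinal hc)) /=; last by rewrite -!val_eqE /= eq_sym dc eq_sym bc.
  rewrite big1 ?addr0 // => i; rewrite -!val_eqE /= => /andP[/andP[id ib] ic].
  have := perm_mem pe i; rewrite (ord3E i) !inE.
  by rewrite (negPf id) (negPf ib) (negPf ic).
Qed.

Definition emonom e (z : A3) : C := z 0 0 ^+ eord e * z 0 1 ^+ (eord e).-1.

Lemma edge_Feq e x d b c : e \in tropical_edges -> echart e x ->
  mono b - mono d = dgen (esim e) o2 ->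
  mono c - mono d = (eord e)%:Z *: dgen (esim e) 0 + (eord e).-1%:Z *: dgen (esim e) 1 ->
  (forall F : 'I_3 -> C, \sum_k F k = F d + (F b + F c)) ->
  Feq d x = 1 + (chr x (dgen (esim e) o2) + emonom e (coords (dgen (esim e)) x)).
Proof.
move=> he xe eb ec es; rewrite /Feq es subrr chr0 eb ec; congr (_ + (_ + _)).
have hD := edge_dual he.
have p0 : pr (dgen (esim e) 0) (gen (esim e) 0) = 1 by rewrite (proj2 hD).
rewrite (chr_monomial hD xe); last first.
  by move=> k _ _; rewrite prD !prZ !(proj2 hD) addr_ge0 // mulr_ge0.
rewrite /emonom !mxE !big_ord_recl big_ord0 mulr1.
have -> : lift ord0 (ord0 : 'I_2) = 1 :> 'I_3 by apply: val_inj.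
have -> : lift ord0 (lift ord0 (ord0 : 'I_1)) = o2 :> 'I_3 by apply: val_inj.
rewrite !prD !prZ !(proj2 hD) /= !mulr1n !mulr0n !mulr1 !mulr0 !addr0 !add0r expr0z mulr1.
by rewrite -!exprnP.
Qed.

(** The substitution that turns the invertible coordinate A into 1 + A + s^p t^(p-1)
  for sign 1, and its inverse for sign -1. *)
Definition shear e (sg : C) (z : A3) : A3 :=
  \row_k (if k == o2 then z 0 o2 + sg * (1 + emonom e z) else z 0 k).

Lemma shear_mor e sg (z : A3) : mor_at (shear e sg : A3 -> A3) z.
Proof.
have gA := good_affine R 3; apply: (mor_affine gA) => k.
have [->|kn] := eqVneq k o2.
  have : germ z (fun z : A3 => z 0 o2 + sg * (1 + emonom e z)).
    apply: (germD gA); first exact: coord_germ.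
    apply: (germM gA); first exact: (germ_cst gA).
    apply: (germD gA); first exact: (germ_cst gA).
    by apply: (germM gA); apply: (germX gA); exact: coord_germ.
  by congr germ; apply/funext => y; rewrite mxE eqxx.
have := coord_germ k z; congr germ; apply/funext => y.
by rewrite mxE (negPf kn).
Qed.

Lemma shear_emonom e sg z : emonom e (shear e sg z) = emonom e z.
Proof. by rewrite /emonom /shear !mxE. Qed.

Lemma shearK e sg z : shear e (- sg) (shear e sg z) = z.
Proof.
apply/rowP => k; rewrite mxE shear_emonom; case: eqP => [->|/eqP kn].
  by rewrite mxE eqxx mulNr addrK.
by rewrite mxE (negPf kn).
Qed.

(** The invertible coordinate, in terms of the new coordinates, does not vanish. *)
Definition eimage e : set A3 := [set z : A3 | z 0 o2 - (1 + emonom e z) != 0].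

(** Replacing the coordinate that is invertible on the chart by the equation
  of the strict transform gives coordinates in which the strict transform
  and the invariant divisors are coordinate planes. *)
Lemma edge_chart e : e \in tropical_edges -> exists f g d,
  [/\ local_iso f g (echart e) (eimage e),
      forall x, echart e x -> (XT x <-> f x 0 o2 = 0),
      forall x k, ea k -> f x 0 k = chr x (dgen (esim e) k) &
      min_on (@cof R (gen (esim e)) ea) d /\
      forall x, echart e x -> f x 0 o2 = Feq d x].
Proof.
move=> he; have hD := edge_dual he; have hS := edge_fan R he.
have gA := good_affine R 3.
have [par l] := chart_iso hD hS.
pose f := shear e 1 \o coords (dgen (esim e)); pose g := par \o shear e (-1).
have im z : eimage e z <-> chart_image ea (shear e (-1) z).
  rewrite /eimage /chart_image /=; split.
    by move=> h k; rewrite /ea negbK => /eqP ->; rewrite mxE eqxx mulN1r.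
  by move=> /(_ o2); rewrite /ea eqxx => /(_ isT); rewrite mxE eqxx mulN1r.
have l2 : local_iso (shear e 1) (shear e (-1)) (chart_image ea : set A3) (eimage e).
  have oW := @W_open R ea; split => //.
  - have -> : eimage e = shear e (-1) @^-1` (chart_image ea).
      by apply/seteqP; split => z /im.
    apply: (openP gA) => z hz; exact: (proj1 (shear_mor e (-1) z)).
  - by move=> z hz; apply/im; rewrite shearK.
  - by move=> z /im.
  - by move=> z _; exact: shearK.
  - by move=> z _; rewrite -{1}(opprK 1); exact: shearK.
  - by move=> z _; exact: shear_mor.
  - by move=> z _; exact: shear_mor.
have lf : local_iso f g (echart e) (eimage e).
  by apply: local_iso_comp l l2 _ _ => // z /im.
have [d [b [c [eb ec md es]]]] := edge_mono he.
have fF x : echart e x -> f x 0 o2 = Feq d x.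
  move=> xe; rewrite (edge_Feq he xe eb ec es) /f /= mxE eqxx mul1r mxE.
  by rewrite addrCA.
have fk x k : ea k -> f x 0 k = chr x (dgen (esim e) k).
  by rewrite /ea => /negPf kn; rewrite /f /= mxE kn mxE.
exists f, g, d; split => // x xe; rewrite fF //; split.
  exact: strict_Feq hS xe md.
rewrite -fF // => f0 O oO Ox.
have gx := li_gf lf xe.
have Vx := li_f lf xe.
have [U [oU Ux hU]] : around (f x) (fun z => eimage e z /\ O (g z)).
  apply: (around_and gA).
    by exists (eimage e); split => //; exact: (li_openV lf).
  by apply: (proj1 (li_gm lf Vx)) => //; rewrite gx.
pose v : 'rV[C]_3 := \row_k (k != o2)%:R.
have [r [r0 hr]] := line_open v oU Ux.
pose q := r * \prod_(k : 'I_3 | ea k) ((f x 0 k)%:P + 'X).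
have q0 : q != 0.
  rewrite mulf_neq0 ?(nz_at0 r0) //; apply/prodf_neq0 => k _.
  by rewrite addrC -size_poly_eq0 size_XaddC.
have [t] := poly_nonroot q0; rewrite hornerM mulf_eq0 negb_or => /andP[/hr Ut].
rewrite horner_prod => /prodf_neq0 ht.
set z := f x + t *: v in Ut; have [Vz Oz] := hU _ Ut.
have z2 : z 0 o2 = 0 by rewrite mxE f0 add0r !mxE eqxx mulr0.
have ye := li_g lf Vz; have ef := li_fg lf Vz.
have Fy : Feq d (g z) = 0 by rewrite -fF // ef.
have ty : orb (g z) = [set 0].
  rewrite (chart_orb hD ye); apply/seteqP; split => [w [c' [hc ->]]|w ->]; last first.
    exists (fun=> 0); split => //.
    by rewrite big1 // => k _; rewrite scale0r.
  apply: big1 => k _; rewrite (proj2 (hc k)) ?scale0r // negb_and.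
  have [ak|//] := boolP (ea k); rewrite /= -fk // ef.
  have zk : z 0 k = f x 0 k + t.
    by rewrite mxE [(t *: v) 0 k]mxE [v 0 k]mxE; move: ak; rewrite /ea => ->; rewrite mulr1.
  by have := ht _ ak; rewrite hornerD hornerC hornerX -zk.
exists (g z); split => //; split => //.
apply/E8_chr; rewrite (@total_factor R _ d) ?Fy ?mulr0 //.
exact: min_on_sub (chart_sub hS ye) md.
Qed.

Lemma strict_min x d : min_on (orb x) d -> (XT x <-> Feq d x = 0).
Proof.
move=> md; split; first exact: strict_Feq (orb_fan x) (chart_self x) md.
move=> F0; have [e he xe] := Feq0_edge md F0.
have [f [g [d' [l hX _ [md' hF]]]]] := edge_chart he.
apply/hX => //; rewrite hF //; apply: Feq_change md _ F0.
exact: min_on_sub (chart_sub (edge_fan R he) xe) md'.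
Qed.

End EdgeCharts.

(** * Divisors and the total transform *)

Section Divisors.
Variable R : realType.
Local Notation C := R[i].
Local Notation V := 'rV[R]_3.
Local Notation S := (@e8fan R).
Local Notation X := (toric_variety S).
Local Notation A3 := (affine_space R 3).
Local Notation XT := (strict_transform S (E8 R)).
Local Notation TT := (@total_transform R S (E8 R)).
Local Notation o2 := (ord_max : 'I_3).
Local Notation chart t := (toric_chart (cof (gen t) predT) : set X).
Local Notation echart e := (toric_chart (cof (gen (esim e)) ea) : set X).
Implicit Types (x y : X) (m u : N) (e : edge) (s : set V).

Lemma vertex_in_face t t' (a : pred 'I_3) k : t \in tris -> t' \in tris ->
  @cof R (gen t') a (lat R (gen t k)) -> exists2 j, a j & gen t k = gen t' j.
Proof.
move=> tt tt' h.
have : (cof (gen t) (pred1 k) `&` cof (gen t') a) (lat R (gen t k)).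
  by split => //; apply: cof_gen; exact: eqxx.
rewrite tri_inter // => /(cof_genP (tri_dual tt)) /andP[_ /existsP [j /andP[aj /eqP e]]].
by exists j.
Qed.

Lemma chart_divisor (B D : 'I_3 -> N) (a : pred 'I_3) x k : dualb B D 1 ->
  toric_chart (cof B a) x -> a k -> (orb x (lat R (B k)) <-> chr x (D k) = 0).
Proof.
move=> hD Ux ak; rewrite (chart_orb hD Ux); split=> [/(cof_genP hD)/andP[_ /eqP] //|e].
by apply: cof_gen; rewrite ak e eqxx.
Qed.

Lemma orbit_open t k : t \in tris ->
  zopen [set x : X | ~ orb x (lat R (gen t k))].
Proof.
move=> tt; apply: (openP (@good_toric R)) => x nx.
exists (toric_chart (orb x)); split; [exact: chart_open (orb_fan x)|exact: chart_self|].
by move=> y /(chart_sub (orb_fan x)) sub /sub.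
Qed.

(** The direction in the plane of the k-th coordinate in which all other
  coordinates change. *)
Definition star_point (k : 'I_3) : A3 := \row_i (i != k)%:R.

Lemma star_line (z : A3) c j i : (z + c *: star_point j) 0 i = z 0 i + c * (i != j)%:R.
Proof. by rewrite !mxE. Qed.

Lemma orbit_coords t k par (z : A3) : t \in tris ->
  local_iso (coords (dgen t)) par (chart t) (chart_image predT) ->
  z 0 k = 0 -> (forall i, i != k -> z 0 i != 0) -> orb (par z) = ray R (gen t k).
Proof.
move=> tt l zk zi; have Wz : chart_image (R := R) predT z by [].
have Uz := li_g l Wz; rewrite (chart_orb (tri_dual tt) Uz) rayE.
apply: eq_cof => // i /=; have := li_fg l Wz => /rowP /(_ i); rewrite mxE => ->.
by have [->|ik] := eqVneq i k; [rewrite zk eqxx|rewrite (negPf (zi _ ik))].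
Qed.

(** The closure of the orbit of a ray consists of the orbits of the cones that
  contain it: near such a point the orbit is dense in a coordinate plane. *)
Lemma divisorE t k x : t \in tris ->
  toric_divisor S (gen t k) x <-> orb x (lat R (gen t k)).
Proof.
move=> tt; split.
  move=> cx; apply: contrapT => nx; have [y [ny ey]] := cx _ (@orbit_open t k tt) nx.
  by apply: ny; rewrite ey rayE; apply: cof_gen; exact: eqxx.
move=> ox O oO Ox; have [t' tt' xt'] := max_chart x.
have [j _ ej] := vertex_in_face tt tt' (chart_sub (e8fan_cof R predT tt') xt' ox).
rewrite ej in ox *; have [par l] := chart_iso (tri_dual tt') (e8fan_cof R predT tt').
have gA := good_affine R 3.
have ck := proj1 (chart_divisor (k := j) (tri_dual tt') xt' isT) ox.
set z := coords (dgen t') x.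
have Wz : chart_image (R := R) predT z by [].
have [U [oU Uz hU]] : around z (fun z' => O (par z')).
  by apply: (proj1 (li_gm l Wz)) => //; rewrite (li_gf l xt').
have [r [r0 hr]] := line_open (star_point j) oU Uz.
pose q := r * \prod_(i : 'I_3 | i != j) ((z 0 i)%:P + 'X).
have q0 : q != 0.
  rewrite mulf_neq0 ?(nz_at0 r0) //; apply/prodf_neq0 => i _.
  by rewrite addrC -size_poly_eq0 size_XaddC.
have [c] := poly_nonroot q0; rewrite hornerM mulf_eq0 negb_or => /andP[/hr /hU Oc].
rewrite horner_prod => /prodf_neq0 hc.
exists (par (z + c *: star_point j)); split => //; apply: orbit_coords => //.
  by rewrite star_line eqxx mulr0 addr0 mxE.
move=> i ij; rewrite star_line ij mulr1.
by have := hc _ ij; rewrite hornerD hornerC hornerX.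
Qed.

Lemma divisor_closed u : zclosed (toric_divisor S u : set X).
Proof. by apply: closure_closed; exact: good_toric. Qed.

Lemma divisor_irreducible t k : t \in tris ->
  irreducible (toric_divisor S (gen t k) : set X).
Proof.
move=> tt; apply: (irreducible_closure); have gA := good_affine R 3.
have [par l] := chart_iso (tri_dual tt) (e8fan_cof R predT tt).
pose Q : {mpoly C[3]} := \prod_(i | i != k) 'X_i.
have evQ z : eval Q z = \prod_(i | i != k) z 0 i.
  by rewrite /eval rmorph_prod; apply: eq_bigr => i _; rewrite /= mevalXU.
pose L : set A3 := [set z : A3 | z 0 k = 0].
have e : [set x : X | orb x = ray R (gen t k)] = par @` (L `&` [set z | eval Q z != 0]).
  apply/seteqP; split => [x ox|_ [z [zk Qz] <-]] /=.
    have xt : chart t x.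
      apply: orb_in_chart => // w; rewrite ox rayE; exact: cof_mono.
    exists (coords (dgen t) x); last exact: (li_gf l xt).
    split=> /=.
      rewrite /L /= mxE; apply/(chart_divisor (tri_dual tt) xt) => //.
      by rewrite ox rayE; apply: cof_gen; exact: eqxx.
    rewrite evQ; apply/prodf_neq0 => i ik; rewrite mxE; apply/chr_neq0.
    rewrite ox rayE perp_cof => j /eqP ->; rewrite (proj2 (tri_dual tt)).
    by rewrite (negPf ik).
  by move: Qz; rewrite /= evQ => /prodf_neq0 h; exact: orbit_coords.
rewrite e; apply: irreducible_image => //; first exact: good_toric.
  by move=> z _; apply: (li_gm l) => j.
apply: irreducible_linear.
  by move=> p q c; rewrite /L /= => pk qk; rewrite !mxE pk qk subrr mulr0 addr0.
exists (star_point k); split; first by rewrite /L /= mxE eqxx.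
by rewrite /= evQ; apply/prodf_neq0 => i ik; rewrite mxE ik oner_neq0.
Qed.

Lemma edges_nonempty : exists e, e \in tropical_edges.
Proof. by exists (head (((0,0,0),(0,0,0),(0,0,0)), (0,0,0)%N, 0%N) tropical_edges). Qed.

Lemma torus_in_face x s : S s -> torus x -> toric_chart s x.
Proof.
move=> Ss tx; apply: chart_of_sub => // w; rewrite tx => ->.
have [t [a [_ ->]]] := Ss; exists (fun=> 0); split => //.
by rewrite big1 // => k _; rewrite scale0r.
Qed.

(** The strict transform is the closure of its part in a single edge chart, which
  is an open subset of a plane and contains the part in the torus. *)
Lemma strict_irreducible : irreducible (XT : set X).
Proof.
have [e he] := edges_nonempty; have gA := good_affine R 3.
have [f [g [d [l hX _ _]]]] := edge_chart R he.
pose L : set A3 := [set z : A3 | z 0 o2 = 0].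
pose Q : {mpoly C[3]} := 'X_o2 - (1%:MP + 'X_0 ^+ eord e * 'X_1 ^+ (eord e).-1).
have evQ z : eval Q z = z 0 o2 - (1 + emonom e z).
  by rewrite evalB evalD evalM !evalXn !evalX evalC.
pose Y := g @` (L `&` [set z | eval Q z != 0]).
have YX : Y `<=` XT.
  move=> _ [z [zL Vz] <-]; rewrite /= evQ in Vz.
  by apply/hX; [exact: (li_g l)|rewrite (li_fg l)].
have -> : (XT : set X) = zclosure Y.
  apply/seteqP; split; last exact: closure_min (@strict_closed R) YX.
  apply: closure_min; first by apply: closure_closed; exact: good_toric.
  move=> x xx; have Xx : XT x by exact: sub_closure.
  have xe := torus_in_face (edge_fan R he) (proj2 xx).
  apply: sub_closure; exists (f x); last exact: (li_gf l xe).
  by split; [exact/hX|rewrite /= evQ; exact: (li_f l xe)].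
apply: irreducible_closure; apply: irreducible_image => //; first exact: good_toric.
  by move=> z [_ /=]; rewrite evQ => Vz; exact: (li_gm l).
apply: irreducible_linear.
  by move=> p q c; rewrite /L /= => pk qk; rewrite !mxE pk qk subrr mulr0 addr0.
exists 0; split; first by rewrite /L /= mxE.
have /andP[/and3P[_ p0 _] _] := edgeP he.
rewrite /= evQ /emonom !mxE expr0n; case: (eord e) p0 => // p _.
by rewrite mul0r addr0 sub0r oppr_eq0 oner_neq0.
Qed.

Lemma posz_wt (z : zvec) (a : 'I_3) : posz z -> 0 < wt z a.
Proof.
move=> /and3P[h0 h1 h2]; case: a => [[|[|[|//]]]] ?; rewrite /wt /= mulr_gt0 //.
Qed.

(** The equation vanishes at a point through the reduced equation or through the
  minimal monomial; in the latter case that monomial, and hence every monomial,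
  has positive weight on some ray of the cone of the orbit. *)
Lemma total_sub x : TT x -> XT x \/ exists t k,
  [/\ t \in tris, posz (sel t (k : 'I_3)) & toric_divisor S (gen t k) x].
Proof.
move=> /E8_chr; have [d md] := orb_min x; rewrite (total_factor md) => /eqP.
rewrite mulf_eq0 => /orP[/eqP/chr_eq0 nd|/eqP F0]; last by left; apply/(strict_min md).
right; have [t [a [tt eo]]] := orb_fan x; move: nd; rewrite eo perp_cof.
move=> /existsNP [k /not_implyP [ak nz]]; exists t, k.
have ok : orb x (lat R (gen t k)) by rewrite eo; exact: cof_gen.
split => //; last exact/divisorE.
have pd : 0 < wt (sel t k) d.
  rewrite -pr_mono lt_neqAle eq_sym; apply/andP; split; first exact/eqP.
  by apply: sumr_ge0 => i _; rewrite mulr_ge0 ?mono_nonneg // tri_orth.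
have hb (b : 'I_3) : 0 < wt (sel t k) b.
  apply: lt_le_trans pd _; have := md b _ ok.
  by rewrite dot_lat ler0z prB !pr_mono subr_ge0.
have := hb 0; have := hb 1; have := hb 2%:R; rewrite /wt /= !pmulr_rgt0 //.
by rewrite /posz => -> -> ->.
Qed.

Lemma divisor_total t k : t \in tris -> posz (sel t (k : 'I_3)) ->
  toric_divisor S (gen t k) `<=` TT.
Proof.
move=> tt pz x /(divisorE _ _ tt) ox; apply/E8_chr; rewrite big1 // => a _.
apply/chr_eq0 => /(_ _ ox) /eqP; rewrite dot_lat intr_eq0 pr_mono.
by rewrite gt_eqF // posz_wt.
Qed.

Lemma strict_total : XT `<=` TT.
Proof.
move=> x Xx; have [d md] := orb_min x; apply/E8_chr.
by rewrite (total_factor md) (proj1 (strict_min md) Xx) mulr0.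
Qed.

(** The components are found among finitely many irreducible closed sets that
  cover the total transform. *)
Lemma total_component Z : component TT Z -> Z = XT \/ exists t k,
  [/\ t \in tris, posz (sel t (k : 'I_3)) & Z = toric_divisor S (gen t k)].
Proof.
move=> [ZT irZ maxZ].
pose nt (i : 'I_(size tris)) := nth (head (((0,0,0),(0,0,0),(0,0,0)) : simplex) tris) tris i.
have ntt i : nt i \in tris by exact: mem_nth.
pose F (o : option ('I_(size tris) * 'I_3)) : set X :=
  if o is Some (i, k) then
    (if posz (sel (nt i) k) then toric_divisor S (gen (nt i) k) else set0)
  else XT.
have cF o : zclosed (F o).
  case: o => [[i k]|]; last exact: strict_closed.
  rewrite /F; case: ifP => _; first exact: divisor_closed.
  by rewrite /zclosed setC0; exact: goodT (@good_toric R).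
have [|o ho] := irreducible_bigU (@good_toric R) cF irZ.
  move=> x /ZT /total_sub [Xx|[t [k [tt pz Dx]]]]; first by exists None.
  have it : (index t tris < size tris)%N by rewrite index_mem.
  exists (Some (Ordinal it, k)) => //=.
  by rewrite /nt /= nth_index // pz.
case: o ho => [[i k]|] /= ho; last first.
  by left; rewrite (maxZ XT) //; [exact: strict_total|exact: strict_irreducible].
move: ho; case: ifP => pz ho; last by case: irZ => -[x /ho].
right; exists (nt i), k; split => //.
by rewrite (maxZ (toric_divisor S (gen (nt i) k))) //;
  [exact: divisor_total|exact: divisor_irreducible].
Qed.

Lemma edge_vertex e t k : e \in tropical_edges -> t \in tris ->
  @cof R (gen (esim e)) ea (lat R (gen t k)) ->
  exists2 j, ea j & gen t k = gen (esim e) j.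
Proof.
move=> he tt; have [t' tt' h] := edge_in_tri he.
pose a j := [exists k, ea k && (gen (esim e) k == gen t' j)].
have sub : @cof R (gen (esim e)) ea `<=` cof (gen t') a.
  apply: cof_sub => i ai; have [j ej] := h i ai; exists j => //; apply/existsP.
  by exists i; rewrite ai ej eqxx.
move=> /sub /(vertex_in_face tt tt') [j /existsP [i /andP[ai /eqP ei]] ej].
by exists i => //; rewrite ej ei.
Qed.

(** On the strict transform the chart of an edge has this property, with the
  equation as a coordinate; elsewhere the chart of a maximal cone does. *)
Lemma adapted_chart x : exists f g U V (D : 'I_3 -> set X),
  [/\ @local_iso R X A3 f g U V, U x,
      forall k y, U y -> (D k y <-> f y 0 k = 0) &
      forall Z, component TT Z -> Z x -> exists k, Z = D k].
Proof.
have gX := @good_toric R; have gA := good_affine R 3.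
have [Xx|nX] := pselect (XT x).
  have [e he xe] := strict_edge Xx; have [f [g [d [l hX hk _]]]] := edge_chart R he.
  have [t0 tt0 h0] := edge_in_tri he.
  exists f, g, (echart e), (eimage e),
    (fun k => if ea k then toric_divisor S (gen (esim e) k) else XT).
  split => //.
    move=> k y ye; case: ifP => ak; last first.
      have -> : k = o2 by apply/eqP; move: ak; rewrite /ea => /negbFE.
      exact: hX.
    rewrite hk //; have [j ej] := h0 k ak; rewrite {1}ej (divisorE _ _ tt0) -ej.
    exact: chart_divisor (edge_dual he) ye ak.
  move=> Z /total_component [-> _|[t [k [tt _ ->]]]]; first by exists o2.
  move=> /(divisorE _ _ tt) /(chart_sub (edge_fan R he) xe) /(edge_vertex he tt) [j aj ->].
  by exists j; rewrite aj.
have [t tt xt] := max_chart x; have St := e8fan_cof R predT tt.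
have [par l] := chart_iso (tri_dual tt) St.
have oU : zopen (chart t `&` ~` XT).
  by apply: goodI => //; [exact: chart_open|exact: strict_closed].
have l' := local_iso_restrict gX gA l oU (@subIsetl _ _ _).
exists (coords (dgen t)), par, (chart t `&` ~` XT),
  (chart_image predT `&` par @^-1` (chart t `&` ~` XT)),
  (fun k => toric_divisor S (gen t k)); split => //.
  move=> k y [yt _]; rewrite (divisorE _ _ tt) mxE.
  exact: chart_divisor (tri_dual tt) yt isT.
move=> Z /total_component [-> //|[t' [k [tt' _ ->]]]].
move=> /(divisorE _ _ tt') /(chart_sub St xt) /(vertex_in_face tt' tt) [j _ ->].
by exists j.
Qed.

Lemma rank_coord n (k : 'I_n) (z : affine_space R n) :
  \rank (\matrix_(i < 1, j < n) eval (mderiv j ('X_k : {mpoly C[n]})) z) = 1%N.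
Proof.
have -> : \matrix_(i < 1, j < n) eval (mderiv j ('X_k : {mpoly C[n]})) z = delta_mx 0 k.
  apply/matrixP => i j; rewrite !mxE ord1 eqxx /= mderivX mnm1E /eval mevalZ eq_sym.
  case: (eqVneq j k) => [->|_]; last by rewrite mul0r.
  by rewrite mul1r mevalX big1 // => h _; rewrite mnmBE subnn expr0.
by rewrite mxrank_delta.
Qed.

End Divisors.

(** * The embedded resolution *)

Section Embedded.
Variable R : realType.
Local Notation C := R[i].
Local Notation S := (@e8fan R).
Local Notation X := (toric_variety S).
Local Notation A3 := (affine_space R 3).
Local Notation pi := (toric_morphism S).
Local Notation XT := (strict_transform S (E8 R)).
Local Notation TT := (@total_transform R S (E8 R)).
Local Notation o2 := (ord_max : 'I_3).
Local Notation chart t := (toric_chart (cof (gen t) predT) : set X).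
Implicit Types (x y : X) (m u : N).

Lemma toric_smooth : smooth 3 X.
Proof.
move=> x; have gX := @good_toric R; have [t tt xt] := max_chart x.
have [par l] := chart_iso (tri_dual tt) (e8fan_cof R predT tt).
apply: (@smooth_local R 3 0 X X id setT (coords (dgen t)) par (chart t) (chart_image predT)
  (fun=> 0) x gX gX (emb_id gX)) => //.
- by move=> y _; exists y.
- by move=> y _; split => // _ [].
- by apply/eqP; rewrite -leqn0 rank_leq_row.
Qed.

Lemma component_smooth (Z : set X) : component TT Z -> smooth 2 (sub_space Z).
Proof.
move=> cZ p; have gX := @good_toric R.
have [f [g [U [W [D [l Up hD hZ]]]]]] := adapted_chart (sval p).
have [k eZ] := hZ _ cZ (svalP p).
apply: (@smooth_local R 2 1 X (sub_space Z) sval Z f g U W (fun=> 'X_k) p gX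
  (good_sub Z gX) (emb_sval Z gX) _ _ l Up).
- by move=> y; exact: svalP.
- by move=> y Zy; exists (exist _ y Zy).
- move=> y Uy; rewrite eZ hD //; split=> [h i|/(_ 0)]; by rewrite evalX.
- exact: rank_coord.
Qed.

Lemma total_transversal : components_meet_transversally TT.
Proof.
move=> p k Z injZ hZ; have gX := @good_toric R.
have [f [g [U [W [D [l Up hD hC]]]]]] := adapted_chart p.
have /choice [c hc] : forall i, exists j, Z i = D j.
  by move=> i; have [ci Zp] := hZ i; exact: hC.
apply: (transversal_coord gX l Up (c := c)).
- by move=> i j e; apply: injZ; rewrite !hc e.
- by move=> i; case: (hZ i).
- by move=> i y Uy; rewrite hc; exact: hD.
Qed.

Lemma generic_point (O : set A3) z : zopen O -> O z ->
  exists2 z', O z' & forall k, z' 0 k != 0.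
Proof.
move=> oO Oz; have [r [r0 hr]] := line_open (const_mx 1) oO Oz.
pose q := r * \prod_(i < 3) ((z 0 i)%:P + 'X).
have q0 : q != 0.
  rewrite mulf_neq0 ?(nz_at0 r0) //; apply/prodf_neq0 => i _.
  by rewrite addrC -size_poly_eq0 size_XaddC.
have [c] := poly_nonroot q0; rewrite hornerM mulf_eq0 negb_or => /andP[/hr Oc].
rewrite horner_prod => /prodf_neq0 hc; exists (z + c *: const_mx 1) => // k.
by have := hc k isT; rewrite hornerD hornerC hornerX !mxE mulr1.
Qed.

Definition axes (k : 'I_3) : N := delta_mx 0 k.
Definition unit3 : set A3 := [set z : A3 | forall k, z 0 k != 0].

Lemma axes_dual : dualb axes axes 1.
Proof.
split=> // i j; rewrite pr_delta mxE eqxx /=; by case: eqP.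
Qed.

Lemma cof_pred0 (B : 'I_3 -> N) : @cof R B pred0 = [set 0].
Proof.
apply/seteqP; split => [w [c [hc ->]]|w ->].
  by apply: big1 => k _; rewrite (proj2 (hc k)) ?scale0r.
by exists (fun=> 0); split => //; rewrite big1 // => k _; rewrite scale0r.
Qed.

Lemma zero_fan : S (cof axes pred0).
Proof.
rewrite cof_pred0 -(cof_pred0 (gen (head (((0,0,0),(0,0,0),(0,0,0)) : simplex) tris))).
exact: e8fan_cof.
Qed.

Lemma torusE x : torus x <-> toric_chart (cof axes pred0) x.
Proof.
split=> [tx|xt]; first exact: torus_in_face zero_fan tx.
by rewrite /torus /= (chart_orb axes_dual xt) -(cof_pred0 axes); apply: eq_cof.
Qed.

(** The torus is the chart of the zero cone, for which the standard basis provides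
  coordinates as well as any other. *)
Lemma torus_iso : exists g, @local_iso R X A3 pi g (@torus R S) unit3.
Proof.
have [g l] := chart_iso axes_dual zero_fan; exists g.
have -> : @torus R S = toric_chart (cof axes pred0).
  by apply/seteqP; split => x /torusE.
have -> : unit3 = chart_image (R := R) pred0.
  by apply/seteqP; split => z h k //; exact: h.
exact: l.
Qed.

Lemma torus_dense : zdense (@torus R S).
Proof.
move=> O oO [x Ox]; have [t tt xt] := max_chart x.
have [par l] := chart_iso (tri_dual tt) (e8fan_cof R predT tt).
have Wz (z : A3) : chart_image (R := R) predT z by move=> k.
have [U [oU Uz hU]] : around (coords (dgen t) x) (fun z => O (par z)).
  by apply: (proj1 (li_gm l (Wz _))) => //; rewrite (li_gf l xt).
have [z /hU Oz nz] := generic_point oU Uz; exists (par z); split => //.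
have yt := li_g l (Wz z); rewrite /torus /= (chart_orb (tri_dual tt) yt).
rewrite -(cof_pred0 (gen t)); apply: eq_cof => // k /=.
have := li_fg l (Wz z) => /rowP /(_ k); rewrite mxE => ->.
by rewrite (negPf (nz k)).
Qed.

Lemma unit3_open : zopen unit3.
Proof. by have [g l] := torus_iso; exact: (li_openV l). Qed.

Lemma toric_birational : birational (pi : X -> A3).
Proof.
have [g l] := torus_iso; have gX := @good_toric R; have gA := good_affine R 3.
have H := emb_iso (A := setT) (B := setT) (good_sub (@torus R S) gX) (good_sub unit3 gA)
  (emb_sval _ gX) (emb_sval _ gA) l.
have [||||//|phi [iphi hphi]] := H.
- by case=> x tx; split.
- by move=> x [tx _]; exists (exist _ x tx).
- by case=> z uz; split.
- by move=> z [uz _]; exists (exist _ z uz).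
exists (@torus R S), unit3, phi; split => //.
- by split; [exact: (li_openU l)|exact: torus_dense].
- split; first exact: unit3_open.
  move=> O oO [z Oz]; have [z' Oz' nz] := generic_point oO Oz.
  by exists z'.
Qed.

Lemma E8_embedded : embedded_resolution S (E8 R).
Proof.
split; [exact: toric_proper|exact: toric_birational|exact: toric_smooth|
  exact: component_smooth|exact: total_transversal].
Qed.

(** ** The strict transform over the surface *)

Definition surface_rhs : {mpoly C[3]} := - ('X_1 ^+ 3 + 'X_0 ^+ 5).

Lemma flatE (q : A3) (i : 'I_3) : i != o2 -> flat o2 q 0 i = q 0 i.
Proof. by move=> /negPf h; rewrite mxE h. Qed.

Lemma E8E (q : A3) : E8 R q <-> q 0 o2 ^+ 2 + (q 0 1 ^+ 3 + q 0 0 ^+ 5) = 0.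
Proof.
have ev : eval (E8_poly R) q = q 0 o2 ^+ 2 + (q 0 1 ^+ 3 + q 0 0 ^+ 5).
  rewrite /E8_poly !evalD !evalXn !evalX addrA.
  by have -> : (2%:R : 'I_3) = o2 by apply: val_inj.
by rewrite -ev; split=> [h|h p ->]; [exact: h|].
Qed.

Lemma E8P (q : A3) : E8 R q <-> q 0 o2 ^+ 2 = eval surface_rhs (flat o2 q).
Proof.
have -> : eval surface_rhs (flat o2 q) = - (q 0 1 ^+ 3 + q 0 0 ^+ 5).
  by rewrite /surface_rhs /eval rmorphN rmorphD !rmorphXn /= !mevalXU !flatE.
by rewrite E8E; split=> [/eqP|->]; [rewrite addr_eq0 => /eqP|rewrite addNr].
Qed.

Lemma E8_poly_split (P : {mpoly C[3]}) : exists A B, forall q : A3, E8 R q ->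
  eval P q = eval A (flat o2 q) + q 0 o2 * eval B (flat o2 q).
Proof.
elim/eval_ind: P => [c|i|P Q [A hA] [B hB]|P Q [A hA] [B hB]].
- by exists c%:MP, 0%:MP => q _; rewrite !evalC mulr0 addr0.
- have [->|io] := eqVneq i o2.
    by exists 0%:MP, 1%:MP => q _; rewrite !evalC evalX mulr1 add0r.
  by exists 'X_i, 0%:MP => q _; rewrite evalC !evalX mulr0 addr0 flatE.
- move: hA hB => [A' hA] [B' hB]; exists (A + B), (A' + B') => q hq.
  by rewrite !evalD hA // hB //; ring.
- move: hA hB => [A' hA] [B' hB].
  exists (A * B + surface_rhs * (A' * B')), (A * B' + A' * B) => q hq.
  by rewrite !(evalD, evalM) hA // hB // -(proj1 (E8P q) hq); ring.
Qed.

(** The part of the surface off the coordinate planes is dense: modulo the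
  equation a polynomial is a + bz, and the reflection z -> -z shows that it
  vanishes there only if a and b do. *)
Lemma surface_dense (O : set A3) p : zopen O -> O p -> E8 R p ->
  exists q, [/\ O q, E8 R q & unit3 q].
Proof.
move=> oO Op Ep; have [P Pp hP] := affine_open oO Op.
have [A [B hAB]] := E8_poly_split P.
have [Q Qp hQ] : exists2 Q, eval Q (flat o2 p) != 0 & Q = A \/ Q = B.
  have [a0|an] := eqVneq (eval A (flat o2 p)) 0; last by exists A => //; left.
  exists B; last by right.
  by apply: contraNneq Pp => b0; rewrite hAB // a0 b0 mulr0 addr0.
pose L : set A3 := [set z : A3 | z 0 o2 = 0].
have irL : irreducible (L `&` [set z | eval (1%:MP : {mpoly C[3]}) z != 0]).
  apply: irreducible_linear.
    by move=> x y c; rewrite /L /= => xk yk; rewrite !mxE xk yk subrr mulr0 addr0.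
  by exists 0; rewrite /L /= mxE evalC; split => //; exact: oner_neq0.
have Lflat (z : A3) : L (flat o2 z) by rewrite /L /= mxE eqxx.
pose W : {mpoly C[3]} := 'X_0 * 'X_1 * surface_rhs.
have [w [[Lw _] Qw Ww]] : exists w, [/\ (L `&` [set z | eval (1%:MP : {mpoly C[3]}) z != 0]) w,
    [set z | eval Q z != 0] w & [set z | eval W z != 0] w].
  apply: (proj2 (proj1 (irreducibleP _) irL)); [exact: poly_open|exact: poly_open| |].
    by exists (flat o2 p); split => //; split => //=; rewrite evalC oner_neq0.
  pose one : A3 := const_mx 1.
  exists (flat o2 one); split; first by split => //=; rewrite evalC oner_neq0.
  rewrite /= !evalM !evalX !flatE // !mxE !mul1r.
  rewrite /surface_rhs /eval rmorphN rmorphD !rmorphXn /= !mevalXU !flatE // !mxE.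
  by rewrite !expr1n oppr_eq0 -mulr2n pnatr_eq0.
move: Ww; rewrite /= !evalM !evalX !mulf_eq0 !negb_or => /andP[/andP[w0 w1] ws].
pose z0 := sqrtc (eval surface_rhs w).
have z0n : z0 != 0 by rewrite sqrtc_eq0.
pose pt (c : C) : A3 := \row_k (if k == o2 then c else w 0 k).
have fpt c : flat o2 (pt c) = w.
  apply/rowP => k; rewrite mxE; case: eqP => [->|/eqP kn]; first by rewrite Lw.
  by rewrite mxE (negPf kn).
have ptE c : c ^+ 2 = eval surface_rhs w -> E8 R (pt c).
  by move=> h; apply/E8P; rewrite fpt mxE eqxx.
have u c : c != 0 -> unit3 (pt c).
  move=> c0 k; rewrite mxE; case: (eqVneq k o2) => // kn.
  have [->|->] := ea_cases (kn : ea k).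
    exact: w0.
  exact: w1.
have sq : z0 ^+ 2 = eval surface_rhs w by rewrite sqr_sqrtc.
have sqN : (- z0) ^+ 2 = eval surface_rhs w by rewrite sqrrN.
have [P1|P1] := eqVneq (eval P (pt z0)) 0; last first.
  by exists (pt z0); split; [exact: hP|exact: ptE|exact: u].
exists (pt (- z0)); split; [|exact: ptE|by apply: u; rewrite oppr_eq0].
apply: hP; apply: contraNneq Qw => P2.
move: P1 P2; rewrite !hAB ?fpt; [|exact: ptE|exact: ptE].
rewrite !mxE eqxx => e1 e2.
have a0 : eval A w = 0.
  have : eval A w *+ 2 = 0 by rewrite -[RHS](addr0 0) -{1}e1 -{1}e2; ring.
  by move/eqP; rewrite mulrn_eq0 /= => /eqP.
have b0 : eval B w = 0.
  by move: e1; rewrite a0 add0r => /eqP; rewrite mulf_eq0 (negPf z0n) => /eqP.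
by case: hQ => ->; rewrite ?a0 ?b0.
Qed.

Lemma strict_pi x : XT x -> E8 R (pi x).
Proof. exact: strict_total. Qed.

Definition surface_map (x : sub_space XT) : sub_space (E8 R) :=
  exist _ (pi (sval x)) (strict_pi (svalP x)).

Lemma torus_strict x : torus x -> (XT x <-> E8 R (pi x)).
Proof.
by move=> tx; split; [exact: strict_pi|move=> Ex; apply: sub_closure; split].
Qed.

Lemma surface_birational : birational surface_map.
Proof.
have [g l] := torus_iso; have gX := @good_toric R; have gA := good_affine R 3.
have gS := good_sub XT gX; have gE := good_sub (E8 R) gA.
have H := emb_iso (A := XT) (B := E8 R)
  (good_sub (trace (@torus R S) : set (sub_space XT)) gS)
  (good_sub (trace unit3 : set (sub_space (E8 R))) gE)
  (emb_sub_sub _ gX) (emb_sub_sub _ gA) l.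
have [|||||phi [iphi hphi]] := H.
- by case=> -[x Xx] tx; split.
- by move=> x [tx Xx]; exists (exist _ (exist _ x Xx) tx).
- by case=> -[z Ez] uz; split.
- by move=> z [uz Ez]; exists (exist _ (exist _ z Ez) uz).
- by move=> x tx; exact: torus_strict.
exists (trace (@torus R S)), (trace unit3), phi; split => //.
- split; first by exists (@torus R S) => //; exact: (li_openU l).
  move=> _ [O oO ->] [x Ox]; have [y [Oy hy]] := svalP x O oO Ox.
  by exists (exist _ y (sub_closure hy)); split => //; case: hy.
- split; first by exists unit3 => //; exact: unit3_open.
  move=> _ [O oO ->] [p Op]; have [q [Oq Eq uq]] := surface_dense oO Op (svalP p).
  by exists (exist _ q Eq).
by move=> x; apply: (emb_inj (emb_sval _ gA)); rewrite hphi.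
Qed.

Lemma strict_smooth : smooth 2 (sub_space XT).
Proof.
move=> p; have gX := @good_toric R; have [e he pe] := strict_edge (svalP p).
have [f [g [d [l hX _ _]]]] := edge_chart R he.
apply: (@smooth_local R 2 1 X (sub_space XT) sval XT f g _ _ (fun=> 'X_o2) p gX
  (good_sub XT gX) (emb_sval XT gX) _ _ l pe).
- by move=> y; exact: svalP.
- by move=> y Zy; exists (exist _ y Zy).
- move=> y Uy; rewrite hX //; split=> [h i|/(_ 0)]; by rewrite evalX.
- exact: rank_coord.
Qed.

Lemma surface_resolution : resolution surface_map.
Proof.
split.
- exact: closed_variety (@strict_closed R).
- have -> : [set: sub_space XT] = trace (XT : set X).
    by apply/seteqP; split => x // _; exact: svalP.
  by apply: irreducible_trace => //; [exact: good_toric|exact: strict_irreducible].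
- exact: strict_smooth.
- by apply: sub_proper (@strict_closed R) _.
- exact: surface_birational.
Qed.

End Embedded.

(** * The exceptional curves *)

(** The ends of an edge as members of its triple. *)
Definition w2 (k : 'I_2) : 'I_3 := widen_ord (isT : (2 <= 3)%N) k.
Definition oth (j : 'I_2) : 'I_2 := if j == 0 then 1 else 0.

Lemma ea_w2 k : ea (w2 k).
Proof. by case: k => [[|[|//]]]. Qed.

Lemma w2_onto k : ea k -> exists j, k = w2 j.
Proof. by case/ea_cases => ->; [exists 0|exists 1]; apply: val_inj. Qed.

Lemma w2_inj : injective w2.
Proof. by move=> i j /(congr1 val) /= /val_inj. Qed.

Lemma othE j i : (i != j) = (i == oth j).
Proof. by case: j => [[|[|//]]] ?; case: i => [[|[|//]]]. Qed.

Lemma oth_neq j : oth j != j.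
Proof. by rewrite othE. Qed.

Definition exc_edges (z : zvec) : seq (edge * 'I_2) :=
  [seq (e, 0) | e <- tropical_edges & (esim e).1.1 == z] ++
  [seq (e, 1) | e <- tropical_edges & (esim e).1.2 == z].

Lemma edge_exc_check : all (fun e => ((esim e).1.2 \in exc_pts) &&
  (((esim e).1.1 \in exc_pts) || has (fun k => sel (esim e).1.1 k == 0) (iota 0 3))) tropical_edges.
Proof. by vm_compute. Qed.

Lemma exc_edge_check : all (fun z : zvec => has (fun e => (esim e).1.1 == z) tropical_edges ||
  has (fun e => (esim e).1.2 == z) tropical_edges) exc_pts.
Proof. by vm_compute. Qed.

Section Curves.
Variable R : realType.
Local Notation C := R[i].
Local Notation S := (@e8fan R).
Local Notation X := (toric_variety S).
Local Notation A3 := (affine_space R 3).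
Local Notation A2 := (affine_space R 2).
Local Notation pi := (toric_morphism S).
Local Notation XT := (strict_transform S (E8 R)).
Local Notation Y := (sub_space XT).
Local Notation o2 := (ord_max : 'I_3).
Local Notation echart e := (toric_chart (cof (gen (esim e)) ea) : set X).
Implicit Types (x y : Y) (m u : N) (e : edge).

Let gX : good X := @good_toric R.
Let gA2 : good A2 := good_affine R 2.
Let gY : good Y := good_sub XT (@good_toric R).
Let eY : emb (sval : Y -> X) := emb_sval XT (@good_toric R).

(** The inclusion of the plane in which the equation of the strict transform
  vanishes. *)
Definition lift3 (z : A2) : A3 :=
  \row_k (if k == o2 then 0 else if k == 0 then z 0 0 else z 0 1).

Definition strict_image e : set A2 :=
  [set z : A2 | 1 + z 0 0 ^+ eord e * z 0 1 ^+ (eord e).-1 != 0].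

Lemma lift3_w2 z k : lift3 z 0 (w2 k) = z 0 k.
Proof.
rewrite mxE (negPf (ea_w2 k)); case: k => [[|[|//]]] h /=; congr (z 0 _); exact: val_inj.
Qed.

Lemma lift3_image e z : eimage e (lift3 z) <-> strict_image e z.
Proof.
rewrite /eimage /strict_image /= /emonom !mxE /=.
by rewrite sub0r oppr_eq0.
Qed.

Lemma lift3_mor (z : A2) : mor_at (lift3 : A2 -> A3) z.
Proof.
apply: (mor_affine gA2) => k.
have [k2|k2] := eqVneq k o2.
  have := germ_cst gA2 z 0; congr germ; apply/funext => y.
  by rewrite mxE k2 eqxx.
have [k0|k0] := eqVneq k 0.
  by have := coord_germ 0 z; congr germ; apply/funext => y; rewrite mxE (negPf k2) k0 eqxx.
by have := coord_germ 1 z; congr germ; apply/funext => y; rewrite mxE (negPf k2) (negPf k0).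
Qed.

(** The strict transform is covered by ten open subsets of the plane, one for
  each edge of the tropical part of the fan. *)
Lemma strict_chart e : e \in tropical_edges -> exists f g,
  @local_iso R Y A2 f g (trace (echart e)) (strict_image e) /\
  forall x k, f x 0 k = chr (sval x) (dgen (esim e) (w2 k)).
Proof.
move=> he; have [f [g [d [l hX hk _]]]] := edge_chart R he.
have imP z : strict_image e z -> eimage e (lift3 z) by move/lift3_image.
have Xg z : strict_image e z -> XT (g (lift3 z)).
  move=> /imP Vz; apply/hX; first exact: (li_g l).
  by rewrite (li_fg l Vz) mxE eqxx.
have z1 : strict_image e (0 : 'rV[C]_2).
  rewrite /strict_image /= !mxE.
  have /andP[/and3P[_ p0 _] _] := edgeP he.
  by case: (eord e) p0 => // p _; rewrite expr0n mul0r addr0 oner_neq0.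
have /choice [g2 hg2] : forall z, exists y : Y, strict_image e z -> sval y = g (lift3 z).
  move=> z; have [Vz|nV] := pselect (strict_image e z).
    by exists (exist _ _ (Xg _ Vz)).
  by exists (exist _ _ (Xg _ z1)).
pose f2 (x : Y) : A2 := \row_k chr (sval x) (dgen (esim e) (w2 k)).
have ff x : echart e (sval x) -> lift3 (f2 x) = f (sval x).
  move=> xe; apply/rowP => k; have [->|k2] := eqVneq k o2.
    by rewrite mxE eqxx; apply/esym/hX => //; exact: svalP.
  have [j ->] := w2_onto k2.
  by rewrite lift3_w2 mxE hk //; exact: ea_w2.
have fV x : echart e (sval x) -> strict_image e (f2 x).
  by move=> xe; apply/lift3_image; rewrite ff //; exact: (li_f l).
have gU z : strict_image e z -> echart e (sval (g2 z)).
  by move=> Vz; rewrite hg2 //; apply: (li_g l); exact: imP.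
have oV : zopen (strict_image e).
  have -> : strict_image e = [set z | eval (1%:MP + 'X_0 ^+ eord e * 'X_1 ^+ (eord e).-1) z != 0].
    by apply/seteqP; split => z; rewrite /= evalD evalM !evalXn !evalX evalC.
  exact: poly_open.
exists f2, g2; split; last by move=> x k; rewrite mxE.
split.
- by exists (echart e) => //; exact: chart_open (edge_fan R he).
- exact: oV.
- exact: fV.
- exact: gU.
- move=> x xe; apply: (emb_inj eY); rewrite hg2; last exact: fV.
  by rewrite ff // (li_gf l).
- move=> z Vz; apply/rowP => k; rewrite mxE hg2 // -hk; last exact: ea_w2.
  by rewrite (li_fg l (imP _ Vz)) lift3_w2.
- move=> x xe; apply: (mor_affine gY) => k.
  have dk : @dual_lattice R (cof (gen (esim e)) ea) (dgen (esim e) (w2 k)).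
    by apply: dual_coord; exact: edge_dual.
  have := proj2 (emb_mor x eY) _ (chr_germ (edge_fan R he) xe dk).
  by congr germ; apply/funext => y; rewrite mxE.
- move=> z Vz; apply: (emb_factor gA2 eY).
  apply: (mor_eq (f := g \o lift3) gA2).
    by exists (strict_image e); split => // y Vy /=; rewrite hg2.
  apply: mor_comp; first exact: lift3_mor.
  by apply: (li_gm l); exact: imP.
Qed.

Definition exc_curve u : set Y := trace (toric_divisor S u).

Lemma exc_vertex z : z \in exc_pts -> exists t k, [/\ t \in tris, vz z = gen t k & posz z].
Proof.
move=> hz; have /allP/(_ _ hz)/and3P[/verticesP [t [k tt e]] pz _] := exc_check.
by exists t, k; rewrite /gen -e.
Qed.

Lemma exc_curveE z x : z \in exc_pts -> exc_curve (vz z) x <-> orb (sval x) (lat R (vz z)).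
Proof. by move=> /exc_vertex [t [k [tt -> _]]]; exact: divisorE. Qed.

Lemma exc_curve_closed u : zclosed (exc_curve u).
Proof. by apply: closed_sub; exact: divisor_closed. Qed.

Lemma exc_curve_edge z x : z \in exc_pts -> exc_curve (vz z) x -> exists e j,
  [/\ e \in tropical_edges, echart e (sval x) & gen (esim e) (w2 j) = vz z].
Proof.
move=> hz /(exc_curveE _ hz) ox; have [e he xe] := strict_edge (svalP x).
have [t [k [tt ez _]]] := exc_vertex hz.
have := chart_sub (edge_fan R he) xe ox; rewrite ez => /(edge_vertex he tt) [k' ak ->].
by have [j ->] := w2_onto ak; exists e, j.
Qed.

Lemma exc_curve_coord e j z x (f : Y -> A2) : e \in tropical_edges -> z \in exc_pts ->
  gen (esim e) (w2 j) = vz z -> echart e (sval x) ->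
  (forall x k, f x 0 k = chr (sval x) (dgen (esim e) (w2 k))) ->
  exc_curve (vz z) x <-> f x 0 j = 0.
Proof.
move=> he hz ez xe hf; rewrite exc_curveE // -ez hf.
exact: chart_divisor (edge_dual he) xe (ea_w2 j).
Qed.

Definition axis_pt (j : 'I_2) (c : C) : A2 := \row_k (if k == j then 0 else c).

(** The chart omits at most the point with parameter -1 of each axis. *)
Lemma axis_image e j (n : nat) : e \in tropical_edges -> strict_image e (axis_pt j n%:R).
Proof.
move=> /edgeP /andP[/and3P[_ p0 _] _]; rewrite /strict_image /= !mxE.
case: (eord e) p0 => // p _; case: (eqVneq 0 j) => [<-|j0].
  by rewrite expr0n mul0r addr0 oner_neq0.
have -> : (1 == j) = true by case: j j0 => [[|[|//]]].
rewrite expr0n; case: p => [|p] /=; last by rewrite mulr0 addr0 oner_neq0.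
by rewrite mulr1 expr1 -(natrD _ 1) pnatr_eq0.
Qed.

Lemma axis_pt_j j c : axis_pt j c 0 j = 0.
Proof. by rewrite mxE eqxx. Qed.

Lemma axis_pt_oth j c : axis_pt j c 0 (oth j) = c.
Proof. by rewrite mxE (negPf (oth_neq j)). Qed.

Lemma A2_eq (a b : A2) j : a 0 j = b 0 j -> a 0 (oth j) = b 0 (oth j) -> a = b.
Proof.
move=> e1 e2; apply/rowP => k; have [->//|] := eqVneq k j.
by rewrite othE => /eqP ->.
Qed.

Lemma line_coord (p v : A2) c k : (p + c *: v) 0 k = p 0 k + c * v 0 k.
Proof. by rewrite !mxE. Qed.

(** The parameter 0 gives the crossing at the other end of the edge. *)
Lemma exc_curve_point e j z (n : nat) : e \in tropical_edges -> z \in exc_pts -> gen (esim e) (w2 j) = vz z ->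
  exists x, [/\ exc_curve (vz z) x, echart e (sval x) &
    chr (sval x) (dgen (esim e) (w2 (oth j))) = n%:R].
Proof.
move=> he hz ez; have [f [g [l hf]]] := strict_chart he.
have Vz := axis_image j n he; have Ug := li_g l Vz.
exists (g (axis_pt j n%:R)); split => //; last by rewrite -hf (li_fg l Vz) axis_pt_oth.
by apply/(exc_curve_coord he hz ez Ug hf); rewrite (li_fg l Vz) axis_pt_j.
Qed.

Lemma ray_fan z : z \in exc_pts -> S (ray R (vz z)).
Proof.
by move=> /exc_vertex [t [k [tt -> _]]]; rewrite rayE; exact: e8fan_cof.
Qed.

Lemma orb_ray e j z x : e \in tropical_edges -> z \in exc_pts -> gen (esim e) (w2 j) = vz z ->
  echart e (sval x) -> chr (sval x) (dgen (esim e) (w2 (oth j))) != 0 ->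
  toric_chart (ray R (vz z)) (sval x).
Proof.
move=> he hz ez xe nz; apply: chart_of_sub; first exact: ray_fan.
rewrite (chart_orb (edge_dual he) xe) -ez rayE; apply: cof_sub => k /andP[ak /eqP ck].
have [i ei] := w2_onto ak; exists k => //=; rewrite ei in ck *.
have [-> //|] := eqVneq i j; rewrite othE => /eqP ei'.
by move: nz; rewrite -ei' ck eqxx.
Qed.

Lemma ray_edge e j z x : e \in tropical_edges -> z \in exc_pts -> gen (esim e) (w2 j) = vz z ->
  toric_chart (ray R (vz z)) (sval x) -> echart e (sval x).
Proof.
move=> he hz ez xr; apply: chart_of_sub; first exact: edge_fan.
move=> w /(chart_sub (ray_fan hz) xr); rewrite -ez rayE.
by apply: cof_mono => k /eqP ->; exact: ea_w2.
Qed.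

Lemma exc_curve_chart_irreducible e j z : e \in tropical_edges -> z \in exc_pts ->
  gen (esim e) (w2 j) = vz z ->
  irreducible (exc_curve (vz z) `&` [set x | echart e (sval x)]).
Proof.
move=> he hz ez; have [f [g [l hf]]] := strict_chart he.
pose L : set A2 := [set z : A2 | z 0 j = 0].
pose Q : {mpoly C[2]} := 1%:MP + 'X_0 ^+ eord e * 'X_1 ^+ (eord e).-1.
have evQ p : eval Q p = 1 + p 0 0 ^+ eord e * p 0 1 ^+ (eord e).-1.
  by rewrite evalD evalM !evalXn !evalX evalC.
have -> : exc_curve (vz z) `&` [set x | echart e (sval x)] = g @` (L `&` [set p | eval Q p != 0]).
  apply/seteqP; split => [x [Ex xe]|_ [p [pL Qp] <-]].
    exists (f x); last exact: (li_gf l).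
    split; first exact/(exc_curve_coord he hz ez xe hf).
    by rewrite /= evQ; exact: (li_f l xe).
  rewrite /= evQ in Qp; have Vp : strict_image e p by [].
  have Up := li_g l Vp; split => //.
  by apply/(exc_curve_coord he hz ez Up hf); rewrite (li_fg l Vp).
apply: irreducible_image => //.
  by move=> p [_ Qp]; rewrite /= evQ in Qp; exact: (li_gm l).
apply: irreducible_linear.
  by move=> p q c; rewrite /L /= => pk qk; rewrite !mxE pk qk subrr mulr0 addr0.
exists (axis_pt j 1%:R); split; first exact: axis_pt_j.
by rewrite /= evQ; exact: axis_image.
Qed.

Lemma ray_open z : z \in exc_pts -> zopen [set x : Y | toric_chart (ray R (vz z)) (sval x)].
Proof. by move=> hz; exists (toric_chart (ray R (vz z))) => //; exact: chart_open (ray_fan hz). Qed.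

Lemma echart_open e : e \in tropical_edges -> zopen [set x : Y | echart e (sval x)].
Proof. by move=> he; exists (echart e) => //; exact: chart_open (edge_fan R he). Qed.

(** The orbit of the ray is dense in each chart of the curve and contained in
  all of them, which makes the whole curve irreducible. *)
Lemma exc_curve_irreducible z : z \in exc_pts -> irreducible (exc_curve (vz z)).
Proof.
move=> hz.
have dense (O : set Y) x : zopen O -> O x -> exc_curve (vz z) x -> exists y,
    [/\ O y, exc_curve (vz z) y & toric_chart (ray R (vz z)) (sval y)].
  move=> oO Ox Ex; have [e [j [he xe ez]]] := exc_curve_edge hz Ex.
  have /irreducibleP [_ ir] := exc_curve_chart_irreducible he hz ez.
  have [y [Ey ye cy]] := exc_curve_point 1 he hz ez.
  have [||q [[Eq _] Oq rq]] := ir O _ oO (ray_open hz); [by exists x| |by exists q].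
  exists y; split => //; apply: (orb_ray he hz ez ye).
  by rewrite cy oner_neq0.
apply/irreducibleP; split.
  have /allP/(_ _ hz) := exc_edge_check; case/orP => /hasP [e he /eqP ez].
    have [|x [Ex _ _]] := @exc_curve_point e 0 z 1 he hz; last by exists x.
    by rewrite -ez /gen /=.
  have [|x [Ex _ _]] := @exc_curve_point e 1 z 1 he hz; last by exists x.
  by rewrite -ez /gen /=.
move=> O O' oO oO' [x [Ex Ox]] [x' [Ex' Ox']].
have [y [Oy Ey ry]] := dense _ _ oO Ox Ex.
have [y' [Oy' Ey' ry']] := dense _ _ oO' Ox' Ex'.
have [e [j [he ye ez]]] := exc_curve_edge hz Ey.
have /irreducibleP [_ ir] := exc_curve_chart_irreducible he hz ez.
have [||q [[Eq _] Oq Oq']] := ir O O' oO oO'; last by exists q.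
  by exists y.
by exists y'; split => //; split => //; exact: ray_edge he hz ez ry'.
Qed.

Lemma closed_point (p : Y) : zclosed [set p].
Proof.
apply: (openP gY) => q qp.
have ne : sval p <> sval q by move=> e; apply: qp; rewrite /=; apply: (emb_inj eY).
have [U [W [h [k [F [[oU oW Up Wq] hh hk hF [e0 e1]]]]]]] := split_sub gX (toric_split ne).
have gF := hF _ _ _ _ gY (germ_cst gY q (h p)) (hk _ Wq).
apply: (around_mono2 gY _ (open_around oW Wq) (germ_neq0 gY gF e1)) => y Wy nz yp.
by move: nz; rewrite yp in Wy *; rewrite e0 ?eqxx.
Qed.

Lemma horner_germ (r : {poly C}) (Z : space R) (z : Z) h : good Z -> germ z h ->
  germ z (fun w => r.[h w]).
Proof.
move=> gZ gh.
have := germ_sum gZ (index_enum 'I_(size r)) (fun i : 'I_(size r) => germM gZ (germ_cst gZ z r`_i)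
  (germX gZ i gh)).
by congr germ; apply/funext => w; rewrite horner_coef.
Qed.

(** A proper closed subset of the curve is finite in each chart, hence an
  irreducible one is a point. *)
Lemma exc_curve_curve z : z \in exc_pts -> curve (exc_curve (vz z)).
Proof.
move=> hz; have irE := exc_curve_irreducible hz; split => //; first exact: exc_curve_closed.
  move=> p e; have [[x0 Ex0] _] := irE; have [d [j [hd _ ez]]] := exc_curve_edge hz Ex0.
  have [x [Ex _ cx]] := exc_curve_point 1 hd hz ez; have [y [Ey _ cy]] := exc_curve_point 2 hd hz ez.
  rewrite e in Ex Ey; rewrite Ex in cx; rewrite Ey in cy.
  by move: cx; rewrite cy => /eqP; rewrite eqr_nat.
move=> F cF irF FE nE; have [[p Fp] irF2] := irF.
have Ep := FE _ Fp; have [e [j [he pe ez]]] := exc_curve_edge hz Ep.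
have [f [g [l hf]]] := strict_chart he.
have [q [Eq qe nFq]] : exists q, [/\ exc_curve (vz z) q, echart e (sval q) & ~ F q].
  apply: contrapT => no; apply: nE; apply/seteqP; split => // q Eq.
  apply: contrapT => nFq; have /irreducibleP [_ ir] := irE.
  have [||y [Ey Fy ye]] := ir _ _ cF (echart_open he); [by exists q|by exists p|].
  by apply: no; exists y.
have Vq := li_f l qe.
have [U [oU Uq hU]] : around (f q) (fun z => strict_image e z /\ ~ F (g z)).
  apply: (around_and gA2).
    by exists (strict_image e); split => //; exact: (li_openV l).
  by apply: (proj1 (li_gm l Vq) _ cF); rewrite /= (li_gf l qe).
have [r [r0 hr]] := line_open (axis_pt j 1 : 'rV[C]_2) oU Uq.
have fqj := proj1 (exc_curve_coord he hz ez qe hf) Eq.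
pose cq := f q 0 (oth j).
have key x : exc_curve (vz z) x -> echart e (sval x) -> r.[f x 0 (oth j) - cq] != 0 -> ~ F x.
  move=> Ex xe /hr Ux; have [_] := hU _ Ux.
  suff -> : f q + (f x 0 (oth j) - cq) *: (axis_pt j 1 : 'rV[C]_2) = f x.
    by rewrite (li_gf l xe).
  have fxj := proj1 (exc_curve_coord he hz ez xe hf) Ex.
  apply: (A2_eq (j := j)).
    by rewrite line_coord axis_pt_j mulr0 addr0 fqj fxj.
  by rewrite line_coord axis_pt_oth mulr1 /cq addrC subrK.
pose c0 := f p 0 (oth j) - cq.
have [r' [n [er nr]]] : exists r' n, r = r' * ('X - c0%:P) ^+ n /\ ~~ root r' c0.
  have [m [r' nr er]] := multiplicity_XsubC r c0; exists r', m; split => //.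
  by move: nr; rewrite (nz_at0 r0).
pose O : set Y := [set x | echart e (sval x) /\ r'.[f x 0 (oth j) - cq] != 0].
have oO : zopen O.
  apply: (openP gY) => x [xe nx].
  have gf : germ x (fun x => f x 0 (oth j) - cq).
    apply: (germB gY); last exact: (germ_cst gY).
    exact: (proj2 (li_fm l xe) _ (coord_germ (oth j) (f x))).
  by apply: (around_and gY (open_around (echart_open he) xe));
    apply: (germ_neq0 gY (horner_germ r' gY gf) nx).
have Op : O p by split => //; exact: nr.
have OF x : O x -> F x -> x = p.
  move=> [xe nx] Fx; have Ex := FE _ Fx; have fxj := proj1 (exc_curve_coord he hz ez xe hf) Ex.
  have fpj := proj1 (exc_curve_coord he hz ez pe hf) Ep.
  have [e1|ne] := eqVneq (f x 0 (oth j)) (f p 0 (oth j)).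
    have e2 : f x = f p by apply: (A2_eq (j := j)); rewrite ?fxj.
    by rewrite -(li_gf l xe) e2 (li_gf l pe).
  case: (key x Ex xe _ Fx).
  rewrite er hornerM mulf_neq0 // horner_exp expf_neq0 // !hornerE.
  by rewrite /c0 opprB addrA subrK subr_eq0.
exists p; apply/seteqP; split => [x Fx|x -> //].
have cO : zclosed (~` O) by rewrite /zclosed setCK.
have FO y : F y -> (~` O `|` [set p]) y.
  by move=> Fy; have [Oy|nO] := pselect (O y); [right; exact: OF|left].
by have [sub|sub] := irF2 _ _ cO (closed_point p) FO; [case: (sub _ Fp)|exact: sub].
Qed.

Lemma exc_curve_contracted z x : z \in exc_pts -> exc_curve (vz z) x -> pi (sval x) = 0.
Proof.
move=> hz /(exc_curveE _ hz) ox; have [t [k [tt ez pz]]] := exc_vertex hz.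
apply/rowP => i; rewrite !mxE; apply/chr_eq0 => /(_ _ ox) /eqP.
rewrite dot_lat intr_eq0 pr_delta mxE; case/and3P: pz => h0 h1 h2.
by apply/negP; rewrite gt_eqF //; case: i => [[|[|[|//]]]].
Qed.

(** At a point over the origin no coordinate function is invertible, so the cone
  of the orbit is not contained in a coordinate plane and one of its rays is
  positive. *)
Lemma over_origin x : pi (sval x) = 0 -> exists2 z, z \in exc_pts & exc_curve (vz z) x.
Proof.
move=> p0; have [e he xe] := strict_edge (svalP x); have hD := edge_dual he.
have /allP/(_ _ he)/andP[h2 h1] := edge_exc_check.
have [c1|n1] := eqVneq (chr (sval x) (dgen (esim e) (w2 1))) 0.
  exists (esim e).1.2 => //; apply/(exc_curveE _ h2).
  exact/(chart_divisor hD xe (ea_w2 1)).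
have nperp m : pr m (gen (esim e) (w2 0)) = 0 -> perp (orb (sval x)) m.
  move=> m0; rewrite (chart_orb hD xe) perp_cof => k /andP[ak /eqP ck].
  have [i ei] := w2_onto ak; rewrite ei in ck *; case: i {ei ak} ck => [[|[|//]]] h ck.
    by rewrite -m0; congr (pr m (gen _ _)); apply: val_inj.
  by case/eqP: n1; rewrite -ck; congr (chr _ (dgen _ _)); apply: val_inj.
have nzero k : perp (orb (sval x)) (delta_mx 0 k) -> False.
  move/chr_neq0; have /rowP/(_ k) := p0; rewrite !mxE => ->.
  by rewrite eqxx.
have [c0|n0] := eqVneq (chr (sval x) (dgen (esim e) (w2 0))) 0; last first.
  case: (nzero 0); rewrite (chart_orb hD xe) perp_cof => k /andP[ak /eqP ck].
  have [i ei] := w2_onto ak; rewrite ei in ck; case: i {ei ak} ck => [[|[|//]]] h ck.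
    by case/eqP: n0; rewrite -ck; congr (chr _ (dgen _ _)); apply: val_inj.
  by case/eqP: n1; rewrite -ck; congr (chr _ (dgen _ _)); apply: val_inj.
case/orP: h1 => [h1|/exists3 [k /eqP hk]].
  exists (esim e).1.1 => //; apply/(exc_curveE _ h1).
  exact/(chart_divisor hD xe (ea_w2 0)).
case: (nzero k); apply: nperp; rewrite pr_delta /gen /= mxE -[RHS]hk.
by case: k {hk} => [[|[|[|//]]]].
Qed.

End Curves.

Lemma axes_check : all (fun u : zvec =>
  has (fun t => has (fun k => sel t k == u) (iota 0 3)) tris)
  [:: (1, 0, 0); (0, 1, 0); (0, 0, 1)].
Proof. by vm_compute. Qed.

Section Exceptional.
Variable R : realType.
Local Notation S := (@e8fan R).
Local Notation pi := (toric_morphism S).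
Local Notation XT := (strict_transform S (E8 R)).
Local Notation Y := (sub_space XT).
Local Notation o2 := (ord_max : 'I_3).
Local Notation rho := (@surface_map R).
Local Notation exc_curve := (@exc_curve R).
Implicit Types (x y : Y) (m u : N) (e : edge).

Let gY : good Y := good_sub XT (@good_toric R).

Lemma axis_fan (i : 'I_3) : S (cof axes (pred1 i)).
Proof.
have [z hz ez] : exists2 z, z \in [:: (1, 0, 0); (0, 1, 0); (0, 0, 1)] & axes i = vz z.
  exists (nth (0, 0, 0) [:: (1, 0, 0); (0, 1, 0); (0, 0, 1)] i); first exact: mem_nth.
  by apply/rowP => k; rewrite !mxE; case: i => [[|[|[|//]]]] ?; case: k => [[|[|[|//]]]].
have /allP/(_ _ hz)/hasP [t tt /exists3 [k /eqP ek]] := axes_check.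
rewrite -(rayE R axes i) ez -ek (rayE R (gen t) k); exact: e8fan_cof.
Qed.

(** Away from the origin a point of the surface has at most one vanishing
  coordinate, so its fibre lies in the chart of an axis, on which the toric
  morphism is injective. *)
Lemma off_origin x y : pi (sval x) <> 0 -> pi (sval y) = pi (sval x) -> y = x.
Proof.
move=> nz exy; set q := pi (sval x) in nz exy.
have i3 (P : 'I_3 -> Prop) : P 0 -> P 1 -> P o2 -> forall k, P k.
  move=> h0 h1 h2 k; have [->//|k2] := eqVneq k o2.
  by have [->|->] := ea_cases (k2 : ea k).
have [i hi] : exists i, forall k, k != i -> q 0 k != 0.
  have /E8E := strict_pi (svalP x); rewrite -/q => eq0.
  have [q0|n0] := eqVneq (q 0 0) 0.
    rewrite q0 expr0n addr0 in eq0.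
    have n1 : q 0 1 != 0.
      apply/eqP => q1; apply: nz; rewrite q1 expr0n addr0 in eq0.
      move/eqP: eq0; rewrite expf_eq0 /= => /eqP q2.
      by apply/rowP => k; rewrite [RHS]mxE; move: k; apply: i3.
    exists 0; apply: i3 => // _; apply: contraNneq n1 => q2.
    by move/eqP: eq0; rewrite q2 expr0n add0r expf_eq0.
  have [q1|n1] := eqVneq (q 0 1) 0; last by exists o2; apply: i3.
  exists 1; apply: i3 => // _; apply: contraNneq n0 => q2.
  by move/eqP: eq0; rewrite q1 q2 !expr0n !add0r expf_eq0.
have inc (z : Y) : pi (sval z) = q -> toric_chart (cof axes (pred1 i)) (sval z).
  move=> ez; apply: chart_of_sub; first exact: axis_fan.
  move=> w ow.
  have wo : orthant R w.
    by rewrite -(e8fan_support R); exists (orb (sval z)) => //; exact: orb_fan.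
  exists (fun k => w 0 k); split=> [k|].
    split; first exact: wo.
    move=> /hi; rewrite -ez mxE => /chr_neq0 /(_ _ ow).
    rewrite /dot (bigD1 k) //= !mxE !eqxx mul1r big1 ?addr0 // => j jk.
    by rewrite !mxE (negPf jk) mul0r.
  apply/rowP => k; rewrite summxE (bigD1 k) //= !mxE !eqxx mulr1 big1 ?addr0 // => j jk.
  by rewrite !mxE eq_sym (negPf jk) mulr0.
apply: (emb_inj (emb_sval XT (@good_toric R))).
apply: (chart_uniq axes_dual (inc _ exy) (inc _ erefl)).
by move: exy; rewrite /q.
Qed.

(** A contracted irreducible curve lies over the origin, hence in the union of the
  eight curves, hence in one of them, and a proper closed irreducible subset of
  that one is a point. *)
Lemma exceptional_curveP (E : set Y) : exceptional_curve rho E <->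
  exists2 z, z \in exc_pts & E = exc_curve (vz z).
Proof.
split=> [[cE [x0 hx]]|[z hz ->]]; last first.
  split; first exact: exc_curve_curve.
  have [[x Ex] _] := exc_curve_irreducible R hz; exists (rho x) => y Ey.
  apply: (emb_inj (emb_sval (E8 R) (good_affine R 3))) => /=.
  by rewrite (exc_curve_contracted hz Ex) (exc_curve_contracted hz Ey).
have [closedE irE nopt _] := cE; have [[x Ex] _] := irE.
have hpi y : E y -> pi (sval y) = pi (sval x).
  by move=> Ey; have := hx _ Ey; rewrite -(hx _ Ex) => /(congr1 sval).
have [p0|nz] := pselect (pi (sval x) = 0); last first.
  case: (nopt x); apply/seteqP; split => [y Ey|y -> //].
  exact: off_origin nz (hpi _ Ey).
pose F (i : 'I_(size exc_pts)) := exc_curve (vz (nth apexz exc_pts i)).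
have EF : E `<=` \bigcup_i F i.
  move=> y Ey; have [z hz Ez] := over_origin (etrans (hpi _ Ey) p0).
  have iz : (index z exc_pts < size exc_pts)%N by rewrite index_mem.
  by exists (Ordinal iz) => //; rewrite /F /= nth_index.
have [i Ei] := irreducible_bigU gY (fun i => @exc_curve_closed R _) irE EF.
have hz : nth apexz exc_pts i \in exc_pts by exact: mem_nth.
exists (nth apexz exc_pts i) => //; apply: contrapT => ne.
have [_ _ _ H] := exc_curve_curve R hz; have [p ep] := H _ closedE irE Ei ne.
exact: nopt ep.
Qed.

End Exceptional.

(** * Colength *)

Section Colength.
Variable R : realType.
Local Notation C := R[i].
Variables (X : space R) (gX : good X) (p : X).

Lemma local_equation_unit (Z : set X) g h w : local_equation Z p g -> germ p w ->
  w p != 0 -> around p (fun y => h y = w y * g y) -> local_equation Z p h.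
Proof.
move=> [gg ag Hg] gw w0 hw; split.
- exact: (germ_eq gX (germM gX gw gg) hw).
- by apply: (around_mono2 gX _ hw ag) => y -> g0 /g0 ->; rewrite mulr0.
move=> k gk ak; have [a ga ha] := Hg k gk ak.
exists (fun y => a y * (w y)^-1); first by apply: (germM gX ga); exact: germV.
apply: (around_mono2 gX _ (around_and gX hw ha) (germ_neq0 gX gw w0)) => y [-> ->] wy.
by rewrite mulrA mulfVK.
Qed.

Lemma colength_unit w : germ p w -> w p != 0 -> colength p w 0.
Proof.
move=> gw w0; exists (fun i => [eta w]); split=> [[]//|h gh|c q _ _ []//].
exists (fun=> 0), (fun y => h y * (w y)^-1); split.
  by apply: (germM gX gh); exact: germV.
by apply: around_mono (germ_neq0 gX gw w0) => y wy; rewrite big_ord0 add0r mulrCA divff ?mulr1.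
Qed.

(** A uniformizer of a discrete valuation ring with coefficient field C: the
  powers below N form a basis of the quotient by its N-th power. *)
Lemma colength_power t w n : germ p t -> t p = 0 ->
  (forall h, germ p h -> exists c q, germ p q /\ around p (fun y => h y = c + t y * q y)) ->
  (forall q, germ p q -> around p (fun y => t y * q y = 0) -> around p (fun y => q y = 0)) ->
  germ p w -> w p != 0 -> colength p (fun y => t y ^+ n * w y) n.
Proof.
move=> gt t0 H1 H2 gw w0; exists (fun i y => t y ^+ i); split.
- by move=> i; exact: germX.
- move=> h gh.
  have [c [q [gq hq]]] : exists (c : 'I_n -> C) q, germ p q /\
      around p (fun y => h y = \sum_i c i * t y ^+ i + t y ^+ n * q y).
    elim: n h gh => [|n IH] h gh.
      exists (fun=> 0), h; split => //; apply: (around_all gX) => y.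
      by rewrite big_ord0 add0r expr0 mul1r.
    have [c0 [h' [gh' e1]]] := H1 h gh; have [c [q [gq e2]]] := IH h' gh'.
    exists (fun i => if unlift ord0 i is Some j then c j else c0), q; split => //.
    apply: (around_mono2 gX _ e1 e2) => y -> ->.
    rewrite big_ord_recl unlift_none expr0 mulr1 -addrA; congr (_ + _).
    rewrite mulrDr mulr_sumr exprS -mulrA; congr (_ + _).
    by apply: eq_bigr => i _; rewrite liftK lift0 exprS mulrCA.
  exists c, (fun y => q y * (w y)^-1); split; first by apply: (germM gX gq); exact: germV.
  apply: (around_mono2 gX _ hq (germ_neq0 gX gw w0)) => y -> wy.
  by rewrite -!mulrA [w y * _]mulrC mulfVK.
move=> c q gq.
have : forall (c : 'I_n -> C) v, germ p v ->
    around p (fun y => \sum_i c i * t y ^+ i = t y ^+ n * v y) -> forall i, c i = 0.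
  elim: n {c} => [|n IH] c v gv e; first by case.
  have c0 : c ord0 = 0.
    have := around_pt e; rewrite big_ord_recl /= expr0 mulr1 [t p ^+ n.+1]exprS !t0 !mul0r big1 ?addr0 //.
    by move=> i _; rewrite /bump /= exprS mul0r mulr0.
  have ci : forall i, c (lift ord0 i) = 0.
    apply: (IH (fun i => c (lift ord0 i)) v gv).
    have gd : germ p (fun y => \sum_i c (lift ord0 i) * t y ^+ i - t y ^+ n * v y).
      apply: (germB gX); last by apply: (germM gX) => //; exact: germX.
      by apply: (germ_sum gX) => i; apply: (germM gX); [exact: germ_cst|exact: germX].
    have := H2 _ gd => H; apply: around_mono (H _).
      by move=> y /eqP; rewrite subr_eq0 => /eqP.
    apply: around_mono e => y; rewrite big_ord_recl c0 mul0r add0r exprS -mulrA => e.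
    rewrite mulrBr -e mulr_sumr; apply/eqP; rewrite subr_eq0; apply/eqP.
    by apply: eq_bigr => i _; rewrite /= /bump /= exprS mulrCA.
  move=> i; case: (unliftP ord0 i) => [j ->|-> //]; exact: ci.
move=> H e; apply: (H c (fun y => w y * q y)); first exact: germM.
by apply: around_mono e => y ->; rewrite mulrA.
Qed.

End Colength.

(** * Self-intersection *)

(** The neighbour of the curve of a ray along an edge at that ray. *)
Definition far_end (a : edge * 'I_2) : zvec := sel (esim a.1) (oth a.2).

Lemma exc_edgesP z e j :
  (e, j) \in exc_edges z <-> e \in tropical_edges /\ gen (esim e) (w2 j) = vz z.
Proof.
have ez k : gen (esim e) (w2 k) = vz z <-> sel (esim e) k = z.
  by split=> [/vz_inj //|ek]; rewrite /gen /= ek.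
rewrite mem_cat ez; split.
  case/orP => /mapP [e' ]; rewrite mem_filter => /andP[/eqP h he] [-> ->]; by split.
case=> he hj; apply/orP; case: j hj => [[|[|//]]] h hj; [left|right]; apply/mapP; exists e; rewrite /= in hj.
- by rewrite mem_filter hj eqxx he.
- by apply: (congr1 (pair e)); exact: val_inj.
- by rewrite mem_filter hj eqxx he.
- by apply: (congr1 (pair e)); exact: val_inj.
Qed.

(** The neighbours of a ray u of the curve sum to 2u: minus this coefficient is
  the self-intersection. *)
Lemma far_end_check : all (fun z : zvec => uniq (map far_end (exc_edges z)) &&
  (foldr addz (0, 0, 0) (map far_end (exc_edges z)) == scalez 2 z)) exc_pts.
Proof. by vm_compute. Qed.

Lemma sum_far_end z m : z \in exc_pts ->
  \sum_(a <- exc_edges z) pr m (vz (far_end a)) = 2 * pr m (vz z).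
Proof.
move=> hz; have /allP/(_ _ hz)/andP[_ /eqP es] := far_end_check.
have prA u v : pr m (vz (addz u v)) = pr m (vz u) + pr m (vz v).
  by rewrite !(prC m) -prD; congr (pr _ m); apply/rowP => i; rewrite !mxE;
    case: i => [[|[|[|//]]]].
have -> : 2 * pr m (vz z) = pr m (vz (scalez 2 z)).
  by rewrite !(prC m) -prZ; congr (pr _ m); apply/rowP => i; rewrite !mxE;
    case: i => [[|[|[|//]]]].
rewrite -es; elim: (exc_edges z) => [|a s IH] /=; last by rewrite big_cons IH prA.
rewrite big_nil prC (_ : vz _ = 0) ?pr0 //; apply/rowP => i; rewrite !mxE.
by case: i => [[|[|[|//]]]].
Qed.

Section Intersection.
Variable R : realType.
Local Notation C := R[i].
Local Notation S := (@e8fan R).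
Local Notation X := (toric_variety S).
Local Notation A2 := (affine_space R 2).
Local Notation XT := (strict_transform S (E8 R)).
Local Notation Y := (sub_space XT).
Local Notation o2 := (ord_max : 'I_3).
Local Notation echart e := (toric_chart (cof (gen (esim e)) ea) : set X).
Local Notation exc_curve := (@exc_curve R).
Implicit Types (x : Y) (m u : N) (e : edge).

Let gX : good X := @good_toric R.
Let gA2 : good A2 := good_affine R 2.
Let gY : good Y := good_sub XT (@good_toric R).

Lemma strict_chr_germ s m x : S s -> toric_chart s (sval x) -> dual_lattice s m ->
  germ x (fun y : Y => chr (sval y) m).
Proof. by move=> Ss xs dm; apply: (emb_germr (emb_sval XT gX)) (chr_germ Ss xs dm). Qed.

(** On the axis in the chart the other coordinate generates the maximal ideal at
  the crossing, and it is not a zero divisor because the curve is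
  irreducible. *)
Lemma exc_curve_uniformizer e j z (p : sub_space (exc_curve (vz z))) : e \in tropical_edges -> z \in exc_pts ->
  gen (esim e) (w2 j) = vz z -> echart e (sval (sval p)) ->
  let t (y : sub_space (exc_curve (vz z))) := chr (sval (sval y)) (dgen (esim e) (w2 (oth j))) in
  t p = 0 -> forall w n, germ p w -> w p != 0 -> colength p (fun y => t y ^+ n * w y) n.
Proof.
move=> he hz ez pe t tp w n gw w0; set E := exc_curve (vz z) in p pe t tp w gw w0 *.
have gE : good (sub_space E) := good_sub E gY.
have [f [g [l hf]]] := strict_chart R he.
have tE y : t y = f (sval y) 0 (oth j) by rewrite hf.
have dD : @dual_lattice R (cof (gen (esim e)) ea) (dgen (esim e) (w2 (oth j))).
  by apply: dual_coord; exact: edge_dual.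
have gt (y : sub_space E) : echart e (sval (sval y)) -> germ y t.
  by move=> ye; exact: (emb_germr (emb_sval E gY) (strict_chr_germ (edge_fan R he) ye dD)).
have ec (y : sub_space E) : echart e (sval (sval y)) ->
    around y (fun y' : sub_space E => echart e (sval (sval y'))).
  move=> ye; exists (fun y' => echart e (sval (sval y'))); split => //.
  exact: (emb_openr (emb_sval E gY) (echart_open R he)).
have fj (y : sub_space E) : echart e (sval (sval y)) -> f (sval y) 0 j = 0.
  by move=> ye; apply/(exc_curve_coord he hz ez ye hf); exact: svalP.
refine (@colength_power R (sub_space E) gE p t w n (gt _ pe) tp _ _ gw w0).
- move=> h /(emb_germ (emb_sval E gY)) [h' gh' eh].
  have [q [gq eq]] := germ_max_ideal (li_germ l pe gh').
  exists (h' (sval p)), (fun y => q (oth j) (f (sval y))); split.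
    exact: (emb_germr (emb_sval E gY) (proj2 (li_fm l pe) _ (gq (oth j)))).
  have eq' := mor_around (emb_mor p (emb_sval E gY)) (li_around' gY l pe eq).
  apply: (around_mono2 gE _ (around_and gE (ec _ pe) eh) eq') => y [ye ->] [_ /=].
  rewrite (li_gf l ye) (li_gf l pe) => ->; congr (_ + _).
  rewrite (bigD1 (oth j)) //= big1 ?addr0 => [|i].
    by rewrite -!tE tp subr0.
  by rewrite -othE negbK => /eqP ->; rewrite !fj // subrr mul0r.
- move=> q gq tq; apply: contrapT => nq.
  have [W [oW Wp hW]] := around_and gE (germ_around gq) tq.
  have oO1 : zopen (W `&` [set y | q y != 0]).
    apply: (openP gE) => y [Wy qy]; have [gy _] := hW _ Wy.
    by apply: (around_mono2 gE _ (open_around oW Wy) (germ_neq0 gE gy qy)) => y1.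
  pose O2 := [set y : sub_space E | echart e (sval (sval y)) /\ t y != 0].
  have oO2 : zopen O2.
    apply: (openP gE) => y [ye ty].
    by apply: (around_mono2 gE _ (ec _ ye) (germ_neq0 gE (gt _ ye) ty)) => y1.
  have irE := irreducible_trace gY (@subset_refl _ E) (exc_curve_irreducible R hz).
  have [] := proj2 (proj1 (irreducibleP _) irE) _ _ oO1 oO2.
  + apply: contrapT => no; apply: nq; exists W; split => // y Wy.
    apply/eqP/negPn/negP => qy; apply: no; exists y; split; [exact: svalP|by split].
  + have [x [Ex xe tx]] := exc_curve_point R 1 he hz ez.
    exists (exist _ x Ex); split; first exact: Ex.
    by split => //; rewrite /t /= tx oner_neq0.
  + move=> y [_ [Wy qy] [_ ty]]; have [_ /eqP] := hW _ Wy.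
    by rewrite mulf_eq0 (negPf ty) (negPf qy).
Qed.

Lemma exc_curve_local_equation e j z (p : Y) : e \in tropical_edges -> z \in exc_pts ->
  gen (esim e) (w2 j) = vz z -> echart e (sval p) -> exc_curve (vz z) p ->
  local_equation (exc_curve (vz z)) p (fun x => chr (sval x) (dgen (esim e) (w2 j))).
Proof.
move=> he hz ez pe Ep; have [f [g [l hf]]] := strict_chart R he.
have := li_local_equation gY gA2 l pe (Z := exc_curve (vz z)) (Z' := [set z : A2 | z 0 j = 0])
  (fun x xe => exc_curve_coord he hz ez xe hf) (local_eq_coord _).
have -> : (fun z : A2 => z 0 j) \o f = fun x => chr (sval x) (dgen (esim e) (w2 j)).
  by apply/funext => x; rewrite /= hf.
by apply; apply/(exc_curve_coord he hz ez pe hf).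
Qed.

(** A character with a simple zero along the curve is, on the chart of an edge
  at the curve, the local equation times a power of the other coordinate
  times a unit. *)
Lemma section_monomial e j z m : e \in tropical_edges -> z \in exc_pts ->
  gen (esim e) (w2 j) = vz z -> pr m (vz z) = 1 ->
  exists D, [/\ @dual_lattice R (cof (gen (esim e)) ea) D,
    (forall x, echart e (sval x) -> chr (sval x) D != 0) &
    forall x, echart e (sval x) -> toric_chart (ray R (vz z)) (sval x) ->
      chr (sval x) (dgen (esim e) (w2 (oth j))) != 0 /\
      chr (sval x) m = chr (sval x) D *
        (chr (sval x) (dgen (esim e) (w2 (oth j))) ^ pr m (gen (esim e) (w2 (oth j))) *
         chr (sval x) (dgen (esim e) (w2 j)))].
Proof.
move=> he hz ez m1; have hD := edge_dual he.
pose D1 := dgen (esim e) (w2 j); pose D2 := dgen (esim e) (w2 (oth j)).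
pose n := pr m (gen (esim e) (w2 (oth j))).
pose D3 := pr m (gen (esim e) o2) *: dgen (esim e) o2.
have em : m = D3 + (n *: D2 + D1).
  rewrite [LHS](unimod_expand hD m) (bigD1 o2) //=; congr (_ + _).
  rewrite (bigD1 (w2 (oth j))) /=; last exact: ea_w2.
  rewrite -/n -/D2; congr (_ + _); rewrite (big_pred1 (w2 j)) => [|k] /=.
    by rewrite ez m1 scale1r.
  have [->|k2] := eqVneq k o2; first by rewrite /= eq_sym (negPf (ea_w2 j)).
  by have [i ->] := w2_onto k2; rewrite /= !(inj_eq w2_inj) -othE negbK.
have dD3 k : ea k -> pr D3 (gen (esim e) k) = 0.
  by move=> ak; rewrite prZ (proj2 hD) eq_sym (negPf (ak : k != o2)) mulr0.
have pD3 x : echart e (sval x) -> perp (orb (sval x)) D3.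
  by move=> xe; rewrite (chart_orb hD xe) perp_cof => k /andP[/dD3].
exists D3; split.
- by apply/dual_cof => k /dD3 ->.
- by move=> x xe; apply/chr_neq0; exact: pD3.
move=> x xe xr.
have pD2 : perp (orb (sval x)) D2.
  move=> w ow; have := chart_sub (ray_fan R hz) xr ow; rewrite -ez rayE.
  have : perp (@cof R (gen (esim e)) (pred1 (w2 j))) D2.
    rewrite perp_cof => k /eqP ->; rewrite (proj2 hD) (inj_eq w2_inj).
    by rewrite (negPf (oth_neq j)).
  by move=> h /h.
split; first exact/chr_neq0.
by rewrite -/n em (chr_perpD _ (pD3 _ xe)) (chr_perpD _ (perpZ n pD2)) (chrZ n pD2).
Qed.

Lemma ray_local_equation z m (p : Y) : z \in exc_pts -> pr m (vz z) = 1 ->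
  toric_chart (ray R (vz z)) (sval p) -> exc_curve (vz z) p ->
  local_equation (exc_curve (vz z)) p (fun x => chr (sval x) m).
Proof.
move=> hz m1 pr0 Ep; have [e [j [he pe ez]]] := exc_curve_edge hz Ep.
have [D [dD D0 hD]] := section_monomial he hz ez m1.
have [t0 _] := hD _ pe pr0.
have dual k : @dual_lattice R (cof (gen (esim e)) ea) (dgen (esim e) k).
  by apply: dual_coord; exact: edge_dual.
pose w x := chr (sval x) D * chr (sval x) (dgen (esim e) (w2 (oth j))) ^
  pr m (gen (esim e) (w2 (oth j))).
apply: (local_equation_unit gY (exc_curve_local_equation he hz ez pe Ep) (w := w)).
- apply: (germM gY); first exact: strict_chr_germ (edge_fan R he) pe dD.
  apply: (germXz gY) => //; exact: strict_chr_germ (edge_fan R he) pe (dual _).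
- by rewrite mulf_neq0 ?expfz_neq0 ?D0.
apply: (around_mono2 gY _ (open_around (echart_open R he) pe) (open_around (ray_open R hz) pr0)).
by move=> y ye yr; rewrite (proj2 (hD _ ye yr)) mulrA.
Qed.

Lemma exc_curve_section_order e j z m (p : sub_space (exc_curve (vz z))) : e \in tropical_edges ->
  z \in exc_pts -> gen (esim e) (w2 j) = vz z -> pr m (vz z) = 1 ->
  echart e (sval (sval p)) ->
  section_order [set x : Y | toric_chart (ray R (vz z)) (sval x)]
    (fun x => chr (sval x) m) p
    (if chr (sval (sval p)) (dgen (esim e) (w2 (oth j))) == 0
     then - pr m (gen (esim e) (w2 (oth j))) else 0).
Proof.
move=> he hz ez m1 pe; have [D [dD D0 hD]] := section_monomial he hz ez m1.
set E := exc_curve (vz z) in p pe *; have gE : good (sub_space E) := good_sub E gY.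
pose u x := chr (sval x) D; pose t x := chr (sval x) (dgen (esim e) (w2 (oth j))).
pose n := pr m (gen (esim e) (w2 (oth j))).
have gt : germ (sval p) t.
  by apply: strict_chr_germ (edge_fan R he) pe _; apply: dual_coord; exact: edge_dual.
have gu : germ (sval p) u by apply: strict_chr_germ (edge_fan R he) pe dD.
(* a section of negative order is a quotient: h t^B = e t^A u with order A - B *)
have [A [B nAB]] : exists A B : nat, n = A%:Z - B%:Z.
  by case: (n) => N; [exists N, 0%N; rewrite subr0|exists 0%N, N.+1; rewrite sub0r NegzE].
have sg h : germ (sval p) h -> germ p (h \o sval) := @emb_germr _ _ _ _ (emb_sval E gY) p h.
have col c (w : sub_space E -> C) : germ p w -> w p != 0 ->
    colength p (fun y => t (sval y) ^+ c * w y) (if t (sval p) == 0 then c else 0%N).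
  move=> gw w0; case: eqP => [t0|/eqP t0].
    exact: (exc_curve_uniformizer he hz ez pe t0 c gw w0).
  apply: (colength_unit gE); last by rewrite mulf_neq0 // expf_neq0.
  by apply: (germM gE _ gw); apply: (germX gE); exact: sg.
exists (fun x => chr (sval x) (dgen (esim e) (w2 j))),
  (fun y => t y ^+ A * u y), (fun y => t y ^+ B * 1),
  (if t (sval p) == 0 then A else 0%N), (if t (sval p) == 0 then B else 0%N); split.
- exact: exc_curve_local_equation he hz ez pe (svalP p).
- split; first by apply: (germM gY) => //; exact: germX.
  by apply: (germM gY); [exact: germX|exact: germ_cst].
- exists (fun y : Y => echart e (sval y)); split => //; first exact: echart_open.
  move=> y ye /= yU; have [t0 ->] := hD _ ye yU.
  have tA : t y ^+ A = t y ^ n * t y ^+ B.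
    by rewrite !exprnP -expfzDr // nAB subrK.
  by rewrite tA -/n -/(t y) -/(u y); ring.
- split; first by apply: (col A (u \o sval)); [exact: sg|exact: D0].
  by apply: (col B); [exact: germ_cst gE p 1|exact: oner_neq0].
- rewrite -/(t (sval p)); case: eqP => _; last by rewrite subrr.
  by rewrite -/n nAB opprB.
Qed.

End Intersection.

Section SelfIntersection.
Variable R : realType.
Local Notation S := (@e8fan R).
Local Notation X := (toric_variety S).
Local Notation XT := (strict_transform S (E8 R)).
Local Notation Y := (sub_space XT).
Local Notation echart e := (toric_chart (cof (gen (esim e)) ea) : set X).
Local Notation exc_curve := (@exc_curve R).
Implicit Types (x : Y) (m u : N) (e : edge).

Let gY : good Y := good_sub XT (@good_toric R).

Lemma edge_gen_vertex e k : e \in tropical_edges -> ea k ->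
  exists t i, t \in tris /\ gen (esim e) k = gen t i.
Proof. by move=> he ak; have [t tt h] := edge_in_tri he; have [i ei] := h k ak; exists t, i. Qed.

Lemma edge_gen_inj e k k' : e \in tropical_edges -> gen (esim e) k = gen (esim e) k' -> k = k'.
Proof.
move=> he h; have [_ hD] := edge_dual he; have := hD k k'.
by rewrite -h hD eqxx; case: eqP.
Qed.

Lemma edge_far e j z : e \in tropical_edges -> gen (esim e) (w2 j) = vz z ->
  vz (far_end (e, j)) <> vz z.
Proof.
move=> he <- h; have /w2_inj /eqP := @edge_gen_inj e (w2 (oth j)) (w2 j) he h.
by rewrite (negPf (oth_neq j)).
Qed.

(** This identifies the neighbour at a crossing independently of the chart. *)
Lemma echart_vertex e j e' k x : e \in tropical_edges -> e' \in tropical_edges -> echart e (sval x) ->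
  ea k -> orb (sval x) (lat R (gen (esim e') k)) ->
  gen (esim e') k = gen (esim e) (w2 j) \/ gen (esim e') k = vz (far_end (e, j)).
Proof.
move=> he he' xe ak ox; have [t [i [tt ei]]] := edge_gen_vertex he' ak.
have := chart_sub (edge_fan R he) xe ox; rewrite ei => /(edge_vertex he tt) [k' ak' ->].
have [i' ->] := w2_onto ak'; have [->|] := eqVneq i' j; first by left.
by rewrite othE => /eqP ->; right.
Qed.

Lemma crossing_uniq e x y : e \in tropical_edges -> echart e (sval x) -> echart e (sval y) ->
  (forall k, chr (sval x) (dgen (esim e) (w2 k)) = 0) ->
  (forall k, chr (sval y) (dgen (esim e) (w2 k)) = 0) -> x = y.
Proof.
move=> he xe ye hx hy; have [f [g [l hf]]] := strict_chart R he.
rewrite -(li_gf l xe) -(li_gf l ye); congr (g _).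
by apply/rowP => k; rewrite !hf hx hy.
Qed.

Lemma chr_both e j x : chr (sval x) (dgen (esim e) (w2 j)) = 0 ->
  chr (sval x) (dgen (esim e) (w2 (oth j))) = 0 ->
  forall k, chr (sval x) (dgen (esim e) (w2 k)) = 0.
Proof. by move=> h1 h2 k; have [->//|] := eqVneq k j; rewrite othE => /eqP ->. Qed.

(** A character that takes the value 1 on the ray gives a rational section whose
  order is 0 except at the crossings with the divisors of the neighbours, where
  it is minus the value of the character on the neighbour. *)
Lemma self_intersection_exc z : z \in exc_pts -> self_intersection (exc_curve (vz z)) (-2).
Proof.
move=> hz; set E := exc_curve (vz z); have gE : good (sub_space E) := good_sub E gY.
pose s := exc_edges z; pose a (i : 'I_(size s)) := tnth (in_tuple s) i.
have ha i : (a i).1 \in tropical_edges /\ gen (esim (a i).1) (w2 (a i).2) = vz z.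
  by apply/exc_edgesP; rewrite -surjective_pairing; exact: mem_tnth.
have [[x0 Ex0] _] := exc_curve_irreducible R hz.
have [e0 [j0 [he0 _ ez0]]] := exc_curve_edge hz Ex0.
pose m := dgen (esim e0) (w2 j0).
have m1 : pr m (vz z) = 1 by rewrite -ez0 (proj2 (edge_dual he0)) eqxx.
have /choice [q hq] : forall i, exists p : sub_space E,
    echart (a i).1 (sval (sval p)) /\ chr (sval (sval p)) (dgen (esim (a i).1) (w2 (oth (a i).2))) = 0.
  move=> i; have [he ez] := ha i; have [x [Ex xe cx]] := exc_curve_point R 0 he hz ez.
  by exists (exist _ x Ex).
have Eorb (p : sub_space E) : orb (sval (sval p)) (lat R (vz z)).
  by apply/(exc_curveE _ hz); exact: svalP.
have q0 i k : chr (sval (sval (q i))) (dgen (esim (a i).1) (w2 k)) = 0.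
  have [he ez] := ha i; have [qe qc] := hq i; apply: chr_both qc _.
  by apply/(chart_divisor (edge_dual he) qe (ea_w2 _)); rewrite ez.
have oq i : orb (sval (sval (q i))) (lat R (vz (far_end (a i)))).
  have [he ez] := ha i; have [qe qc] := hq i.
  exact/(chart_divisor (edge_dual he) qe (ea_w2 (oth (a i).2))).
have /allP/(_ _ hz)/andP[us _] := far_end_check.
have injq : injective q.
  move=> i i' eq; have [he ez] := ha i; have [he' ez'] := ha i'.
  have [qe' _] := hq i'; have := oq i; rewrite eq => o1.
  have [] := @echart_vertex (a i').1 (a i').2 (a i).1 (w2 (oth (a i).2)) _ he' he qe' (ea_w2 _) o1.
    by rewrite ez' => /(edge_far he ez).
  move=> /vz_inj ff; apply: val_inj.
  have sz (j : 'I_(size s)) : (j < size (map far_end s))%N by rewrite size_map.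
  apply/eqP; rewrite -(nth_uniq z (sz i) (sz i') us); apply/eqP.
  by move: ff; rewrite !(nth_map (e0, j0)) // /a !(tnth_nth (e0, j0)) -surjective_pairing.
pose ord (p : sub_space E) : int :=
  \sum_i (if `[< p = q i >] then - pr m (vz (far_end (a i))) else 0).
have ordq i : ord (q i) = - pr m (vz (far_end (a i))).
  rewrite /ord (bigD1 i) //= asboolT // big1 ?addr0 // => i' ii'.
  by rewrite asboolF // => /injq e; rewrite e eqxx in ii'.
exists [set x : Y | toric_chart (ray R (vz z)) (sval x)], (fun x => chr (sval x) m), ord,
  (size s), q; split.
- split; first exact: ray_open.
    apply: (regular_germ gY); first exact: ray_open.
    move=> x xr; apply: strict_chr_germ (ray_fan R hz) xr _.
    rewrite -ez0 rayE; apply/dual_cof => k /eqP ->.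
    by rewrite (proj2 (edge_dual he0)) eqxx.
  have [x [Ex xe cx]] := exc_curve_point R 1 he0 hz ez0; exists x; split => //.
  by apply: (orb_ray he0 hz ez0 xe); rewrite cx oner_neq0.
- by move=> p; exact: ray_local_equation.
- move=> p; have [[i ->]|np] := pselect (exists i, p = q i).
    have [he ez] := ha i; have [qe qc] := hq i.
    by have := exc_curve_section_order he hz ez m1 qe; rewrite qc eqxx -ordq.
  have -> : ord p = 0.
    by rewrite /ord big1 // => i _; rewrite asboolF // => e; apply: np; exists i.
  have [e [j [he pe ez]]] := exc_curve_edge hz (svalP p).
  have := exc_curve_section_order he hz ez m1 pe; case: eqP => // c0 _.
  have /(tnthP (in_tuple s)) [i ei] : (e, j) \in s by apply/exc_edgesP.
  case: np; exists i; apply: (emb_inj (emb_sval E gY)).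
  have [qe _] := hq i; have := q0 i; rewrite /a -ei /= in qe * => qc.
  apply: (crossing_uniq he pe qe _ qc); apply: chr_both c0.
  by apply/(chart_divisor (edge_dual he) pe (ea_w2 j)); rewrite ez.
- split => // p np; apply: contrapT => no; apply: np.
  by rewrite /ord big1 // => i _; rewrite asboolF // => e; apply: no; exists i.
- under eq_bigr do rewrite ordq.
  rewrite sumrN -(big_tnth _ _ s xpredT (fun b => pr m (vz (far_end b)))).
  by rewrite sum_far_end // m1.
Qed.

End SelfIntersection.

(** * The resolution graph *)

Lemma exc_uniq : uniq exc_pts. Proof. by vm_compute. Qed.

(** Two exceptional curves meet where an edge of the fan joins their rays. *)
Definition joined (z z' : zvec) : bool :=
  has (fun e => ((esim e).1.1 == z) && ((esim e).1.2 == z') ||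
                ((esim e).1.1 == z') && ((esim e).1.2 == z)) tropical_edges.

Lemma joinedP z z' : joined z z' <-> exists e j,
  [/\ e \in tropical_edges, gen (esim e) (w2 j) = vz z & gen (esim e) (w2 (oth j)) = vz z'].
Proof.
split=> [/hasP [e he /orP[]/andP[/eqP h /eqP h']]|[e [j [he hj hj']]]].
- by exists e, 0; rewrite -h -h'.
- by exists e, 1; rewrite -h -h'.
apply/hasP; exists e => //; move: j hj hj' => [[|[|//]]] h /vz_inj /= -> /vz_inj /= ->;
  by rewrite !eqxx ?orbT.
Qed.

Section Graph.
Variable R : realType.
Local Notation S := (@e8fan R).
Local Notation X := (toric_variety S).
Local Notation XT := (strict_transform S (E8 R)).
Local Notation Y := (sub_space XT).
Local Notation echart e := (toric_chart (cof (gen (esim e)) ea) : set X).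
Local Notation exc_curve := (@exc_curve R).
Local Notation rho := (@surface_map R).
Implicit Types (x : Y) (m u : N) (e : edge).

Lemma exc_curve_inj z z' : z \in exc_pts -> z' \in exc_pts -> exc_curve (vz z) = exc_curve (vz z') -> z = z'.
Proof.
move=> hz hz' eE; have [[x0 Ex0] _] := exc_curve_irreducible R hz.
have [e [j [he _ ez]]] := exc_curve_edge hz Ex0; have [x [Ex xe cx]] := exc_curve_point R 1 he hz ez.
have ox : orb (sval x) (lat R (vz z')) by apply/(exc_curveE _ hz'); rewrite -eE.
have [t [k [tt ek _]]] := exc_vertex hz; have [t' [k' [tt' ek' _]]] := exc_vertex hz'.
have xr : toric_chart (ray R (vz z)) (sval x).
  by apply: (orb_ray he hz ez xe); rewrite cx oner_neq0.
have := chart_sub (ray_fan R hz) xr ox.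
rewrite ek' ek rayE => /(vertex_in_face tt' tt) [i /eqP -> e'].
by apply: vz_inj; rewrite ek ek' e'.
Qed.

(** A point on two of the curves lies in the chart of every edge that joins their
  rays, because its own edge chart belongs to an edge with the same ends. *)
Lemma common_chart e j z z' x : e \in tropical_edges -> z \in exc_pts -> z' \in exc_pts ->
  gen (esim e) (w2 j) = vz z -> gen (esim e) (w2 (oth j)) = vz z' ->
  exc_curve (vz z) x -> exc_curve (vz z') x -> echart e (sval x).
Proof.
move=> he hz hz' ez ez' Ex /(exc_curveE _ hz') ox'.
have [e' [j' [he' xe' ej']]] := exc_curve_edge hz Ex.
apply: chart_of_sub; first exact: edge_fan.
have f' : vz (far_end (e', j')) = vz z'.
  have := @echart_vertex R e' j' e (w2 (oth j)) x he' he xe' (ea_w2 _); rewrite ez'.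
  case=> // h; have := @edge_gen_inj e (w2 (oth j)) (w2 j) he.
  by rewrite ez ez' h ej' => /(_ erefl) /w2_inj /eqP; rewrite (negPf (oth_neq j)).
move=> w /(chart_sub (edge_fan R he') xe'); apply: cof_sub => k ak.
have [i ->] := w2_onto ak; have [->|] := eqVneq i j'.
  by exists (w2 j); [exact: ea_w2|rewrite ej' ez].
rewrite othE => /eqP ->; exists (w2 (oth j)); first exact: ea_w2.
by rewrite ez' -f'.
Qed.

(** A common point of two curves has vanishing coordinates in the chart of the
  joining edge. *)
Lemma exc_curve_meet z z' : z \in exc_pts -> z' \in exc_pts -> z <> z' ->
  exc_curve (vz z) `&` exc_curve (vz z') #= `I_(joined z z').
Proof.
move=> hz hz' zz'; case: (boolP (joined z z')) => [/joinedP [e [j [he ez ez']]]|nj].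
  have [x [Ex xe cx]] := exc_curve_point R 0 he hz ez.
  suff -> : exc_curve (vz z) `&` exc_curve (vz z') = [set x] by exact: card_set1.
  have both y : echart e (sval y) -> exc_curve (vz z) y -> exc_curve (vz z') y <->
      chr (sval y) (dgen (esim e) (w2 (oth j))) = 0.
    move=> ye _; rewrite exc_curveE // -ez'.
    exact: (chart_divisor (edge_dual he) ye (ea_w2 (oth j))).
  have zero y : echart e (sval y) -> exc_curve (vz z) y ->
      chr (sval y) (dgen (esim e) (w2 j)) = 0.
    by move=> ye /(exc_curveE _ hz) oy; apply/(chart_divisor (edge_dual he) ye (ea_w2 j)); rewrite ez.
  have Ex' : exc_curve (vz z') x by apply/both.
  apply/seteqP; split => [y [Ey Ey']|y ->] //.
  have ye := common_chart he hz hz' ez ez' Ey Ey'.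
  apply: (crossing_uniq he ye xe); apply: chr_both.
  - exact: zero.
  - exact/both.
  - exact: zero.
  - exact/both.
suff -> : exc_curve (vz z) `&` exc_curve (vz z') = set0 by rewrite II0; exact: card_eq00.
apply/seteqP; split => // x [Ex Ex']; have [e [j [he xe ez]]] := exc_curve_edge hz Ex.
case/negP: nj; apply/joinedP; exists e, j; split => //.
have ox := proj1 (exc_curveE _ hz') Ex'.
have [e' [j' [he' xe' ez']]] := exc_curve_edge hz' Ex'; rewrite -ez' in ox.
have [] := @echart_vertex R e j e' (w2 j') x he he' xe (ea_w2 _) ox.
  by rewrite ez ez' => /vz_inj /esym.
by rewrite ez' => ->.
Qed.

Definition e8_graph : weighted_graph :=
  @WeightedGraph 'I_(size exc_pts) (fun=> -2) (fun v w =>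
    (v != w) && joined (nth apexz exc_pts v) (nth apexz exc_pts w) : nat).

Lemma e8_resolution_graph : resolution_graph rho e8_graph.
Proof.
have hz (v : 'I_(size exc_pts)) : nth apexz exc_pts v \in exc_pts by exact: mem_nth.
exists (fun v : 'I_(size exc_pts) => exc_curve (vz (nth apexz exc_pts v))); split.
- move=> v w /(exc_curve_inj (hz v) (hz w)) /eqP.
  by rewrite nth_uniq ?exc_uniq // => /eqP /val_inj.
- move=> D; rewrite exceptional_curveP; split=> [[z zz ->]|[v ->]]; last by exists (nth apexz exc_pts v).
  have iz : (index z exc_pts < size exc_pts)%N by rewrite index_mem.
  by exists (Ordinal iz); rewrite /= nth_index.
- by move=> v; exact: self_intersection_exc.
- move=> v w vw; rewrite /=; have -> : v != w by exact/eqP.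
  apply: exc_curve_meet => // /eqP; rewrite nth_uniq ?exc_uniq // => /eqP /val_inj.
  exact: vw.
- by move=> v; rewrite /= eqxx.
Qed.

Lemma surface_minimal : minimal_resolution rho.
Proof.
split; first exact: surface_resolution.
by move=> E /exceptional_curveP [z hz ->] _; exists (-2) => //; exact: self_intersection_exc.
Qed.

Lemma component_irreducible (Z : space R) (A E : set Z) : irreducible A ->
  component A E <-> E = A.
Proof.
move=> irA; split=> [[EA irE max]|->]; first by rewrite -(max A).
by split => // B BA _ AB; apply/seteqP.
Qed.

End Graph.

Theorem theorem4p31 (R : realType) :
  exists S : set (set 'rV[R]_3),
    [/\ regular_fan S, fan_support S = orthant R,
        refines S (groebner_fan (E8_poly R)) &
        rays S = [set ray R u | u in groebner_points (E8_poly R)]] /\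
    (embedded_resolution S (E8 R) /\
     forall C, max_groebner_cones (E8_poly R) C ->
       forall u, profile_points C u -> irreducible_in C u) /\
    (forall u, interior_skeleton_points (E8_poly R) u ->
       strict_transform S (E8 R) `&` toric_divisor S u !=set0) /\
    exists rho : sub_space (strict_transform S (E8 R)) -> sub_space (E8 R),
      [/\ (forall x, sval (rho x) = toric_morphism S (sval x)),
          resolution rho,
          (forall E : set (sub_space (strict_transform S (E8 R))),
             exceptional_curve rho E <->
             exists2 u, interior_skeleton_points (E8_poly R) u &
               component (trace (toric_divisor S u)) E) &
          exists G : weighted_graph,
            resolution_graph rho G /\
            minimal_resolution_graph (sub_space (E8 R)) G].
Proof.
exists (@e8fan R); split; last split; last split.
- by split; [exact: e8fan_regular|exact: e8fan_support|exact: e8fan_refines|exact: e8fan_rays].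
- split; first exact: E8_embedded.
  by move=> C /max_groebnerP [a ->] u; exact: profile_irreducible.
- move=> u /exc_pointsP [z hz ->]; have [[x Ex] _] := exc_curve_irreducible R hz.
  by exists (sval x); split => //; exact: svalP.
exists (@surface_map R); split => //; first exact: surface_resolution.
  move=> E; rewrite exceptional_curveP; split=> [[z hz ->]|[u /exc_pointsP [z hz ->]]].
    exists (vz z); first by apply/exc_pointsP; exists z.
    by apply/component_irreducible => //; exact: exc_curve_irreducible.
  by move=> /(component_irreducible _ (exc_curve_irreducible R hz)) ->; exists z.
exists e8_graph; split; first exact: e8_resolution_graph.
exists (sub_space (strict_transform (@e8fan R) (E8 R))), (@surface_map R); split.
  exact: surface_minimal.
exact: e8_resolution_graph.
Qed.
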